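(* Let $k$ be an even integer with $k+2\geq7$. Let $\mu:S_{k+2}\to S_k$ be the linear map sending $G=\sum_{n\geq1}b(n)q^n$ to $\mu(G)=\sum_{n\geq1}a_1(n)q^n$, where $$a_1(n)=\frac{k(k-1)}{4\pi n}\left(b(n)\left(\frac{k}{12n}-1\right)-2n^kk\,L_{E_2,G,n}(k+1)\right).$$ If $g=\sum_{l\geq1}b(l)q^l\in\ker(\mu)$ is a cusp form of weight $k+2$ such that $b(l)\in\mathbb{Q}$ for all $l\leq\dim(S_{k+2})+1$, then $L_{E_2,g,n}(k+1)\in\mathbb{Q}$ for all $n\in\mathbb{N}$. In fact, $$L_{E_2,g,n}(k+1)=\frac{k-12n}{24n^{k+1}k}\,b(n).$$
   Context: $S_k$ is the space of cusp forms of weight $k$ on $SL_2(\mathbb{Z})$, $q=e^{2\pi i z}$, $\mathbb{N}$ denotes the positive integers, $\sigma(n)=\sum_{d\mid n}d$. For $G=\sum_{n\geq1}b(n)q^n\in S_{k+2}$ and an integer $n\geq1$, the shifted Dirichlet series is $L_{E_2,G,n}(w)=\sum_{m\geq1}\frac{\sigma(m)b(n+m)}{(n+m)^w}$; it converges absolutely at $w=k+1$. The series $\mu(G)$ is a cusp form of weight $k$, so $\mu$ is well defined; up to a scalar it is the adjoint, for the Petersson inner product, of the Ramanujan-Serre derivative $f\mapsto \frac{1}{2\pi i}\frac{df}{dz}-\frac{k}{12}E_2f$ from $S_k$ to $S_{k+2}$, where $E_2=1-24\sum_{n\geq1}\sigma(n)q^n$. *)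

(* Defs.v *)
From mathcomp Require Import all_boot all_order all_algebra complex.
From mathcomp Require Import boolp classical_sets functions reals topology.
From mathcomp Require Import normedtype sequences derive exp trigo.

Set Implicit Arguments.
Unset Strict Implicit.
Unset Printing Implicit Defensive.

Import Order.TTheory GRing.Theory Num.Theory.
Import numFieldNormedType.Exports.

Local Open Scope classical_set_scope.
Local Open Scope ring_scope.
Local Open Scope complex_scope.

Section LinearAlgebra.
Variables (K : fieldType) (V : lmodType K).

Definition is_basis (S : set V) (d : nat) (e : 'I_d -> V) : Prop :=
  [/\ forall i, S (e i),
      forall c : 'I_d -> K, \sum_i c i *: e i = 0 -> forall i, c i = 0
    & forall v, S v -> exists c : 'I_d -> K, v = \sum_i c i *: e i].

(* The default 0 is only used when S has no finite basis. *)
Definition dimension (S : set V) : nat :=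
  xget 0%N [set d | exists e : 'I_d -> V, is_basis S e].

End LinearAlgebra.

Definition sigma (n : nat) : nat := \sum_(d <- divisors n) d.

Section CuspForms.
Variable R : realType.

(* R[i] with the metric topology of the modulus, over the scalar field R[i]:
   derivable below is complex differentiability. *)
Local Notation C := (R[i]^o).

Definition cexp (z : C) : C :=
  (expR (complex.Re z) * cos (complex.Im z))
    +i* (expR (complex.Re z) * sin (complex.Im z)).

(* x ^ w for real x > 0 and complex w, with the real determination of ln x. *)
Definition cpow (x : R) (w : C) : C := cexp (w * (ln x)%:C).

Definition qpar (z : C) : C := cexp (2 * 'i * pi%:C * z).

Definition upper_half_plane : set C := [set z : C | 0 < complex.Im z].
Local Notation HH := upper_half_plane.

(* b 0 plays no role here: the expansion has no constant term. *)
Definition has_cusp_expansion (f : C -> C) (b : nat -> C) : Prop :=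
  forall z, HH z ->
    (\sum_(1 <= n < N) b n * qpar z ^+ n : C) @[N --> \oo] --> f z.

(* Functions on the upper half-plane are represented by their extension by 0
   to C, so that they form a subspace of C -> C in which equality is equality
   on the upper half-plane. The last condition says that f is holomorphic and
   vanishes at the cusp. *)
Definition cusp_form (k : nat) : set (C -> C) :=
  [set f : C -> C | [/\
    forall z, ~ HH z -> f z = 0,
    forall z, HH z -> derivable f z 1,
    forall (a b c d : int) (z : C), a * d - b * c = 1 -> HH z ->
      f ((a%:~R * z + b%:~R) / (c%:~R * z + d%:~R))
        = (c%:~R * z + d%:~R) ^+ k * f z
  & exists b : nat -> C, has_cusp_expansion f b]].

(* The n-th Fourier coefficient of f, relevant for n >= 1 only. *)
Definition fourier_coef (f : C -> C) : nat -> C :=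
  xget (fun=> 0) [set b | has_cusp_expansion f b].

Definition L_E2 (G : C -> C) (n : nat) (w : C) : C :=
  lim ((\sum_(1 <= m < N)
    (sigma m)%:R * fourier_coef G (n + m) / cpow (n + m)%:R w : C)
      @[N --> \oo]).

Definition mu_coef (k : nat) (G : C -> C) (n : nat) : C :=
  k%:R * (k%:R - 1) / (4 * pi%:C * n%:R) *
  (fourier_coef G n * (k%:R / (12 * n%:R) - 1)
   - 2 * n%:R ^+ k * k%:R * L_E2 G n (k%:R + 1)).

Definition mu (k : nat) (G : C -> C) : C -> C := fun z =>
  if 0 < complex.Im z then
    lim ((\sum_(1 <= n < N) mu_coef k G n * qpar z ^+ n : C) @[N --> \oo])
  else 0.

Definition ker_mu (k : nat) : set (C -> C) :=
  [set G | cusp_form (k + 2) G /\ mu k G = 0].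

Definition is_rational (x : C) : Prop := exists r : rat, x = ratr r.

End CuspForms.

(* Main.v *)
Require Import Defs.
From mathcomp Require Import all_boot all_order all_algebra complex.
From mathcomp Require Import boolp classical_sets functions reals topology.
From mathcomp Require Import normedtype sequences derive exp trigo.
From mathcomp Require Import ring lra zify.

(** Let [g] be in the kernel of [mu]. If the series [mu g] converges in the whole
    half-plane, uniqueness of [q]-expansions makes each of its coefficients
    [a_1 n] vanish, and [a_1 n = 0] solved for [L_{E_2,g,n}(k + 1)] is the formula
    of the theorem ([kernel_formula]). Convergence holds because Hecke's bound for
    the [b n] bounds [L_{E_2,g,n}(k + 1)] uniformly in [n] ([cusp_coef_bound],
    [L_E2_bound], [mu_coef_eq0]).

    By the formula, the values are rational as soon as every [b n] is, while only
    the coefficients up to [dim S_(k+2) + 1] are assumed rational. The rest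
    follows from the structure of the forms of level one: in weight [w] there is a
    family of forms with rational coefficients, the [i]-th one starting with
    [q ^ i], that determines every form by its first coefficients
    ([echelon_exists], [echelon_rational]), and all its members but the first are
    a basis of the cusp forms ([echelon_dimension]). The family is built by
    induction on [w] from an Eisenstein series [E_4 ^ a E_6 ^ b] and [Delta] times
    the family of weight [w - 12]. This uses that [Delta] vanishes nowhere in the
    half-plane, that no nonzero form has negative weight, and that the three
    forms are modular with rational coefficients.

    A form is represented by the sequence of its coefficients ([mform]), and only
    its behaviour under [z -> - 1 / z] is recorded; Euclid's algorithm extends
    this to the modular group ([mform_moebius], [cusp_form_psum],
    [cusp_form_expansion]).

    Modularity starts from the law of [E_2] ([sigma_law]): Tannery's theorem
    turns finite sums over roots of unity into the partial fractions of the
    cotangent ([cot_sum]) and Lipschitz's formula ([lipschitz2]), and the two orders of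
    summation of the double series [(m z + n) ^ (-2)] are compared. Then [Delta]
    is defined through its logarithmic derivative [E_2], so that [Delta (- 1 / z)]
    and [z ^ 12 Delta z] satisfy the same linear differential equation
    ([mform_delta]); [E_4] and [E_6] are differential polynomials in [E_2].

    For the growth of a cusp form [f] of weight [w], [|f| y ^ (w / 2)] is invariant
    and bounded where [y >= 1 / 2], hence everywhere, as inversion raises every
    lower point of a suitable vertical strip ([bound_of_invariant]). Averages over
    roots of unity extract the coefficients ([coef_bound]), which gives Hecke's
    bound and excludes negative weights ([hecke_bound], [negative_weight]). *)

Import Order.TTheory GRing.Theory Num.Theory.
Import numFieldNormedType.Exports.

Local Open Scope classical_set_scope.
Local Open Scope ring_scope.
Local Open Scope complex_scope.

Set Implicit Arguments.
Unset Strict Implicit.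
Unset Printing Implicit Defensive.

(** * The real modulus and absolutely convergent series *)

(** Neighbourhood filters of [R[i]^o], for instance resolution. *)
#[local] Instance nbhsC_filter (R : realType) (z : R[i]^o) :
  @ProperFilter (R[i]^o) (nbhs z).
Proof. exact: nbhs_pfilter. Qed.

#[local] Instance dnbhsC_filter (R : realType) (z : R[i]^o) :
  @ProperFilter (R[i]^o) (z^').
Proof. exact: Proper_dnbhs_numFieldType. Qed.

Section ComplexModulus.
Variable R : realType.
Local Notation C := (R[i]^o).

(** The modulus as a real number: the norm of [R[i]] takes its values in
    [R[i]], where the order is only partial. Sealed, as are the sums and [nome]
    below, to keep unification from unfolding it. *)
Fact nm_key : unit. Proof. exact: tt. Qed.
Definition nm : C -> R := locked_with nm_key (@ComplexField.Normc.normc R).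

Lemma nm_unlock (z : C) : nm z = ComplexField.Normc.normc z.
Proof. by rewrite /nm unlock. Qed.

Lemma normE (z : C) : `|z| = (nm z)%:C.
Proof. by rewrite nm_unlock. Qed.

Lemma nmE (z : C) :
  nm z = Num.sqrt (complex.Re z ^+ 2 + complex.Im z ^+ 2).
Proof. by rewrite nm_unlock; case: z. Qed.

Lemma nm_ge0 z : 0 <= nm z.
Proof. by rewrite nmE sqrtr_ge0. Qed.

Lemma nm0 : nm 0 = 0.
Proof. by rewrite nm_unlock; exact: ComplexField.Normc.normc0. Qed.

Lemma nm1 : nm 1 = 1.
Proof. by rewrite nm_unlock; exact: ComplexField.Normc.normc1. Qed.

Lemma nmM z w : nm (z * w) = nm z * nm w.
Proof. by rewrite !nm_unlock; exact: ComplexField.Normc.normcM. Qed.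

Lemma nmV z : nm z^-1 = (nm z)^-1.
Proof. by rewrite !nm_unlock; exact: ComplexField.Normc.normcV. Qed.

Lemma nmN z : nm (- z) = nm z.
Proof. by rewrite !nm_unlock; exact: normcN. Qed.

Lemma nmB z w : nm (z - w) = nm (w - z).
Proof. by rewrite -nmN opprB. Qed.

Lemma le_nmD z w : nm (z + w) <= nm z + nm w.
Proof. by rewrite !nm_unlock; exact: le_normcD. Qed.

Lemma le_nmB z w : nm (z - w) <= nm z + nm w.
Proof. by rewrite -(nmN w) le_nmD. Qed.

Lemma nmX z n : nm (z ^+ n) = nm z ^+ n.
Proof.
by elim: n => [|n IH]; rewrite ?expr0 ?nm1// !exprS nmM IH.
Qed.

Lemma nm_eq0 z : (nm z == 0) = (z == 0).
Proof.
apply/eqP/eqP => [|->]; last exact: nm0.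
by rewrite nm_unlock; exact: ComplexField.Normc.eq0_normc.
Qed.

Lemma nm_gt0 z : (0 < nm z) = (z != 0).
Proof. by rewrite lt_def nm_eq0 nm_ge0 andbT. Qed.

Lemma nm_real (x : R) : nm x%:C = `|x|.
Proof. by rewrite nmE /= expr0n addr0 sqrtr_sqr. Qed.

Lemma nm_nat n : nm n%:R = n%:R.
Proof.
by rewrite -(rmorph_nat (real_complex R)) nm_real ger0_norm ?ler0n.
Qed.

Lemma le_nm_sum (I : Type) (r : seq I) (P : pred I) (F : I -> C) :
  nm (\sum_(i <- r | P i) F i) <= \sum_(i <- r | P i) nm (F i).
Proof.
elim/big_rec2: _ => [|i y x _ H]; first by rewrite nm0.
by rewrite (le_trans (le_nmD _ _))// lerD2l.
Qed.

Lemma le_nm_dist z w : nm z - nm w <= nm (z - w).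
Proof. by have := le_nmD (z - w) w; rewrite subrK; lra. Qed.

Lemma nm_le_ReIm z : nm z <= `|complex.Re z| + `|complex.Im z|.
Proof.
rewrite -[leRHS]ger0_norm ?addr_ge0// -sqrtr_sqr nmE ler_wsqrtr//.
rewrite -(real_normK (num_real (complex.Re z))).
rewrite -(real_normK (num_real (complex.Im z))).
have := normr_ge0 (complex.Re z); have := normr_ge0 (complex.Im z); nra.
Qed.

Lemma le_Re_nm z : `|complex.Re z| <= nm z.
Proof. by rewrite nmE -sqrtr_sqr ler_wsqrtr// lerDl sqr_ge0. Qed.

Lemma le_Im_nm z : `|complex.Im z| <= nm z.
Proof. by rewrite nmE -sqrtr_sqr ler_wsqrtr// lerDr sqr_ge0. Qed.

Lemma sqr_nm z : nm z ^+ 2 = complex.Re z ^+ 2 + complex.Im z ^+ 2.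
Proof. by rewrite nmE sqr_sqrtr// addr_ge0 ?sqr_ge0. Qed.

Lemma RecD (z w : C) : complex.Re (z + w) = complex.Re z + complex.Re w.
Proof. by case: z w => [? ?] [? ?]. Qed.

Lemma ImcD (z w : C) : complex.Im (z + w) = complex.Im z + complex.Im w.
Proof. by case: z w => [? ?] [? ?]. Qed.

Lemma RecB (z w : C) : complex.Re (z - w) = complex.Re z - complex.Re w.
Proof. by case: z w => [? ?] [? ?]. Qed.

Lemma ImcB (z w : C) : complex.Im (z - w) = complex.Im z - complex.Im w.
Proof. by case: z w => [? ?] [? ?]. Qed.

(** Convergence in [R[i]] tested with the real modulus and real radii. *)
Lemma cvg_nmP (T : Type) (F : set_system T) {FF : Filter F}
    (f : T -> C) (l : C) :
  f @ F --> l <-> forall e : R, 0 < e -> \forall t \near F, nm (f t - l) <= e.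
Proof.
split=> [/cvgrPdist_le H e e0|H].
  have : 0 < e%:C :> R[i] by rewrite ltcR.
  by move/H; apply: filterS => t; rewrite normE lecR nmB.
apply/cvgrPdist_le => e e0.
have eE : e = (complex.Re e)%:C.
  by rewrite RRe_real// gtr0_real.
move: e0; rewrite eE ltcR => /H.
by apply: filterS => t; rewrite normE lecR nmB.
Qed.

Lemma cvg_nmP_lt (T : Type) (F : set_system T) {FF : Filter F}
    (f : T -> C) (l : C) :
  f @ F --> l <-> forall e : R, 0 < e -> \forall t \near F, nm (f t - l) < e.
Proof.
rewrite cvg_nmP; split=> H e e0.
  have e20 : 0 < e / 2 by lra.
  have := H _ e20; apply: filterS => t h; lra.
by have := H _ e0; apply: filterS => t; exact: ltW.
Qed.

Lemma cvg_Re (T : Type) (F : set_system T) {FF : Filter F} (f : T -> C) (l : C) :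
  f @ F --> l -> complex.Re (f t) @[t --> F] --> complex.Re l.
Proof.
move=> /cvg_nmP H; apply/cvgrPdist_le => e /H; apply: filterS => t.
rewrite -[_ - _]/(_ + _) distrC => h; apply: le_trans h.
by rewrite -RecB le_Re_nm.
Qed.

Lemma cvg_Im (T : Type) (F : set_system T) {FF : Filter F} (f : T -> C) (l : C) :
  f @ F --> l -> complex.Im (f t) @[t --> F] --> complex.Im l.
Proof.
move=> /cvg_nmP H; apply/cvgrPdist_le => e /H; apply: filterS => t.
rewrite -[_ - _]/(_ + _) distrC => h; apply: le_trans h.
by rewrite -ImcB le_Im_nm.
Qed.

Lemma cvg_ReIm (T : Type) (F : set_system T) {FF : Filter F} (f : T -> C) (a b : R) :
  complex.Re (f t) @[t --> F] --> a -> complex.Im (f t) @[t --> F] --> b ->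
  f @ F --> (a +i* b : C).
Proof.
move=> /cvgrPdist_le Ha /cvgrPdist_le Hb; apply/cvg_nmP => e e0.
have e20 : 0 < e / 2 by lra.
have := Hb _ e20; have := Ha _ e20; apply: filterS2 => t h1 h2.
apply: le_trans (nm_le_ReIm _) _.
rewrite RecB ImcB /=.
by rewrite distrC [X in _ + X]distrC; lra.
Qed.

Lemma cvg_nm (T : Type) (F : set_system T) {FF : Filter F} (f : T -> C) (l : C) :
  f @ F --> l -> nm (f t) @[t --> F] --> nm l.
Proof.
move=> /cvg_nmP H; apply/cvgrPdist_le => e /H; apply: filterS => t.
apply: le_trans; rewrite ler_norml nmB.
have := le_nm_dist l (f t); have := le_nm_dist (f t) l; rewrite (nmB (f t)).
by move=> *; apply/andP; split; lra.
Qed.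

Lemma nm_cvg_le (T : Type) (F : set_system T) {FF : ProperFilter F}
    (f : T -> C) (l : C) (K : R) :
  f @ F --> l -> (\forall t \near F, nm (f t) <= K) -> nm l <= K.
Proof. by move=> /cvg_nm; exact: cvgr_to_le. Qed.

Lemma cvgc_unique (T : Type) (F : set_system T) {FF : ProperFilter F}
    (f : T -> C) (a b : C) : f @ F --> a -> f @ F --> b -> a = b.
Proof. by move=> fa fb; exact: (cvg_unique (@norm_hausdorff _ _) fa fb). Qed.

Section Limits.
Context (T : Type) (F : set_system T) {FF : Filter F}.
Implicit Types (f g : T -> C) (a b : C).

Lemma cvgc_cst a : (fun=> a) @ F --> a.
Proof. exact: cvg_cst. Qed.

Lemma cvgc_near f g a : (\forall t \near F, f t = g t) ->
  f @ F --> a -> g @ F --> a.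
Proof.
move=> fg /cvg_nmP fa; apply/cvg_nmP => e /fa.
by apply: filterS2 fg => t ->.
Qed.

Lemma cvgcD f g a b : f @ F --> a -> g @ F --> b ->
  (fun t => f t + g t) @ F --> (a + b : C).
Proof. exact: cvgD. Qed.

Lemma cvgcB f g a b : f @ F --> a -> g @ F --> b ->
  (fun t => f t - g t) @ F --> (a - b : C).
Proof. exact: cvgB. Qed.

Lemma cvgcN f a : f @ F --> a -> (fun t => - f t) @ F --> (- a : C).
Proof. exact: cvgN. Qed.

Lemma cvgcM f g a b : f @ F --> a -> g @ F --> b ->
  (fun t => f t * g t) @ F --> (a * b : C).
Proof. exact: cvgM. Qed.

Lemma cvgcV f a : a != 0 -> f @ F --> a -> (fun t => (f t)^-1) @ F --> (a^-1 : C).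
Proof. by move=> a0 fa; exact: (cvgV a0 fa). Qed.

Lemma cvgcX f a n : f @ F --> a -> (fun t => f t ^+ n) @ F --> (a ^+ n : C).
Proof.
move=> fa; elim: n => [|n IH].
  have -> : (fun t => f t ^+ 0) = (fun=> 1) by apply/funext => t; rewrite expr0.
  by rewrite expr0; exact: cvgc_cst.
have -> : (fun t => f t ^+ n.+1) = (fun t => f t * f t ^+ n).
  by apply/funext => t; rewrite exprS.
by rewrite exprS; exact: cvgcM.
Qed.

Lemma cvgc_sum (I : Type) (r : seq I) (f : I -> T -> C) (a : I -> C) :
  (forall i, f i @ F --> a i) ->
  (fun t => \sum_(i <- r) f i t) @ F --> (\sum_(i <- r) a i : C).
Proof.
move=> fa; elim: r => [|i r IH].
  have -> : (fun t => \sum_(i <- [::]) f i t) = (fun=> 0).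
    by apply/funext => t; rewrite big_nil.
  by rewrite big_nil; exact: cvgc_cst.
have -> : (fun t => \sum_(j <- i :: r) f j t) =
    (fun t => f i t + \sum_(j <- r) f j t).
  by apply/funext => t; rewrite big_cons.
by rewrite big_cons; exact: (cvgcD (fa i) IH).
Qed.

End Limits.
Arguments cvgc_cst {T F FF} a.

Fact tsum_key : unit. Proof. exact: tt. Qed.
Definition tsum : (nat -> C) -> C :=
  locked_with tsum_key (fun a : nat -> C => limn (series a)).

Lemma tsum_unlock (a : nat -> C) : tsum a = limn (series a).
Proof. by rewrite /tsum unlock. Qed.

Lemma tsumE (a : nat -> C) (l : C) : series a @ \oo --> l -> tsum a = l.
Proof. by rewrite tsum_unlock => /cvg_lim; apply. Qed.

Definition summ (B : nat -> R) : Prop :=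
  (forall n, 0 <= B n) /\ cvgn (series B).

Definition dom (a : nat -> C) (B : nat -> R) : Prop :=
  forall n, nm (a n) <= B n.

Lemma summ_bounded (B : nat -> R) (K : R) :
  (forall n, 0 <= B n) -> (forall N, \sum_(0 <= k < N) B k <= K) -> summ B.
Proof.
move=> B0 BK; split=> //; apply: nondecreasing_is_cvgn.
  apply/nondecreasing_seqP => n; rewrite /series/= big_nat_recr//= lerDl//.
by exists K => _ [N _ <-]; exact: BK.
Qed.

Lemma summ_geo (K r : R) : 0 <= K -> 0 <= r < 1 -> summ (fun n => K * r ^+ n).
Proof.
move=> K0 /andP[r0 r1]; split=> [n|]; first by rewrite mulr_ge0 ?exprn_ge0.
by apply: is_cvg_geometric_series; rewrite ger0_norm.
Qed.

Lemma summZ (K : R) (B : nat -> R) : 0 <= K -> summ B -> summ (fun n => K * B n).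
Proof.
move=> K0 [B0 cB]; split=> [n|]; first by rewrite mulr_ge0.
exact: (is_cvg_seriesZ (k := K) cB).
Qed.

Lemma series_le_lim (B : nat -> R) N : summ B -> series B N <= limn (series B).
Proof.
move=> [B0 cB]; apply: nondecreasing_cvgn_le => //.
by apply/nondecreasing_seqP => n; rewrite /series/= big_nat_recr//= lerDl.
Qed.

Lemma dom_dist (a : nat -> C) (B : nat -> R) (m n : nat) :
  summ B -> dom a B -> (m <= n)%N ->
  nm (series a n - series a m) <= limn (series B) - series B m.
Proof.
move=> sB aB mn; apply: (@le_trans _ _ (series B n - series B m)).
  rewrite !sub_series_geq//.
  apply: (le_trans (le_nm_sum (index_iota m n) xpredT a)).
  by apply: ler_sum => i _; exact: aB.
by rewrite lerD2r series_le_lim.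
Qed.

Lemma tsum_cvg (a : nat -> C) (B : nat -> R) :
  summ B -> dom a B -> series a @ \oo --> tsum a.
Proof.
move=> [B0 cB] aB.
have cvgc (f : C -> R) : {morph f : x y / x + y} ->
    (forall z, `|f z| <= nm z) -> cvgn (series (f \o a)).
  move=> fD fle; apply: normed_cvg.
  apply: (series_le_cvg _ B0 _ cB) => n //=.
  exact: le_trans (fle _) (aB n).
have sumc (f : C -> R) : {morph f : x y / x + y} -> f 0 = 0 ->
    series (f \o a) = (fun n => f (series a n)).
  move=> fD f0; apply/funext => n; rewrite /series/=.
  by rewrite (big_morph f fD f0).
have cRe : cvgn (series (@complex.Re R \o a)).
  by apply: cvgc => [[? ?] [? ?]//|z]; exact: le_Re_nm.
have cIm : cvgn (series (@complex.Im R \o a)).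
  by apply: cvgc => [[? ?] [? ?]//|z]; exact: le_Im_nm.
rewrite tsum_unlock; apply: cvgP (_ : _ --> (limn (series (@complex.Re R \o a)) +i*
  limn (series (@complex.Im R \o a)) : C)).
apply: cvg_ReIm.
- by rewrite -(sumc (@complex.Re R))// => -[? ?] [? ?].
- by rewrite -(sumc (@complex.Im R))// => -[? ?] [? ?].
Qed.

Lemma tsum_tail (a : nat -> C) (B : nat -> R) N : summ B -> dom a B ->
  nm (tsum a - series a N) <= limn (series B) - series B N.
Proof.
move=> sB aB.
have h : (series a n - series a N : C) @[n --> \oo]
   --> (tsum a - series a N : C).
  by exact: (cvgcB (tsum_cvg sB aB) (cvgc_cst _)).
apply: nm_cvg_le h _; exists N => // n /= Nn; exact: dom_dist.
Qed.

Lemma nm_tsum_le (a : nat -> C) (B : nat -> R) :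
  summ B -> dom a B -> nm (tsum a) <= limn (series B).
Proof.
move=> sB aB; have := tsum_tail 0 sB aB.
by rewrite /series/= !big_nil !subr0.
Qed.

(** Tannery's theorem: a dominated family of series may be summed after
    passing to the limit, because one tail estimate serves all its members. *)
Lemma tannery (T : Type) (F : set_system T) {FF : ProperFilter F}
    (a : T -> nat -> C) (l : nat -> C) (B : nat -> R) :
  summ B -> (\forall t \near F, dom (a t) B) ->
  (forall j, (a t j : C) @[t --> F] --> (l j : C)) ->
  tsum (a t) @[t --> F] --> tsum l.
Proof.
move=> sB aB al.
have lB : dom l B.
  move=> j; apply: nm_cvg_le (al j) _.
  by apply: filterS aB => t; apply.
apply/cvg_nmP => e e0.
have e30 : 0 < e / 3 by lra.
have [N hN] : exists N, limn (series B) - series B N <= e / 3.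
  have [N _ /(_ N (leqnn N))] := (cvgrPdist_le _ _).1 sB.2 _ e30.
  rewrite ger0_norm ?subr_ge0 ?series_le_lim// => h; by exists N.
have aN : (series (a t : nat -> C) N) @[t --> F] --> (series l N : C).
  exact: (@cvgc_sum _ _ _ _ (index_iota 0 N) (fun j t => a t j) l al).
have H1 := (cvg_nmP _ _).1 aN _ e30.
near=> t.
have atB : dom (a t) B by near: t.
have h : nm (series (a t) N - series l N) <= e / 3.
  by near: t; exact: H1.
have -> : tsum (a t) - tsum l = (tsum (a t) - series (a t : nat -> C) N) +
  (series (a t : nat -> C) N - series l N)
  - (tsum l - series l N) by ring.
apply: le_trans (le_nmB _ _) _.
have := le_nmD (tsum (a t) - series (a t : nat -> C) N)
  (series (a t : nat -> C) N - series l N).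
have := tsum_tail N sB atB; have := tsum_tail N sB lB; lra.
Unshelve. all: by end_near. Qed.

Lemma tsum_fin (a : nat -> C) N : (forall n, (N <= n)%N -> a n = 0) ->
  tsum a = \sum_(n < N) a n.
Proof.
move=> aN; apply: tsumE; apply: cvg_near_cst; exists N => // n /= Nn.
rewrite /series/= (big_cat_nat (leq0n N) Nn)//= [X in _ + X]big_nat.
rewrite [X in _ + X]big1 ?addr0 ?big_mkord// => i /andP[Ni _]; exact: aN.
Qed.

Lemma tsumD (a b : nat -> C) (A B : nat -> R) :
  summ A -> dom a A -> summ B -> dom b B ->
  tsum (fun n => a n + b n) = tsum a + tsum b.
Proof.
move=> sA aA sB bB; apply: tsumE.
have -> : series (fun n => a n + b n : C) =
  (fun n => series a n + series (b : nat -> C) n).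
  by apply/funext => n; rewrite /series/= big_split.
by exact: (cvgcD (tsum_cvg sA aA) (tsum_cvg sB bB)).
Qed.

Lemma tsumZ (k : C) (a : nat -> C) (B : nat -> R) : summ B -> dom a B ->
  tsum (fun n => k * a n) = k * tsum a.
Proof.
move=> sB aB; apply: tsumE.
have -> : series (fun n => k * a n : C) = (fun n => k * series a n).
  by apply/funext => n; rewrite /series/= big_distrr.
by exact: (cvgcM (cvgc_cst k) (tsum_cvg sB aB)).
Qed.

Lemma tsum_recl (a : nat -> C) (B : nat -> R) : summ B -> dom a B ->
  tsum a = a 0%N + tsum (fun n => a n.+1).
Proof.
move=> sB aB; have := tsum_cvg sB aB; rewrite -cvg_shiftS => h.
suff -> : tsum (fun n => a n.+1) = tsum a - a 0%N by rewrite addrC subrK.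
apply: tsumE.
have -> : series (fun n => a n.+1) = (fun n => series a n.+1 - a 0%N).
  apply/funext => n; rewrite /series/= [X in _ = X - _]big_nat_recl//.
  by rewrite addrAC subrr add0r.
exact: (cvgcB h (cvgc_cst _)).
Qed.

Lemma cvg_idC (q : C) : (fun w : C => w) @ q --> q.
Proof. exact: cvg_id. Qed.

End ComplexModulus.
Arguments cvgc_cst {R T F FF} a.
Arguments cvg_idC {R} q.

(** * Complex differentiation and the exponential *)

Section ComplexDerivative.
Variable R : realType.
Local Notation C := (R[i]^o).

(** Caratheodory's form of complex differentiability: the difference quotient
    extends continuously. It makes the product and chain rules algebraic
    identities between the quotients. *)
Definition cder (f : C -> C) (z l : C) : Prop :=
  exists2 phi : C -> C, forall w, f w - f z = phi w * (w - z)
                      & phi @ z --> l.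

Lemma near_nm (z : C) (e : R) : 0 < e -> \forall w \near z, nm (w - z) <= e.
Proof.
move=> e0; have h : id @ (nbhs z) --> z by exact: cvg_id.
exact: ((cvg_nmP _ _).1 h _ e0).
Qed.

Lemma near_all (z : C) (P : C -> Prop) : (forall w, P w) -> \forall w \near z, P w.
Proof. by move=> h; exact: (@filterE _ (nbhs z) _ _ h). Qed.

Lemma cvg_self (f : C -> C) (z l : C) : f @ z --> l -> f z = l.
Proof.
move=> /cvg_nmP h; apply/eqP; rewrite -subr_eq0 -nm_eq0 eq_le nm_ge0 andbT.
apply/ler_addgt0Pr => e e0; rewrite add0r.
exact: (nbhs_singleton (h _ e0)).
Qed.

Lemma cder_cvg (f : C -> C) (z l : C) : cder f z l -> f @ z --> f z.
Proof.
move=> [phi fE cphi].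
have h := cvgcD (cvgcM cphi (cvgcB (@cvg_id _ (nbhs z)) (cvgc_cst z))) (cvgc_cst (f z)).
have E : l * (z - z) + f z = f z by rewrite subrr mulr0 add0r.
have F : f = (fun w => phi w * (w - z) + f z).
  by apply/funext => w; rewrite -fE subrK.
by rewrite -E {1}F; exact: h.
Qed.

Lemma cder_cst (a z : C) : cder (fun=> a) z 0.
Proof.
exists (fun=> 0); first by move=> w; rewrite subrr mul0r.
exact: cvgc_cst.
Qed.

Lemma cder_id (z : C) : cder id z 1.
Proof.
exists (fun=> 1); first by move=> w; rewrite mul1r.
exact: cvgc_cst.
Qed.

Lemma cderD (f g : C -> C) (z a b : C) : cder f z a -> cder g z b ->
  cder (fun w => f w + g w) z (a + b).
Proof.
move=> [p fE cp] [q gE cq]; exists (fun w => p w + q w); last exact: (cvgcD cp cq).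
by move=> w; rewrite mulrDl -fE -gE; ring.
Qed.

Lemma cderM (f g : C -> C) (z a b : C) : cder f z a -> cder g z b ->
  cder (fun w => f w * g w) z (a * g z + f z * b).
Proof.
move=> fa gb; have gc := cder_cvg gb; move: fa gb => [p fE cp] [q gE cq].
exists (fun w => p w * g w + f z * q w); last first.
  exact: (cvgcD (cvgcM cp gc) (cvgcM (cvgc_cst _) cq)).
move=> w; rewrite mulrDl mulrAC -fE -[f z * q w * _]mulrA -gE; ring.
Qed.

Lemma cderZ (f : C -> C) (k z a : C) : cder f z a ->
  cder (fun w => k * f w) z (k * a).
Proof. by move=> fa; have := cderM (cder_cst k z) fa; rewrite mul0r add0r. Qed.

Lemma cder_comp (f g : C -> C) (z a b : C) : cder g z b -> cder f (g z) a ->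
  cder (f \o g) z (a * b).
Proof.
move=> gb fa; have gc := cder_cvg gb; move: fa gb => [p fE cp] [q gE cq].
exists (fun w => p (g w) * q w) => [w /=|]; first by rewrite fE gE mulrA.
apply: cvgcM cq.
exact: (cvg_comp g p gc cp).
Qed.

Lemma cderV (z : C) : z != 0 -> cder (fun w => w^-1) z (- (z ^+ 2)^-1).
Proof.
move=> z0; exists (fun w => if w == 0 then (- z^-1) / (- z) else - (w * z)^-1).
  move=> w; case: eqVneq => [->|w0].
    by rewrite invr0 !sub0r mulfVK// oppr_eq0.
  by field; apply/andP.
have h : (fun w : C => - (w * z)^-1) @ z --> (- (z ^+ 2)^-1 : C).
  rewrite expr2; apply: cvgcN; apply: cvgcV; first by rewrite mulf_neq0.
  exact: (cvgcM (@cvg_id _ (nbhs z)) (cvgc_cst z)).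
apply: cvg_trans h; apply: near_eq_cvg.
have /(cvg_nmP_lt _ _) := @cvg_id _ (nbhs z).
have nz : 0 < nm z by rewrite nm_gt0.
move=> /(_ _ nz); apply: filterS => w /=; case: eqVneq => // ->.
by rewrite sub0r nmN ltxx.
Qed.

Lemma cder_near (f g : C -> C) (z l : C) : (\forall w \near z, f w = g w) ->
  cder f z l -> cder g z l.
Proof.
move=> fg [p fE cp].
exists (fun w => if w == z then l else (g w - g z) / (w - z)).
  move=> w; case: eqVneq => [->|wz]; first by rewrite !subrr mulr0.
  by rewrite mulfVK// subr_eq0.
apply: cvg_trans (cp); apply: near_eq_cvg; near=> w.
case: eqVneq => [->|wz]; first exact: (cvg_self cp).
have -> : g w = f w by rewrite (near fg w).
by rewrite -(nbhs_singleton fg) fE mulfK// subr_eq0.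
Unshelve. all: by end_near. Qed.

Lemma cder_unique (f : C -> C) (z : C) (a b : C) : cder f z a -> cder f z b -> a = b.
Proof.
move=> [p fE cp] [r fE' cr].
have pr w : w != z -> p w = r w.
  move=> wz; have n0 : w - z != 0 by rewrite subr_eq0.
  by apply: (mulIf n0); rewrite -fE fE'.
have cp' : p @ z^' --> (a : C) by exact: cvg_within_filter cp.
have cr' : r @ z^' --> (b : C) by exact: cvg_within_filter cr.
apply: cvgc_unique cp' _; apply: cvgc_near cr'.
rewrite /dnbhs; near=> w.
have wz : w != z by near: w; apply: withinT.
by rewrite pr.
Unshelve. all: by end_near. Qed.

Lemma cderX (f : C -> C) (z a : C) n : cder f z a ->
  cder (fun w => f w ^+ n.+1) (z : C) (n.+1%:R * f z ^+ n * a).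
Proof.
move=> fa; elim: n => [|n IH].
  by rewrite expr0 !mul1r; apply: cder_near fa; apply: near_all => w; rewrite expr1.
have := cderM fa IH.
have -> : a * f z ^+ n.+1 + f z * (n.+1%:R * f z ^+ n * a) = n.+2%:R * f z ^+ n.+1 * a.
  by rewrite -[n.+2%:R]natr1 exprS; ring.
by apply: cder_near; apply: near_all => w; rewrite -exprS.
Qed.

Lemma cder_negV (z : C) : z != 0 -> cder (fun w : C => - w^-1) (z : C) (z ^- 2).
Proof.
move=> z0; have := cderZ (-1) (cderV z0); rewrite mulN1r opprK.
by apply: cder_near; apply: near_all => w; rewrite mulN1r.
Qed.

Lemma cder_eq (f : C -> C) (z : C) (l l' : C) : cder f z l -> l = l' -> cder f z l'.
Proof. by move=> h <-. Qed.

Lemma cder_derivable (f : C -> C) (z l : C) : cder f z l -> derivable f z 1.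
Proof.
move=> [p fE cp]; apply/cvg_ex; exists l => /=.
have hz : (fun h : C => h + z) @ (0 : C)^' --> z.
  apply/cvg_nmP => e e0.
  have /cvg_nmP/(_ _ e0) : (fun h : C => h) @ (0 : C)^' --> (0 : C).
    by apply: cvg_within_filter; exact: cvg_id.
  by apply: filterS => h; rewrite subr0 addrK.
apply: cvg_trans (cvg_comp _ _ hz cp); apply: near_eq_cvg.
near=> h.
have h0 : h != 0 by near: h; rewrite /dnbhs; apply: withinT.
rewrite /= [h *: 1]mulr1 fE addrK [_ *: _]mulrC mulfK//.
Unshelve. all: by end_near. Qed.

End ComplexDerivative.

Section ComplexExponential.
Variable R : realType.
Local Notation C := (R[i]^o).

Lemma cexpE (z : C) : cexp z = (expR (complex.Re z) * cos (complex.Im z))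
  +i* (expR (complex.Re z) * sin (complex.Im z)).
Proof. by []. Qed.

Lemma cexp0 : cexp 0 = 1 :> C.
Proof. by rewrite /cexp /= expR0 cos0 sin0 !mul1r. Qed.

Lemma cexpD (z w : C) : cexp (z + w) = cexp z * cexp w.
Proof.
rewrite /cexp RecD ImcD expRD cosD sinD; apply/eqP; rewrite eq_complex /=.
by apply/andP; split; apply/eqP; ring.
Qed.

Lemma nm_cexp (z : C) : nm (cexp z) = expR (complex.Re z).
Proof.
rewrite nmE /cexp /= !exprMn -mulrDr cos2Dsin2 mulr1 sqrtr_sqr.
by rewrite ger0_norm ?expR_ge0.
Qed.

Lemma cexp_neq0 (z : C) : cexp z != 0.
Proof. by rewrite -nm_eq0 nm_cexp expR_eq0. Qed.

Lemma cexpMn (z : C) n : cexp (n%:R * z) = cexp z ^+ n.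
Proof.
elim: n => [|n IH]; first by rewrite mul0r cexp0.
by rewrite -natr1 mulrDl mul1r cexpD IH exprSr.
Qed.

Lemma norm_sin_le (y : R) : `|sin y| <= `|y|.
Proof.
have h (x : R) : 0 <= x -> `|sin x| <= x.
  move=> x0.
  have cs : {within `[0, x], continuous (@sin R)}.
    by apply: continuous_subspaceT => ?; exact: continuous_sin.
  have [c _] := MVT_segment x0 (fun t _ => is_derive_sin t) cs.
  rewrite sin0 !subr0 => ->; rewrite normrM (ger0_norm x0) ler_piMl//.
  exact: cos_max.
have [y0|y0] := leP 0 y; first by rewrite (ger0_norm y0) h.
by rewrite (ltr0_norm y0) -normrN -sinN h// oppr_ge0 ltW.
Qed.

Lemma norm_cosB1_le (y : R) : `|cos y - 1| <= y ^+ 2.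
Proof.
have -> : cos y - 1 = - (sin (y / 2) ^+ 2 * 2).
  have -> : cos y = cos ((y / 2) *+ 2).
    by congr cos; rewrite -mulr_natr; field.
  rewrite cos_mulr2n sin2cos2; ring.
have p2 : 0 <= 2 :> R by lra.
have p2' : 0 <= 2^-1 :> R by lra.
rewrite normrN normrM normrX (ger0_norm p2).
have := norm_sin_le (y / 2); rewrite normrM (ger0_norm p2').
rewrite -(real_normK (num_real y)).
have := normr_ge0 (sin (y / 2)); have := normr_ge0 y; nra.
Qed.

Lemma norm_sinBid_le (y : R) : `|y| <= 1 -> `|sin y - y| <= y ^+ 2.
Proof.
have h (x : R) : 0 <= x -> x <= 1 -> `|sin x - x| <= x ^+ 2.
  move=> x0 x1.
  have cs : {within `[0, x], continuous (@sin R)}.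
    by apply: continuous_subspaceT => ?; exact: continuous_sin.
  have [c] := MVT_segment x0 (fun t _ => is_derive_sin t) cs.
  rewrite in_itv/= => /andP[c0 cx].
  rewrite sin0 !subr0 => ->; rewrite -{2}[x]mul1r -mulrBl normrM (ger0_norm x0).
  have := norm_cosB1_le c; have := normr_ge0 (cos c - 1); nra.
move=> y1; have [y0|y0] := leP 0 y.
  by apply: h => //; rewrite -(ger0_norm y0).
have := h (- y); rewrite sinN sqrrN -opprD normrN; apply; first by lra.
by rewrite -(ltr0_norm y0).
Qed.

Lemma norm_expRB_le (x : R) : `|x| <= 2^-1 -> `|expR x - 1 - x| <= x ^+ 2 *+ 2.
Proof.
rewrite ler_norml => /andP[x1 x2].
have h1 := expR_ge1Dx x; have h2 := expR_ge1Dx (- x).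
have e0 := expR_gt0 x.
have h3 : expR x * (1 - x) <= 1.
  by rewrite -[leRHS](expRxMexpNx_1 x) ler_pM2l.
rewrite ger0_norm; last by lra.
rewrite -mulr_natr; nra.
Qed.

(** The exponential is its own derivative: by the functional equation this is
    a statement at the origin, where it follows from quadratic bounds. *)
Lemma cder_cexp (z : C) : cder (@cexp R) z (cexp z).
Proof.
have h0 : cder (@cexp R) 0 1.
  exists (fun h => if h == 0 then 1 else (cexp h - 1) / h).
    move=> h; rewrite cexp0 subr0; case: eqVneq => [->|h0].
      by rewrite cexp0 subrr mulr0.
    by rewrite mulfVK.
  apply: ((@cvg_nmP R C (nbhs (0 : C)) _ _ _).2) => e e0.
  have d0 : 0 < Num.min 2^-1 (e / 20) by rewrite lt_min; apply/andP; split; lra.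
  apply: filterS (near_nm 0 d0) => h.
  rewrite subr0 le_min => /andP[h1 h2].
  have [_|hn0] := eqVneq h 0; first by rewrite subrr nm0 ltW.
  have -> : (cexp h - 1) / h - 1 = (cexp h - 1 - h) / h by field.
  have hp : 0 < nm h by rewrite nm_gt0.
  rewrite nmM nmV ler_pdivrMr//; apply: (le_trans (nm_le_ReIm _)).
  have hx := le_Re_nm h; have hy := le_Im_nm h.
  have := sqr_nm h; rewrite !RecB !ImcB /=; move: hx hy h1 h2 hp.
  set x := complex.Re h; set y := complex.Im h; set n := nm h => hx hy h1 h2 hp nE.
  have x12 : `|x| <= 2^-1 by lra.
  have y1 : `|y| <= 1 by lra.
  have H1 := norm_expRB_le x12; have H2 := norm_cosB1_le y.
  have H3 := norm_sinBid_le y1.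
  have e2 : expR x <= 3.
    have : expR x <= 1 + x + x ^+ 2 *+ 2.
      by move: H1; rewrite ler_norml => /andP[_]; lra.
    by move: x12; rewrite -mulr_natr ler_norml => /andP[? ?]; nra.
  have e0' := expR_ge0 x.
  have -> : expR x * cos y - 1 - x = expR x * (cos y - 1) + (expR x - 1 - x) by ring.
  have -> : expR x * sin y - 0 - y = expR x * (sin y - y) + (expR x - 1 - x) * y + x * y.
    by ring.
  have N1 := ler_normD (expR x * (cos y - 1)) (expR x - 1 - x).
  have N2 := ler_normD (expR x * (sin y - y) + (expR x - 1 - x) * y) (x * y).
  have N3 := ler_normD (expR x * (sin y - y)) ((expR x - 1 - x) * y).
  move: N1 N2 N3; rewrite !normrM (ger0_norm e0') => N1 N2 N3.
  move: H1; rewrite -mulr_natr => H1.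
  have K1 : expR x * `|cos y - 1| <= 3 * y ^+ 2 by apply: ler_pM.
  have K2 : expR x * `|sin y - y| <= 3 * y ^+ 2 by apply: ler_pM.
  have K3 : `|expR x - 1 - x| * `|y| <= x ^+ 2 * 2 * 1 by apply: ler_pM.
  have K4 : `|x| * `|y| <= n * n by apply: ler_pM.
  have : n * n <= n * (e / 20) by rewrite ler_pM2l.
  rewrite !expr2 in K1 K2 K3 H1 nE; nra.
have hs : cder (fun w : C => w - z) z 1.
  by have := cderD (cder_id z) (cder_cst (- z) z); rewrite addr0.
have h1 : cder (@cexp R) (z - z) 1 by rewrite (subrr z); exact: h0.
have E : cexp z * (1 * 1) = cexp z by rewrite mulr1 mulr1.
rewrite -E; apply: cder_near (cderZ (cexp z) (cder_comp hs h1)).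
by apply: near_all => w; rewrite /= -cexpD addrC subrK.
Qed.

End ComplexExponential.

(** * Power series on the unit disc *)

Section PowerSeries.
Variable R : realType.
Local Notation C := (R[i]^o).
Implicit Types (a b : nat -> C) (q w z : C).

(** The coefficient sequences of the power series that converge on the open
    unit disc. *)
Definition subexp b : Prop :=
  forall r : R, 0 < r < 1 -> exists K : R, forall n, nm (b n) * r ^+ n <= K.

Fact psum_key : unit. Proof. exact: tt. Qed.
Definition psum : (nat -> C) -> C -> C :=
  locked_with psum_key (fun b q => tsum (fun n => b n * q ^+ n)).

Lemma psumE b q : psum b q = tsum (fun n => b n * q ^+ n).
Proof. by rewrite /psum unlock. Qed.

Lemma nS_geo_le (s : R) n : 0 <= s < 1 -> n.+1%:R * s ^+ n <= (1 - s)^-1.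
Proof.
move=> /andP[s0 s1]; rewrite -[leRHS]mul1r ler_pdivlMr ?subr_gt0//.
suff h : n.+1%:R * s ^+ n * (1 - s) <= 1 - s ^+ n.+1.
  by apply: le_trans h _; rewrite gerBl exprn_ge0.
elim: n => [|n IH]; first by rewrite expr0 expr1 !mul1r.
have p0 : 0 <= s ^+ n.+1 by rewrite exprn_ge0.
have p1 : s ^+ n.+1 <= 1 by rewrite exprn_ile1// ltW.
have e : s ^+ n.+1 = s * s ^+ n by rewrite exprS.
rewrite -natr1 mulrDl mul1r [s ^+ n.+2]exprS.
have : n.+1%:R * s ^+ n.+1 * (1 - s) <= s * (1 - s ^+ n.+1).
  have -> : n.+1%:R * s ^+ n.+1 * (1 - s) = s * (n.+1%:R * s ^+ n * (1 - s)).
    by rewrite e; ring.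
  by rewrite ler_wpM2l.
nra.
Qed.

Lemma subexp_le a b : subexp a -> (forall n, nm (b n) <= nm (a n)) -> subexp b.
Proof.
move=> ha h r r01; have [K hK] := ha r r01; exists K => n.
apply: le_trans (hK n); rewrite ler_wpM2r// exprn_ge0//; lra.
Qed.

Lemma subexp_const (k : C) : subexp (fun=> k).
Proof.
move=> r r01; exists (nm k) => n; rewrite ler_piMr ?nm_ge0// exprn_ile1//; lra.
Qed.

Lemma subexpD a b : subexp a -> subexp b -> subexp (fun n => a n + b n).
Proof.
move=> ha hb r r01; have [K hK] := ha r r01; have [L hL] := hb r r01.
exists (K + L) => n; apply: le_trans (lerD (hK n) (hL n)).
by rewrite -mulrDl ler_wpM2r ?le_nmD// exprn_ge0//; lra.
Qed.

Lemma subexpZ (k : C) b : subexp b -> subexp (fun n => k * b n).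
Proof.
move=> hb r r01; have [K hK] := hb r r01; exists (nm k * K) => n.
by rewrite nmM -mulrA ler_wpM2l ?nm_ge0.
Qed.

Lemma ratio_bounds (r s : R) : 0 <= r -> r < s -> 0 <= r / s < 1.
Proof.
move=> r0 rs; have s0 : 0 < s by lra.
apply/andP; split; first by rewrite divr_ge0// ltW.
by rewrite ltr_pdivrMr// mul1r.
Qed.

(** Passing from [r] to [(1 + r) / 2] leaves room for a factor [n + 1]. *)
Lemma subexp_nS b : subexp b -> subexp (fun n => n.+1%:R * b n).
Proof.
move=> hb r r01; set s := (1 + r) / 2; have s01 : 0 < s < 1 by rewrite /s; lra.
have rs : r < s by rewrite /s; lra.
have [K hK] := hb s s01; exists (K * (1 - r / s)^-1) => n.
have r0 : 0 <= r by lra.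
have s0 : s != 0 by lra.
have -> : nm (n.+1%:R * b n) * r ^+ n =
    (nm (b n) * s ^+ n) * (n.+1%:R * (r / s) ^+ n).
  have -> : r ^+ n = s ^+ n * (r / s) ^+ n by rewrite -exprMn mulrCA divff// mulr1.
  by rewrite nmM nm_nat; ring.
have /andP[t0 t1] := ratio_bounds r0 rs.
apply: ler_pM => //; last by apply: nS_geo_le; rewrite t0.
  by rewrite mulr_ge0 ?nm_ge0// exprn_ge0//; lra.
by rewrite mulr_ge0 ?exprn_ge0.
Qed.

Lemma subexp_poly b (K : R) m : (forall n, nm (b n) <= K * n.+1%:R ^+ m) -> subexp b.
Proof.
move=> h; suff hp : subexp (fun n => n.+1%:R ^+ m : C).
  apply: subexp_le (subexpZ (K%:C : C) hp) _ => n.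
  rewrite nmM nmX nm_nat nm_real; apply: le_trans (h n) _.
  by rewrite ler_wpM2r ?exprn_ge0// ler_norm.
elim: m {h} => [|m IH]; first exact: subexp_const.
by apply: subexp_le (subexp_nS IH) _ => n; rewrite exprS.
Qed.

(** The operator [q d/dq]. *)
Definition theta b : nat -> C := fun n => n%:R * b n.

Lemma subexp_theta b : subexp b -> subexp (theta b).
Proof.
move=> /subexp_nS hb; apply: subexp_le hb _ => n.
by rewrite !nmM !nm_nat ler_wpM2r ?nm_ge0// ler_nat.
Qed.

Lemma subexp_shift b : subexp b -> subexp (fun n => b n.+1).
Proof.
move=> hb r r01; have [K hK] := hb r r01; exists (K / r) => n.
by rewrite ler_pdivlMr -?mulrA -?exprSr//; lra.
Qed.

Definition cmul a b : nat -> C := fun n => \sum_(i < n.+1) a i * b (n - i)%N.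

Lemma subexp_cmul a b : subexp a -> subexp b -> subexp (cmul a b).
Proof.
move=> ha hb.
suff h : forall r : R, 0 < r < 1 -> exists2 K : R, 0 <= K &
    forall n, nm (cmul a b n) * r ^+ n <= K * n.+1%:R.
  move=> r r01; set s := (1 + r) / 2; have s01 : 0 < s < 1 by rewrite /s; lra.
  have rs : r < s by rewrite /s; lra.
  have [K K0 hK] := h s s01; exists (K * (1 - r / s)^-1) => n.
  have r0 : 0 <= r by lra.
  have s0 : s != 0 by lra.
  have /andP[t0 t1] := ratio_bounds r0 rs.
  have -> : r ^+ n = s ^+ n * (r / s) ^+ n by rewrite -exprMn mulrCA divff// mulr1.
  rewrite mulrA; apply: (@le_trans _ _ (K * n.+1%:R * (r / s) ^+ n)).
    by rewrite ler_wpM2r ?exprn_ge0.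
  by rewrite -mulrA ler_wpM2l// nS_geo_le// t0.
move=> r r01; have [K hK] := ha r r01; have [L hL] := hb r r01.
have K0 : 0 <= K by apply: le_trans (hK 0%N); rewrite mulr1 nm_ge0.
have L0 : 0 <= L by apply: le_trans (hL 0%N); rewrite mulr1 nm_ge0.
exists (K * L) => [|n]; first exact: mulr_ge0.
have -> : K * L * n.+1%:R = \sum_(i < n.+1) K * L.
  by rewrite sumr_const card_ord mulr_natr.
rewrite (le_trans (ler_wpM2r _ (le_nm_sum _ _ _)))//; first by rewrite exprn_ge0//; lra.
rewrite big_distrl/=; apply: ler_sum => i _.
have -> : r ^+ n = r ^+ i * r ^+ (n - i) by rewrite -exprD subnKC// -ltnS.
have -> : nm (a i * b (n - i)%N) * (r ^+ i * r ^+ (n - i)) =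
  (nm (a i) * r ^+ i) * (nm (b (n - i)%N) * r ^+ (n - i)) by rewrite nmM; ring.
by apply: ler_pM => //; rewrite mulr_ge0 ?nm_ge0 ?exprn_ge0//; lra.
Qed.

Lemma subexp_dom b (rho : R) : subexp b -> 0 <= rho < 1 ->
  exists2 B, summ B & forall q, nm q <= rho -> dom (fun n => b n * q ^+ n) B.
Proof.
move=> hb /andP[p0 p1]; set r := (1 + rho) / 2.
have r01 : 0 < r < 1 by rewrite /r; lra.
have pr : rho < r by rewrite /r; lra.
have [K hK] := hb r r01.
have K0 : 0 <= K by apply: le_trans (hK 0%N); rewrite mulr1 nm_ge0.
have /andP[t0 t1] := ratio_bounds p0 pr.
exists (fun n => K * (rho / r) ^+ n); first by apply: summ_geo => //; rewrite t0.
move=> q qp n; rewrite nmM nmX.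
have r0 : r != 0 by lra.
have h : nm q ^+ n <= r ^+ n * (rho / r) ^+ n.
  by rewrite -exprMn mulrCA divff// mulr1 lerXn2r// nnegrE ?nm_ge0.
apply: le_trans (ler_wpM2l (nm_ge0 _) h) _.
by rewrite mulrA ler_wpM2r ?exprn_ge0.
Qed.

Lemma subexp_dom1 b q : subexp b -> nm q < 1 ->
  exists2 B, summ B & dom (fun n => b n * q ^+ n) B.
Proof.
move=> hb q1; have [|B sB hB] := @subexp_dom b (nm q) hb; first by rewrite nm_ge0.
by exists B => //; exact: hB.
Qed.

Lemma psum_cvg b q : subexp b -> nm q < 1 ->
  series (fun n => b n * q ^+ n) @ \oo --> psum b q.
Proof.
by move=> hb /(subexp_dom1 hb)[B sB hB]; rewrite psumE; exact: tsum_cvg sB hB.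
Qed.

Lemma psumD a b q : subexp a -> subexp b -> nm q < 1 ->
  psum (fun n => a n + b n) q = psum a q + psum b q.
Proof.
move=> ha hb q1; have [A sA hA] := subexp_dom1 ha q1.
have [B sB hB] := subexp_dom1 hb q1; rewrite !psumE -(tsumD sA hA sB hB).
by congr tsum; apply/funext => n; rewrite mulrDl.
Qed.

Lemma psumZ (k : C) b q : subexp b -> nm q < 1 ->
  psum (fun n => k * b n) q = k * psum b q.
Proof.
move=> hb q1; have [B sB hB] := subexp_dom1 hb q1; rewrite !psumE -(tsumZ k sB hB).
by congr tsum; apply/funext => n; rewrite mulrA.
Qed.

Lemma psum_recl b q : subexp b -> nm q < 1 ->
  psum b q = b 0%N + q * psum (fun n => b n.+1) q.
Proof.
move=> hb q1; have [B sB hB] := subexp_dom1 hb q1.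
rewrite 2!psumE (tsum_recl sB hB) expr0 mulr1; congr (_ + _).
have [B' sB' hB'] := subexp_dom1 (subexp_shift hb) q1.
rewrite -(tsumZ q sB' hB'); congr tsum; apply/funext => n.
by rewrite exprS mulrCA.
Qed.

Lemma psum0 b : subexp b -> psum b 0 = b 0%N.
Proof. by move=> hb; rewrite psum_recl ?nm0// mul0r addr0. Qed.

Lemma psum_fin b q N : (forall n, (N <= n)%N -> b n = 0) ->
  psum b q = \sum_(n < N) b n * q ^+ n.
Proof. by move=> h; rewrite psumE; apply: tsum_fin => n /h ->; rewrite mul0r. Qed.

Lemma nm_psum_le b q (B : nat -> R) : summ B -> dom (fun n => b n * q ^+ n) B ->
  nm (psum b q) <= limn (series B).
Proof. by rewrite psumE; exact: nm_tsum_le. Qed.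

Lemma disc_nbhs q : nm q < 1 -> exists2 rho : R, 0 <= rho < 1 &
  (nm q <= rho) /\ \forall w \near q, nm w <= rho.
Proof.
move=> q1; have q0 := nm_ge0 q; exists ((1 + nm q) / 2); first lra.
split; first lra.
have e0 : 0 < (1 - nm q) / 2 by lra.
apply: filterS (near_nm q e0) => w; have := le_nm_dist w q; lra.
Qed.

Lemma psum_continuous b q : subexp b -> nm q < 1 -> psum b @ q --> psum b q.
Proof.
move=> hb /disc_nbhs[rho rho1 [qr wr]]; have [B sB hB] := subexp_dom hb rho1.
have -> : psum b = (fun w => tsum (fun n => b n * w ^+ n)).
  by apply/funext => w; rewrite psumE.
apply: (@tannery _ C (nbhs q) _ _ _ B) => //; first exact: filterS wr.
by move=> j; exact: (cvgcM (cvgc_cst (b j)) (cvgcX (cvg_idC q))).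
Qed.

(** Cauchy product, as the limit of the products with the truncations of [a]. *)
Lemma psum_cmul a b q : subexp a -> subexp b -> nm q < 1 ->
  psum (cmul a b) q = psum a q * psum b q.
Proof.
move=> ha hb q1.
pose aN N n : C := if (n < N)%N then a n else 0.
have haN N : subexp (aN N).
  apply: subexp_le ha _ => n; rewrite /aN; case: ifP => // _.
  by rewrite nm0 nm_ge0.
have finite N : psum (cmul (aN N) b) q = (\sum_(n < N) a n * q ^+ n) * psum b q.
  elim: N => [|N IH].
    rewrite big_ord0 mul0r (@psum_fin _ _ 0) ?big_ord0// => n _.
    by rewrite /cmul big1// => i _; rewrite /aN ltn0 mul0r.
  pose d n : C := if (N <= n)%N then a N * b (n - N)%N else 0.
  have cE : cmul (aN N.+1) b = (fun n => cmul (aN N) b n + d n).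
    apply/funext => n; rewrite /cmul /d; case: leqP => [Nn|nN]; last first.
      rewrite addr0; apply: eq_bigr => i _; rewrite /aN.
      have iN : (i < N)%N by rewrite (leq_ltn_trans _ nN)// -ltnS.
      by rewrite iN ltnW.
    have Nn' : (N < n.+1)%N by [].
    rewrite (bigD1 (Ordinal Nn'))//= [in RHS](bigD1 (Ordinal Nn'))//=.
    rewrite /aN ltnn ltnSn mul0r add0r addrC; congr (_ + _).
    apply: eq_bigr => i; rewrite -val_eqE/= => iN.
    by rewrite ltnS leq_eqVlt (negbTE iN).
  have dsub : subexp d.
    have : subexp (fun n => cmul (aN N.+1) b n + (-1) * cmul (aN N) b n).
      by apply: subexpD; [|apply: subexpZ]; exact: subexp_cmul.
    by move/subexp_le; apply => n; rewrite cE mulN1r addrAC subrr add0r.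
  rewrite cE psumD//; last exact: subexp_cmul.
  rewrite IH big_ord_recr mulrDl; congr (_ + _).
  have [B sB hB] := subexp_dom1 hb q1.
  rewrite !psumE -(tsumZ _ sB hB).
  have [D sD hD] := subexp_dom1 dsub q1.
  have cd := tsum_cvg sD hD; apply: tsumE.
  rewrite -(cvg_shiftn N).
  have -> : (fun n => series (fun n => d n * q ^+ n) (n + N)%N) =
      series (fun n => a N * q ^+ N * (b n * q ^+ n)).
    apply/funext => n; rewrite /series /= addnC.
    rewrite (@big_cat_nat _ _ _ N)//= ?leq_addr//.
    rewrite big_nat big1 ?add0r; last first.
      by move=> i /andP[_ iN]; rewrite /d leqNgt iN mul0r.
    rewrite -{1}[N]add0n big_addn addKn; apply: eq_bigr => i _.
    by rewrite /d leq_addl addnK exprD; ring.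
  by apply: tsum_cvg (summZ (nm_ge0 (a N * q ^+ N)) sB) _ => n; rewrite nmM ler_wpM2l ?nm_ge0.
have lim1 : (fun N => psum (cmul (aN N) b) q) @ \oo --> psum (cmul a b) q.
  pose A n : C := (nm (a n))%:C; pose B n : C := (nm (b n))%:C.
  have sAB : subexp (cmul A B).
    by apply: subexp_cmul; [apply: subexp_le ha _|apply: subexp_le hb _] => n;
       rewrite nm_real ger0_norm ?nm_ge0.
  have q1' : nm ((nm q)%:C : C) < 1 by rewrite nm_real ger0_norm ?nm_ge0.
  have [D sD hD] := subexp_dom1 sAB q1'.
  have -> : (fun N => psum (cmul (aN N) b) q) =
      (fun N => tsum (fun n => cmul (aN N) b n * q ^+ n)).
    by apply/funext => N; rewrite psumE.
  rewrite psumE; apply: tannery sD _ _.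
    near=> N => n; apply: le_trans (hD n).
    rewrite !nmM !nmX nm_real (ger0_norm (nm_ge0 q)) ler_wpM2r ?exprn_ge0 ?nm_ge0//.
    apply: le_trans (le_nm_sum _ _ _) _.
    have -> : cmul A B n = (\sum_(i < n.+1) nm (a i) * nm (b (n - i)%N))%:C.
      by rewrite rmorph_sum; apply: eq_bigr => i _; rewrite rmorphM.
    rewrite nm_real; apply: le_trans (ler_norm _); apply: ler_sum => i _.
    rewrite nmM /aN; case: ifP => // _.
    by rewrite nm0 mul0r mulr_ge0 ?nm_ge0.
  move=> j; apply: cvg_near_cst; exists j.+1 => // N /= jN; congr (_ * _).
  by apply: eq_bigr => i _; rewrite /aN (leq_trans _ jN).
have lim2 : (fun N => psum (cmul (aN N) b) q) @ \oo --> (psum a q * psum b q : C).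
  have -> : (fun N => psum (cmul (aN N) b) q) =
      (fun N => series (fun n => a n * q ^+ n) N * psum b q).
    by apply/funext => N; rewrite finite /series /= big_mkord.
  exact: (cvgcM (psum_cvg ha q1) (cvgc_cst _)).
exact: (cvg_unique _ lim1 lim2).
Unshelve. all: by end_near. Qed.

(** Continuity at 0 along the positive axis gives [b 0 = 0]; then divide by [q]
    and repeat. *)
Lemma psum_eq0 b : subexp b ->
  (forall x : R, 0 < x < 1 -> psum b x%:C = 0) -> forall n, b n = 0.
Proof.
have head a : subexp a -> (forall x : R, 0 < x < 1 -> psum a x%:C = 0) -> a 0%N = 0.
  move=> ha h; have n01 : nm (0 : C) < 1 by rewrite nm0.
  have /cvg_nmP c0 := psum_continuous ha n01.
  apply/eqP; rewrite -nm_eq0 eq_le nm_ge0 andbT -(psum0 ha).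
  apply/ler_addgt0Pr => e e0; rewrite add0r.
  have [d /= d0 hd] := c0 e e0.
  have /andP[/eqP dI d0'] : (complex.Im d == 0) && (0 < complex.Re d).
    by move: d0; rewrite ltcE.
  pose x := Num.min (complex.Re d / 2) 2^-1.
  have x0 : 0 < x by rewrite lt_min; apply/andP; split; lra.
  have x1 : x < 1.
    have : x <= 2^-1 by rewrite ge_min lexx orbT.
    by lra.
  have xd : x < complex.Re d.
    have : x <= complex.Re d / 2 by rewrite ge_min lexx.
    by lra.
  have := hd (x%:C : C); rewrite h ?x0//.
  rewrite sub0r nmN; apply; rewrite /= sub0r normrN normE nm_real gtr0_norm//.
  by rewrite ltcE /= dI eqxx.
move=> + + n; elim: n b => [|n IH] b hb h; first exact: head.
apply: (IH (fun n => b n.+1)) => [|x x01]; first exact: subexp_shift.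
have /andP[x0 x1] := x01.
have xE : nm (x%:C : C) = x by rewrite nm_real gtr0_norm.
have := h x x01; rewrite psum_recl ?xE// (head b hb h) add0r => /eqP.
by rewrite mulf_eq0 -nm_eq0 xE gt_eqF// => /eqP.
Qed.

Lemma psum_inj a b : subexp a -> subexp b ->
  (forall x : R, 0 < x < 1 -> psum a x%:C = psum b x%:C) -> a = b.
Proof.
move=> ha hb h; apply/funext => n; apply/eqP; rewrite -subr_eq0; apply/eqP.
have hN : subexp (fun n => (-1) * b n) by exact: subexpZ.
have := psum_eq0 (subexpD ha hN) _ n; rewrite mulN1r; apply=> x x01.
have x1 : nm (x%:C : C) < 1 by rewrite nm_real gtr0_norm; lra.
by rewrite psumD// psumZ// h// mulN1r subrr.
Qed.

(** Termwise differentiation: the difference quotient of [q ^+ n] is a sum of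
    [n] monomials, so the quotient of the series is dominated by the series of
    the [n * b n] and is continuous. *)
Lemma cder_psum b q : subexp b -> nm q < 1 ->
  cder (psum b) q (psum (fun n => n.+1%:R * b n.+1) q).
Proof.
move=> hb /[dup] q1 /disc_nbhs[rho rho1 [qr wr]].
pose p n w : C := \sum_(i < n) w ^+ (n.-1 - i) * q ^+ i.
have hp n w : w ^+ n - q ^+ n = p n w * (w - q).
  by rewrite subrXX mulrC; congr (_ * _).
have hb' : subexp (fun n => n.+1%:R * b n.+1) by exact: subexp_shift (subexp_theta hb).
have [B sB hB] := subexp_dom hb' rho1.
pose B' n := if n is n'.+1 then B n' else 0.
have sB' : summ B'.
  have B0 n : 0 <= B' n by case: n => //= n; exact: sB.1.
  apply: (@summ_bounded _ _ (limn (series B))) => // -[|N].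
    by rewrite big_nil; apply: le_trans (series_le_lim 0 sB); rewrite /series/= big_nil.
  by rewrite big_nat_recl//= add0r; exact: series_le_lim.
have p_dom w : nm w <= rho -> dom (fun n => b n * p n w) B'.
  move=> wrho [|n]; first by rewrite /p big_ord0 mulr0 nm0.
  have rhoE : nm (rho%:C : C) = rho by rewrite nm_real ger0_norm//; lra.
  apply: le_trans (hB rho%:C _ n); last by rewrite rhoE.
  rewrite !nmM mulrAC mulrC ler_wpM2r ?nm_ge0//.
  apply: le_trans (le_nm_sum _ _ _) _; rewrite nm_nat nmX rhoE.
  have -> : n.+1%:R * rho ^+ n = \sum_(i < n.+1) rho ^+ n.
    by rewrite sumr_const card_ord mulr_natl.
  apply: ler_sum => i _; rewrite nmM !nmX.
  have -> : rho ^+ n = rho ^+ (n - i) * rho ^+ i by rewrite -exprD subnK// -ltnS.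
  by apply: ler_pM; rewrite ?exprn_ge0 ?nm_ge0// lerXn2r// nnegrE ?nm_ge0//; lra.
pose phi w : C := if nm w <= rho then tsum (fun n => b n * p n w)
                  else (psum b w - psum b q) / (w - q).
exists phi => [w|].
  rewrite /phi; case: ifP => [wrho|/negbT]; last first.
    rewrite -ltNge => rw; rewrite mulfVK// subr_eq0.
    by apply: contraTneq rw => ->; rewrite -leNgt.
  have rho_lt1 : rho < 1 by lra.
  have [A sA hA] := subexp_dom1 hb (le_lt_trans wrho rho_lt1).
  have [A' sA' hA'] := subexp_dom1 hb q1.
  rewrite mulrC -(tsumZ _ sB' (p_dom w wrho)) !psumE; apply/esym/tsumE.
  have -> : series (fun n => (w - q) * (b n * p n w)) =
      (fun N => series (fun n => b n * w ^+ n) N - series (fun n => b n * q ^+ n) N).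
    apply/funext => N; rewrite /series/= -sumrB.
    by apply: eq_bigr => i _; rewrite -mulrBr hp; ring.
  exact: (cvgcB (tsum_cvg sA hA) (tsum_cvg sA' hA')).
have phiE : \forall w \near q, tsum (fun n => b n * p n w) = phi w.
  by apply: filterS wr => w wrho; rewrite /phi wrho.
have -> : psum (fun n => n.+1%:R * b n.+1) q = tsum (fun n => b n * p n q).
  rewrite psumE (tsum_recl sB' (p_dom q qr)) {1}/p big_ord0 mulr0 add0r.
  congr tsum; apply/funext => n; rewrite /p.
  rewrite (eq_bigr (fun=> q ^+ n)) ?sumr_const ?card_ord ?mulr_natl.
    by rewrite -mulr_natl -[_ *+ _]mulr_natl; ring.
  by move=> i _; rewrite -exprD subnK// -ltnS.
have : (fun w => tsum (fun n => b n * p n w)) @ q --> tsum (fun n => b n * p n q).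
  apply: (@tannery _ C (nbhs q) _ _ _ B') => //; first exact: filterS wr.
  move=> j.
  have hi (i : 'I_j) : (fun w => w ^+ (j.-1 - i) * q ^+ i) @ q -->
      (q ^+ (j.-1 - i) * q ^+ i : C).
    exact: (cvgcM (cvgcX (cvg_idC q)) (cvgc_cst (q ^+ i))).
  have h := cvgc_sum (r := index_enum 'I_j) hi.
  exact: (cvgcM (cvgc_cst (b j)) (h _)).
by apply: cvg_trans; apply: near_eq_cvg.
Qed.

End PowerSeries.

(** * Expansions in [q] *)

Section QExpansions.
Variable R : realType.
Local Notation C := (R[i]^o).
Local Notation HH := (@upper_half_plane R).
Local Notation pi := (@pi R).
Implicit Types (a b : nat -> C) (q w z : C).

Lemma RecM z w : complex.Re (z * w) =
  complex.Re z * complex.Re w - complex.Im z * complex.Im w.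
Proof. by case: z w => [? ?] [? ?]. Qed.

Lemma ImcM z w : complex.Im (z * w) =
  complex.Re z * complex.Im w + complex.Im z * complex.Re w.
Proof. by case: z w => [? ?] [? ?]. Qed.

Definition tpi : C := 2 * 'i * pi%:C.

Lemma tpiE : tpi = 0 +i* (2 * pi).
Proof.
rewrite /tpi -complexiE; apply/eqP; rewrite eq_complex.
rewrite !RecM !ImcM /=; apply/andP; split; apply/eqP; ring.
Qed.

Lemma tpi_neq0 : tpi != 0.
Proof. by rewrite tpiE eq_complex /= negb_and orbC gt_eqF// mulr_gt0 ?pi_gt0. Qed.

Fact nome_key : unit. Proof. exact: tt. Qed.
Definition nome : C -> C := locked_with nome_key (@qpar R).

Lemma nome_qpar z : nome z = qpar z.
Proof. by rewrite /nome unlock. Qed.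

Lemma nomeE z : nome z = cexp (tpi * z).
Proof. by rewrite nome_qpar. Qed.

Lemma nomeD z w : nome (z + w) = nome z * nome w.
Proof. by rewrite !nomeE mulrDr cexpD. Qed.

Lemma nome0 : nome (0 : C) = 1.
Proof. by rewrite nomeE mulr0 cexp0. Qed.

Lemma nomeMn z n : nome (n%:R * z) = nome z ^+ n.
Proof. by rewrite !nomeE mulrCA cexpMn. Qed.

Lemma nm_nome z : nm (nome z) = expR (- (2 * pi * complex.Im z)).
Proof. by rewrite nomeE nm_cexp tpiE RecM /= mul0r sub0r. Qed.

Lemma nome_neq0 z : nome z != 0.
Proof. by rewrite nomeE cexp_neq0. Qed.

Lemma nome_lt1 z : HH z -> nm (nome z) < 1.
Proof.
by move=> zH; rewrite nm_nome expR_lt1 oppr_lt0 !mulr_gt0 ?pi_gt0.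
Qed.

Lemma cder_nome z : cder nome z (tpi * nome z).
Proof.
have h1 := cderZ tpi (cder_id z); rewrite mulr1 in h1.
have h := cder_comp h1 (cder_cexp (tpi * z)).
rewrite mulrC nomeE; apply: cder_near h.
by apply: near_all => w; rewrite /= nomeE.
Qed.

Lemma nome1 : nome (1 : C) = 1.
Proof.
rewrite nomeE mulr1 tpiE cexpE /= expR0 !mul1r mulr_natl cos2pi sin2pi.
by [].
Qed.

Lemma nome_nat n : nome (n%:R : C) = 1.
Proof. by rewrite -[n%:R]mulr1 nomeMn nome1 expr1n. Qed.

Lemma nome_int (n : int) : nome (n%:~R : C) = 1.
Proof.
case: n => n; first exact: nome_nat.
rewrite NegzE mulrNz; apply: (mulfI (nome_neq0 n.+1%:R)).
by rewrite -nomeD addrN nome0 nome_nat mulr1.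
Qed.

Lemma nomeDn z n : nome (z + n%:R) = nome z.
Proof. by rewrite nomeD nome_nat mulr1. Qed.

Lemma nome_real_neq1 (x : R) : 0 < x < 1 -> nome (x%:C : C) != 1.
Proof.
move=> /andP[x0 x1]; rewrite nomeE tpiE.
have -> : (0 +i* (2 * pi)) * x%:C = 0 +i* ((pi * x) *+ 2) :> C.
  apply/eqP; rewrite eq_complex RecM ImcM /= -mulr_natl.
  by apply/andP; split; apply/eqP; ring.
rewrite cexpE /= expR0 !mul1r eq_complex /= negb_and; apply/orP; left.
have s0 : 0 < sin (pi * x).
  by apply: sin_gt0_pi; rewrite mulr_gt0 ?pi_gt0//= gtr_pMr ?pi_gt0.
rewrite cos_mulr2n -mulr_natr lt_eqF//.
by have := sin2cos2 (pi * x); nra.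
Qed.

Lemma nome_imag (x : R) : 0 < x < 1 -> exists2 y : R, 0 < y &
  x%:C = nome (0 +i* y : C).
Proof.
move=> /andP[x0 x1]; exists (- ln x / (2 * pi)).
  by rewrite divr_gt0 ?mulr_gt0 ?pi_gt0// oppr_gt0 ln_lt0// x0.
have p0 : pi != 0 by rewrite gt_eqF// pi_gt0.
rewrite nomeE tpiE.
have -> : (0 +i* (2 * pi)) * (0 +i* (- ln x / (2 * pi))) = (ln x)%:C :> C.
  apply/eqP; rewrite eq_complex RecM ImcM /=.
  apply/andP; split; apply/eqP; last by ring.
  by move: pi p0 => p p0; field.
by rewrite cexpE /= cos0 sin0 mulr1 mulr0 lnK.
Qed.

(** Equality of two [q]-expansions may be tested on the imaginary axis. *)
Lemma qexp_inj a b : subexp a -> subexp b ->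
  (forall z, HH z -> psum a (nome z) = psum b (nome z)) -> a = b.
Proof.
move=> ha hb h; apply: psum_inj => // x /nome_imag[y y0 ->]; exact: h.
Qed.

Lemma root_filter N e : (0 < N)%N ->
  \sum_(j < N) nome (N%:R^-1 : C) ^+ (j * e) = if (N %| e)%N then N%:R else 0.
Proof.
move=> N0; set zeta := nome _.
have zN : zeta ^+ N = 1 by rewrite -nomeMn mulfV ?nome1// pnatr_eq0 -lt0n.
case: ifPn => [/dvdnP[k ->]|Ne].
  rewrite (eq_bigr (fun=> 1)) ?sumr_const ?card_ord// => j _.
  by rewrite mulnA mulnC exprM zN expr1n.
set x := zeta ^+ e.
have x1 : x != 1.
  rewrite /x (divn_eq e N) exprD mulnC exprM zN expr1n mul1r -nomeMn.
  have -> : (e %% N)%:R / N%:R = ((e %% N)%:R / N%:R : R)%:C :> C.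
    by rewrite rmorphM fmorphV !rmorph_nat.
  apply: nome_real_neq1; rewrite divr_gt0 ?ltr0n//= ?lt0n//.
  by rewrite ltr_pdivrMr ?ltr0n// mul1r ltr_nat ltn_pmod.
have -> : \sum_(j < N) zeta ^+ (j * e) = \sum_(j < N) x ^+ j.
  by apply: eq_bigr => j _; rewrite mulnC exprM.
apply/eqP; rewrite -(mulrI_eq0 _ (mulfI _ : GRing.lreg (x - 1))) ?subr_eq0//.
  by rewrite -subrX1 -exprM mulnC exprM zN expr1n subrr.
Qed.

Lemma tsum_sum (N : nat) (f : 'I_N -> nat -> C) (B : nat -> R) :
  summ B -> (forall j, dom (f j) B) ->
  \sum_(j < N) tsum (f j) = tsum (fun n => \sum_(j < N) f j n).
Proof.
move=> sB fB; apply/esym/tsumE.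
have h (j : 'I_N) := tsum_cvg sB (fB j).
have -> : series (fun n => \sum_(j < N) f j n) =
    (fun m => \sum_(j < N) series (f j) m).
  by apply/funext => m; rewrite /series/= exchange_big.
exact: (cvgc_sum (r := index_enum 'I_N) h).
Qed.

(** The average of [zeta ^- (j m) * F (zeta ^ j q)] over the [N]-th roots of
    unity keeps the coefficients of index congruent to [m] modulo [N]; for
    large [N] only [b m] remains. This replaces Cauchy's integral. *)
Lemma coef_bound b (y M : R) m : subexp b -> 0 < y ->
  (forall x : R, nm (psum b (nome (x +i* y))) <= M) ->
  nm (b m) * expR (- (2 * pi * y)) ^+ m <= M.
Proof.
move=> hb y0 hM; pose q := nome (0 +i* y : C).
have q1 : nm q < 1 by apply: nome_lt1.
have q01 : 0 <= nm q < 1 by rewrite q1 nm_ge0.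
have [B sB hB] := subexp_dom hb q01.
pose zeta N := nome (N%:R^-1 : C).
pose S N : C := tsum (fun n => b n * q ^+ n *
   (N%:R^-1 * \sum_(j < N) zeta N ^+ (j * (n + (N - m))))).
have nz N : nm (zeta N) = 1.
  rewrite nm_nome -(rmorph_nat (real_complex R)) -fmorphV /=.
  by rewrite mulr0 oppr0 expR0.
have SM N : (0 < N)%N -> nm (S N) <= M.
  move=> N0; have Nn0 : N%:R != 0 :> C by rewrite pnatr_eq0 -lt0n.
  have -> : S N = N%:R^-1 * \sum_(j < N) zeta N ^+ (j * (N - m)) *
      psum b (zeta N ^+ j * q).
    have hj (j : 'I_N) : dom (fun n => zeta N ^+ (j * (N - m)) *
         (b n * (zeta N ^+ j * q) ^+ n)) B.
      move=> n; rewrite nmM nmX nz expr1n mul1r; apply: hB.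
      by rewrite nmM nmX nz expr1n mul1r.
    have -> : \sum_(j < N) zeta N ^+ (j * (N - m)) * psum b (zeta N ^+ j * q) =
        \sum_(j < N) tsum (fun n => zeta N ^+ (j * (N - m)) *
         (b n * (zeta N ^+ j * q) ^+ n)).
      apply: eq_bigr => j _; rewrite psumE -(tsumZ _ sB)// => n; apply: hB.
      by rewrite nmM nmX nz expr1n mul1r.
    have sB' : summ (fun n => N%:R * B n) by apply: summZ.
    rewrite (tsum_sum sB hj) -(tsumZ _ sB').
      congr tsum; apply/funext => n; rewrite !big_distrr/=.
      apply: eq_bigr => j _; rewrite mulnDr exprD exprMn -exprM; ring.
    move=> n; apply: le_trans (le_nm_sum _ _ _) _.
    have -> : N%:R * B n = \sum_(j < N) B n.
      by rewrite sumr_const card_ord mulr_natl.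
    by apply: ler_sum => j _; exact: hj.
  rewrite nmM nmV nm_nat mulrC ler_pdivrMr ?ltr0n//.
  apply: le_trans (le_nm_sum _ _ _) _.
  have -> : M * N%:R = \sum_(j < N) M by rewrite sumr_const card_ord mulr_natr.
  apply: ler_sum => j _; rewrite nmM nmX nz expr1n mul1r.
  rewrite -nomeMn -nomeD.
  have -> : j%:R / N%:R + 0 +i* y = (j%:R / N%:R) +i* y :> C.
    rewrite -!(rmorph_nat (real_complex R)) -fmorphV -rmorphM.
    by apply/eqP; rewrite eq_complex RecD ImcD /= add0r addr0 !eqxx.
  exact: hM.
have Slim : S @ \oo --> (b m * q ^+ m : C).
  have -> : b m * q ^+ m = tsum (fun n => if n == m then b m * q ^+ m else 0).
    rewrite (@tsum_fin _ _ m.+1) => [|n mn]; last by rewrite gtn_eqF.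
    rewrite big_ord_recr/= eqxx big1 ?add0r// => i _.
    by rewrite (ltn_eqF (ltn_ord i)).
  have filt N n : (0 < N)%N -> N%:R^-1 * \sum_(j < N) zeta N ^+ (j * (n + (N - m))) =
      (if (N %| n + (N - m))%N then 1 else 0) :> C.
    move=> N0; rewrite root_filter//; case: ifP => _; last by rewrite mulr0.
    by rewrite mulVf// pnatr_eq0 -lt0n.
  apply: (@tannery _ nat \oo _ _ _ B) => //.
    exists 1%N => // N /= N0 n; rewrite filt//; case: ifP => _.
      by rewrite mulr1; exact: hB.
    by rewrite mulr0 nm0 sB.1.
  move=> n; apply: cvg_near_cst; exists (n + m).+1 => // N /= nmN.
  have N0 : (0 < N)%N by apply: leq_trans nmN.
  rewrite filt//; have [->|nm'] := eqVneq n m.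
    by rewrite subnKC ?dvdnn ?mulr1//; lia.
  rewrite ifF ?mulr0//; apply/negbTE.
  have [nlt|mlt] := ltnP n m.
    by rewrite gtnNdvd//; lia.
  have -> : (n + (N - m))%N = ((n - m) + N)%N by lia.
  rewrite dvdn_addl// gtnNdvd//; lia.
have -> : nm (b m) * expR (- (2 * pi * y)) ^+ m = nm (b m * q ^+ m).
  by rewrite nmM nmX nm_nome.
by apply: nm_cvg_le Slim _; exists 1%N.
Qed.

End QExpansions.

(** * Growth on the half-plane *)

Section GrowthOnHalfPlane.
Variable R : realType.
Local Notation C := (R[i]^o).
Local Notation HH := (@upper_half_plane R).
Local Notation pi := (@pi R).
Implicit Types (a b : nat -> C) (q w z : C).

Lemma HH_neq0 z : HH z -> z != 0.
Proof. by move=> zH; apply: contraTneq zH => ->; rewrite /= ltxx. Qed.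

Lemma ImcV z : complex.Im (- z^-1) = complex.Im z / nm z ^+ 2.
Proof.
by rewrite sqr_nm; case: z => x y; rewrite /= opprK.
Qed.

Lemma HH_inv z : HH z -> HH (- z^-1).
Proof.
move=> zH; have zH' : 0 < complex.Im z by [].
by rewrite /upper_half_plane /= ImcV divr_gt0// exprn_gt0// nm_gt0 HH_neq0.
Qed.

Lemma near_HH z : HH z -> \forall w \near z, HH w.
Proof.
move=> zH; have y0 : 0 < complex.Im z / 2 by rewrite divr_gt0.
apply: filterS (near_nm z y0) => w h.
have := le_trans (le_Im_nm _) h; rewrite ImcB ler_norml => /andP[h1 _].
have zH' : 0 < complex.Im z by [].
by rewrite /upper_half_plane /=; lra.
Qed.

(** A point of height below 1/2 can be translated to [`|Re z| <= 1/2], and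
    then inversion at least doubles its height. *)
Lemma bound_of_invariant (Phi : C -> R) (K : R) :
  (forall z, HH z -> Phi (z + 1) = Phi z) ->
  (forall z, HH z -> Phi (- z^-1) = Phi z) ->
  (forall z, 2^-1 <= complex.Im z -> Phi z <= K) ->
  forall z, HH z -> Phi z <= K.
Proof.
move=> hT hS hK.
have hTn z n : HH z -> Phi (z + n%:R) = Phi z.
  move=> zH; elim: n => [|n IH]; first by rewrite addr0.
  rewrite -natr1 addrA hT ?IH// /upper_half_plane /= ImcD.
  by rewrite -(rmorph_nat (real_complex R)) /= addr0.
have hTz z (n : int) : HH z -> Phi (z + n%:~R) = Phi z.
  move=> zH; case: n => n; first exact: hTn.
  rewrite NegzE mulrNz -(hTn (z - n.+1%:R) n.+1) ?subrK//.
  rewrite /upper_half_plane /= ImcB.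
  by rewrite -(rmorph_nat (real_complex R)) /= subr0.
suff h n z : HH z -> 2^-1 <= complex.Im z * 2 ^+ n -> Phi z <= K.
  move=> z zH; have zH' : 0 < complex.Im z by [].
  have [n hn] : exists n, 2^-1 <= complex.Im z * 2 ^+ n.
    have [n hn] : exists n : nat, (complex.Im z)^-1 <= n%:R.
      exists (Num.bound (complex.Im z)^-1); apply: ltW.
      by apply: archi_boundP; rewrite invr_ge0 ltW.
    exists n; have h2 : n%:R <= 2 ^+ n :> R.
      by rewrite -natrX ler_nat ltnW// ltn_expl.
    have : (complex.Im z)^-1 * complex.Im z <= 2 ^+ n * complex.Im z.
      by apply: ler_wpM2r; [exact: ltW|exact: le_trans hn h2].
    by rewrite mulVf ?gt_eqF// => ?; lra.
  exact: h hn.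
elim: n z => [|n IH] z zH; first by rewrite expr0 mulr1; exact: hK.
move=> hn; have [|yl] := leP 2^-1 (complex.Im z); first exact: hK.
pose k := - Num.floor (complex.Re z + 2^-1).
pose w := z + k%:~R.
have kE : (k%:~R : C) = (k%:~R : R)%:C by rewrite rmorph_int.
have wI : complex.Im w = complex.Im z by rewrite /w kE ImcD /= addr0.
have wR : `|complex.Re w| <= 2^-1.
  rewrite /w kE RecD /= /k mulrNz.
  have := floor_le (complex.Re z + 2^-1).
  have := floorD1_gt (complex.Re z + 2^-1); rewrite intrD => ? ?.
  by rewrite ler_norml; apply/andP; split; lra.
have wH : HH w by rewrite /upper_half_plane /= wI.
rewrite -(hTz z k zH) -/w -hS//; apply: IH; first exact: HH_inv.
have y0 : 0 < complex.Im z by [].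
rewrite ImcV sqr_nm wI; set y := complex.Im z in yl y0 hn *.
have R2 : complex.Re w ^+ 2 <= 4^-1.
  rewrite -(real_normK (num_real _)).
  have -> : 4^-1 = 2^-1 ^+ 2 :> R by field.
  by rewrite lerXn2r ?nnegrE// invr_ge0.
have D0 : 0 < complex.Re w ^+ 2 + y ^+ 2.
  by rewrite ltr_wpDl ?sqr_ge0// exprn_gt0.
apply: le_trans hn _; rewrite exprS mulrA ler_wpM2r ?exprn_ge0//.
rewrite ler_pdivlMr//.
have : complex.Re w ^+ 2 + y ^+ 2 <= 2^-1 by move: R2; rewrite !expr2; nra.
nra.
Qed.

Lemma pow_le_expR (x : R) n : 0 <= x -> x ^+ n <= n`!%:R * expR x.
Proof.
case: n => [|n] x0; first by rewrite expr0 mul1r; have := expR_ge1Dx x; lra.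
rewrite mulrC -ler_pdivrMr ?ltr0n ?fact_gt0//.
by have := expR_ge1Dxn n x0; lra.
Qed.

Lemma nome_half_le z : 2^-1 <= complex.Im z -> nm (nome z) <= expR (- pi).
Proof.
move=> zI; rewrite nm_nome ler_expR lerN2.
by have := @pi_gt0 R; nra.
Qed.

Lemma psum_half_bound b : subexp b -> exists2 L : R, 0 <= L &
  forall z, 2^-1 <= complex.Im z -> nm (psum b (nome z)) <= L.
Proof.
move=> hb.
have e1 : 0 <= expR (- pi) < 1.
  by rewrite expR_ge0 expR_lt1 oppr_lt0 pi_gt0.
have [B sB hB] := subexp_dom hb e1; exists (limn (series B)).
  by apply: le_trans (series_le_lim 0 sB); rewrite /series/= big_nil.
by move=> z /nome_half_le zI; apply: nm_psum_le sB _; exact: hB.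
Qed.

(** For a cusp form of weight [2 s], [`|f| * y ^ s] is invariant, and decays at
    the cusp. *)
Lemma cusp_bound b s : subexp b -> b 0%N = 0 ->
  (forall z, HH z -> nm (psum b (nome (- z^-1))) =
                     nm z ^+ (2 * s) * nm (psum b (nome z))) ->
  exists2 K : R, 0 <= K &
    forall z, HH z -> nm (psum b (nome z)) * complex.Im z ^+ s <= K.
Proof.
move=> hb b0 hS; have [L L0 hL] := psum_half_bound (subexp_shift hb).
have K0 : 0 <= L * s`!%:R by rewrite mulr_ge0.
exists (L * s`!%:R) => // z.
apply: (@bound_of_invariant (fun z => nm (psum b (nome z)) * complex.Im z ^+ s)) => {}z.
- move=> zH; rewrite nomeD nome1 mulr1 ImcD.
  by have -> : complex.Im (1 : R[i]) = 0 by []; rewrite addr0.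
- move=> zH; have z0 : nm z != 0 by rewrite nm_eq0 HH_neq0.
  move: (hS z zH) (ImcV z); move: (- z^-1) => w -> ->.
  move: (nm z) (complex.Im z) (nm (psum b _)) z0 => A Y F A0.
  rewrite exprMn exprVn -exprM; have := expf_neq0 (2 * s) A0.
  by move: (A ^+ (2 * s)) (Y ^+ s) => B Z B0; field.
move=> zI; have zH : HH z by rewrite /upper_half_plane /=; lra.
rewrite psum_recl ?nome_lt1// b0 add0r nmM.
have y0 : 0 <= complex.Im z by lra.
have p2 : complex.Im z <= 2 * pi * complex.Im z by have := @pi_ge2 R; nra.
have h1 : complex.Im z ^+ s <= s`!%:R * expR (2 * pi * complex.Im z).
  apply: le_trans (pow_le_expR _ _); last by lra.
  by rewrite lerXn2r// nnegrE//; lra.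
have h2 : nm (nome z) * complex.Im z ^+ s <= s`!%:R.
  by rewrite nm_nome expRN [leLHS]mulrC ler_pdivrMr ?expR_gt0.
rewrite mulrAC mulrC; apply: ler_pM => //; first exact: nm_ge0.
  by rewrite mulr_ge0 ?nm_ge0 ?exprn_ge0.
exact: hL.
Qed.

(** Hecke's bound: extract the [n]-th coefficient at height [1 / n]. *)
Lemma hecke_bound b s : subexp b -> b 0%N = 0 ->
  (forall z, HH z -> nm (psum b (nome (- z^-1))) =
                     nm z ^+ (2 * s) * nm (psum b (nome z))) ->
  exists2 K : R, 0 <= K & forall n, (0 < n)%N -> nm (b n) <= K * n%:R ^+ s.
Proof.
move=> hb b0 hS; have [K K0 hK] := cusp_bound hb b0 hS.
exists (K * expR (2 * pi)) => [|n n0]; first by rewrite mulr_ge0 ?expR_ge0.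
have nR : 0 < n%:R :> R by rewrite ltr0n.
have y0 : 0 < n%:R^-1 :> R by rewrite invr_gt0.
have hM (x : R) : nm (psum b (nome (x +i* n%:R^-1))) <= K * n%:R ^+ s.
  have := hK (x +i* n%:R^-1) y0; rewrite /= exprVn.
  by rewrite ler_pdivrMr ?exprn_gt0.
have := coef_bound n hb y0 hM.
rewrite -expRM_natl mulrN mulrCA divff ?gt_eqF// mulr1 expRN.
by rewrite ler_pdivrMr ?expR_gt0// mulrAC.
Qed.

(** There are no modular forms of negative weight: here [`|f| * y ^ (- t)] is
    bounded, and letting [y] tend to 0 kills every coefficient. *)
Lemma negative_weight b t : (0 < t)%N -> subexp b ->
  (forall z, HH z -> nm z ^+ (2 * t) * nm (psum b (nome (- z^-1))) =
                     nm (psum b (nome z))) ->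
  forall n, b n = 0.
Proof.
move=> t0 hb hS; have [L L0 hL] := psum_half_bound hb.
have hK z : HH z -> nm (psum b (nome z)) / complex.Im z ^+ t <= L * 2 ^+ t.
  apply: (@bound_of_invariant (fun z => nm (psum b (nome z)) / complex.Im z ^+ t)) => {}z.
  - move=> zH; rewrite nomeD nome1 mulr1 ImcD.
    by have -> : complex.Im (1 : R[i]) = 0 by []; rewrite addr0.
  - move=> zH; move: (hS z zH) (ImcV z); move: (- z^-1) => w <- ->.
    move: (nm z) (complex.Im z) (nm (psum b _)) => A Y F.
    rewrite exprMn exprVn -exprM invf_div.
    by move: (A ^+ (2 * t)) (Y ^+ t) => B Z; rewrite mulrCA mulrA.
  move=> zI; apply: ler_pM; rewrite ?nm_ge0 ?hL// ?invr_ge0 ?exprn_ge0//; first lra.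
  by rewrite -exprVn lerXn2r ?nnegrE ?invr_ge0//; [lra|rewrite invf_ple ?posrE//; lra].
move=> n; apply/eqP; rewrite -nm_eq0 eq_le nm_ge0 andbT.
set K := L * 2 ^+ t in hK; set E := expR (2 * pi) ^+ n.
have K0 : 0 <= K by rewrite mulr_ge0// exprn_ge0.
have E0 : 0 < E by rewrite exprn_gt0// expR_gt0.
apply/ler_addgt0Pr => e e0; rewrite add0r.
pose y := Num.min 1 (e / (K * E + 1)).
have D0 : 0 < K * E + 1 by rewrite ltr_wpDl// mulr_ge0// ltW.
have y0 : 0 < y by rewrite lt_min ltr01 divr_gt0.
have y1 : y <= 1 by rewrite ge_min lexx.
have ye : y * (K * E + 1) <= e.
  by rewrite -ler_pdivlMr// ge_min lexx orbT.
have hM (x : R) : nm (psum b (nome (x +i* y))) <= K * y.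
  have := hK (x +i* y) y0; rewrite /= ler_pdivrMr ?exprn_gt0// => h.
  apply: le_trans h _; rewrite ler_wpM2l// -(prednK t0) exprS.
  by apply: ler_piMr; [exact: ltW|apply: exprn_ile1 => //; exact: ltW].
have := coef_bound n hb y0 hM.
have E1 : E^-1 <= expR (- (2 * pi * y)) ^+ n.
  rewrite /E -exprVn -expRN lerXn2r ?nnegrE ?expR_ge0// ler_expR lerN2.
  by have := @pi_gt0 R; nra.
move=> h; have : nm (b n) * E^-1 <= K * y.
  by apply: le_trans h; rewrite ler_wpM2l ?nm_ge0.
rewrite ler_pdivrMr// => h2; apply: le_trans h2 _; apply: le_trans ye.
by rewrite mulrAC [leRHS]mulrC; nra.
Qed.

End GrowthOnHalfPlane.

(** * Finite sums over roots of unity *)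

Section PartialFractions.
Variable R : realType.
Local Notation C := (R[i]^o).
Local Notation HH := (@upper_half_plane R).
Local Notation pi := (@pi R).
Implicit Types (u v w z : C).

Lemma summ_inv_sq (K : R) : 0 <= K -> summ (fun n => K / n.+1%:R ^+ 2).
Proof.
move=> K0; apply: summZ => //.
have n0 n : 0 < n.+1%:R :> R by rewrite ltr0n.
apply: (@summ_bounded _ _ 2) => [n|N]; first by rewrite invr_ge0 exprn_ge0.
case: N => [|N]; first by rewrite big_nil.
suff : \sum_(0 <= k < N.+1) (k.+1%:R ^+ 2)^-1 <= 2 - N.+1%:R^-1 :> R.
  by move=> h; apply: le_trans h _; rewrite gerBl invr_ge0 ltW.
elim: N => [|N IH]; first by rewrite big_nat1 expr1n; lra.
rewrite big_nat_recr//=.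
suff h : (N.+2%:R ^+ 2)^-1 <= N.+1%:R^-1 - N.+2%:R^-1 :> R.
  by apply: le_trans (lerD IH h) _; rewrite addrA subrK.
have -> : N.+1%:R^-1 - N.+2%:R^-1 = (N.+1%:R * N.+2%:R)^-1 :> R.
  have a0 := n0 N; have b0 := n0 N.+1.
  have : N.+2%:R = N.+1%:R + 1 :> R by rewrite -natr1.
  move: (N.+1%:R) (N.+2%:R) a0 b0 => x y x0 y0 yE; rewrite yE.
  by field; apply/andP; split; rewrite gt_eqF//; lra.
by rewrite lef_pV2 ?posrE ?mulr_gt0 ?exprn_gt0// expr2 ler_pM2r// ler_nat.
Qed.

Definition node (N : nat) u (j : nat) : C := nome ((u + j%:R) / N%:R).

Lemma nodeE N u j : node N u j = nome (u / N%:R) * nome (N%:R^-1 : C) ^+ j.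
Proof. by rewrite /node mulrDl nomeD nomeMn. Qed.

Lemma nodeXN N u j : (0 < N)%N -> node N u j ^+ N = nome u.
Proof.
move=> N0; rewrite /node -nomeMn mulrCA divff ?mulr1 ?nomeDn//.
by rewrite pnatr_eq0 -lt0n.
Qed.

Lemma sum_nodeX N u e : (0 < N)%N ->
  \sum_(j < N) node N u j ^+ e =
  if (N %| e)%N then N%:R * nome (u / N%:R) ^+ e else 0.
Proof.
move=> N0; have -> : \sum_(j < N) node N u j ^+ e =
   nome (u / N%:R) ^+ e * \sum_(j < N) nome (N%:R^-1 : C) ^+ (j * e).
  by rewrite big_distrr/=; apply: eq_bigr => j _; rewrite nodeE exprMn exprM.
by rewrite root_filter//; case: ifP => _; rewrite ?mulr0// mulrC.
Qed.

Lemma node_neq1 N u j : (0 < N)%N -> nome u != 1 -> 1 - node N u j != 0.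
Proof.
move=> N0; apply: contraNneq => /eqP; rewrite subr_eq0 eq_sym => /eqP e.
by rewrite -(nodeXN u j N0) e expr1n.
Qed.

(** [1 - Y] divides [1 - Y ^+ N = 1 - nome u]. In the sums over all the [N]-th
    roots [Y] of [nome u], only the powers of [Y] whose exponent is divisible by
    [N] survive. *)
Lemma inv_nodeE N u j : (0 < N)%N -> nome u != 1 ->
  (1 - node N u j)^-1 = (1 - nome u)^-1 * \sum_(n < N) node N u j ^+ n.
Proof.
move=> N0 u1; have h1 := node_neq1 j N0 u1.
have h2 : 1 - nome u != 0 by rewrite subr_eq0 eq_sym.
apply: (mulfI h1); rewrite divff// mulrCA.
have -> : (1 - node N u j) * \sum_(n < N) node N u j ^+ n = 1 - nome u.
  rewrite -(nodeXN u j N0).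
  by rewrite -opprB mulNr -subrX1 opprB.
by rewrite mulVf.
Qed.

Lemma sum_inv_node N u : (0 < N)%N -> nome u != 1 ->
  \sum_(j < N) (1 - node N u j)^-1 = N%:R / (1 - nome u).
Proof.
move=> N0 u1; under eq_bigr do rewrite inv_nodeE//.
rewrite -big_distrr/= exchange_big/=.
under eq_bigr do rewrite sum_nodeX//.
case: N N0 => // N _; rewrite big_ord_recl dvdn0 expr0 mulr1 big1 ?addr0; last first.
  by move=> i _; rewrite gtnNdvd.
by rewrite mulrC.
Qed.

Lemma sum_inv_sq_node N u : (0 < N)%N -> nome u != 1 ->
  \sum_(j < N) node N u j / (1 - node N u j) ^+ 2 =
  N%:R ^+ 2 * (nome u / (1 - nome u) ^+ 2).
Proof.
move=> N0 u1; set D := (1 - nome u)^-1.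
have -> : \sum_(j < N) node N u j / (1 - node N u j) ^+ 2 =
    D ^+ 2 * \sum_(n1 < N) \sum_(n2 < N) \sum_(j < N) node N u j ^+ (n1 + n2).+1.
  under [in RHS]eq_bigr do rewrite exchange_big/=.
  rewrite exchange_big/= big_distrr/=; apply: eq_bigr => j _.
  rewrite -exprVn inv_nodeE// exprMn [in LHS]mulrCA; congr (_ * _).
  rewrite expr2 big_distrlr/= big_distrr/=; apply: eq_bigr => n1 _.
  rewrite big_distrr/=; apply: eq_bigr => n2 _.
  by rewrite -exprD -exprS.
have inner (n1 : 'I_N) : \sum_(n2 < N) \sum_(j < N) node N u j ^+ (n1 + n2).+1 =
    N%:R * nome u.
  rewrite (bigD1 (rev_ord n1))//= [X in _ + X]big1 ?addr0; last first.
    move=> n2 n2n1; rewrite sum_nodeX//; case: ifP => // /dvdnP[k kE].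
    have := ltn_ord n1; have := ltn_ord n2 => l2 l1.
    have k1 : k = 1%N by nia.
    by case/eqP: n2n1; apply/val_inj => /=; move: kE; rewrite k1 mul1n; lia.
  have -> : (n1 + (N - n1.+1)).+1 = N by have := ltn_ord n1; lia.
  by rewrite sum_nodeX// dvdnn -nomeMn mulrCA divff ?mulr1// pnatr_eq0 -lt0n.
rewrite (eq_bigr _ (fun n1 _ => inner n1)) sumr_const card_ord -mulr_natl.
by rewrite exprVn; ring.
Qed.

Lemma sum_symmetric (g : C -> C) u M : (forall v, g (v + 1) = g v) ->
  \sum_(j < (2 * M).+1) g ((u + j%:R) / (2 * M).+1%:R) =
  g (u / (2 * M).+1%:R) +
  \sum_(j < M) (g ((u + j.+1%:R) / (2 * M).+1%:R) +
                g ((u - j.+1%:R) / (2 * M).+1%:R)).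
Proof.
move=> gT; set N := (2 * M).+1.
rewrite big_ord_recl addr0 big_split/=; congr (_ + _).
have -> : \sum_(i < 2 * M) g ((u + (bump 0 i)%:R) / N%:R) =
    \sum_(0 <= i < M + M) g ((u + i.+1%:R) / N%:R).
  by rewrite addnn -mul2n big_mkord; apply: eq_bigr => i _; rewrite /bump add1n.
rewrite (@big_cat_nat _ _ _ M)//= ?leq_addr// big_mkord; congr (_ + _).
rewrite -{1}[M]add0n big_addn addnK big_nat_rev/= big_mkord.
apply: eq_bigr => j _; have jM := ltn_ord j.
have -> : (0 + M - j.+1 + M).+1%:R = N%:R - j.+1%:R :> C.
  by rewrite -natrB /N; [congr (_%:R); lia|lia].
have -> : (u + (N%:R - j.+1%:R)) / N%:R = (u - j.+1%:R) / N%:R + 1 :> C.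
  by rewrite addrA addrAC mulrDl divff// pnatr_eq0.
by rewrite gT.
Qed.

Lemma sin_pi_ge : exists2 c : R, 0 < c <= 1 &
  forall x : R, 0 <= x <= 3 / 4 -> c * x <= sin (pi * x).
Proof.
have p0 := @pi_gt0 R.
pose c0 : R := cos (3 * pi / 8).
have c0gt : 0 < c0 by apply: cos_gt0_pihalf; apply/andP; split; lra.
have c0le : c0 <= 1 by exact: cos_le1.
exists (c0 ^+ 3) => [|x /andP[x0 x1]].
  by rewrite exprn_gt0// exprn_ile1// ltW.
have cosge (t : R) : 0 <= t -> t <= 3 * pi / 8 -> c0 <= cos t.
  move=> t0 t1; have [->//|tn] := eqVneq t (3 * pi / 8).
  apply: ltW; rewrite /c0 ltr_cos ?in_itv/=; last 2 first.
  - by apply/andP; split; lra.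
  - by apply/andP; split; lra.
  by rewrite lt_neqAle tn.
have singe (t : R) : 0 <= t -> t <= 3 * pi / 8 -> c0 * t <= sin t.
  move=> t0 t1; have cs : {within `[0, t], continuous (@sin R)}.
    by apply: continuous_subspaceT => ?; exact: continuous_sin.
  have [s] := MVT_segment t0 (fun r _ => is_derive_sin r) cs.
  rewrite in_itv/= => /andP[s0 s1]; rewrite sin0 !subr0 => ->.
  by rewrite ler_wpM2r// cosge//; lra.
pose t := pi * x / 4.
have t0 : 0 <= t by rewrite /t; nra.
have t1 : t <= 3 * pi / 16 by rewrite /t; nra.
have s2 (r : R) : sin (r * 2) = cos r * sin r * 2.
  by rewrite !mulr_natr sin_mulr2n.
have -> : pi * x = t * 2 * 2 by rewrite /t; field.
rewrite !s2.
have h1 := singe t t0 ltac:(lra).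
have h2 := cosge t t0 ltac:(lra).
have h3 : c0 <= cos (t * 2) by apply: cosge; lra.
have h4 : c0 * (c0 * t) <= cos t * sin t.
  by apply: ler_pM => //; [lra|rewrite mulr_ge0//; lra].
have h5 : c0 * (c0 * (c0 * t)) <= cos (t * 2) * (cos t * sin t).
  by apply: ler_pM => //; [lra|rewrite !mulr_ge0//; lra].
have p1 : 1 <= pi by have := @pi_ge2 R; lra.
have : c0 ^+ 3 * x <= c0 ^+ 3 * (t * 4).
  have xt : x <= t * 4 by rewrite /t; nra.
  by apply: ler_wpM2l => //; apply: exprn_ge0; exact: ltW.
have -> : c0 ^+ 3 * (t * 4) = c0 * (c0 * (c0 * t)) * 4 by ring.
have -> : cos (t * 2) * (cos t * sin t * 2) * 2 =
  cos (t * 2) * (cos t * sin t) * 4 by ring.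
by lra.
Qed.

(** With [v = x + i y] and [rho = exp (- 2 pi y)], [|1 - nome v| ^ 2] is
    [(1 - rho) ^ 2 + 4 rho sin (pi x) ^ 2]; the two terms control [y] and [x]. *)
Lemma nome_dist_ge : exists2 c : R, 0 < c &
  forall v, `|complex.Re v| <= 3 / 4 -> 0 <= complex.Im v <= 1 ->
    c * nm v <= nm (1 - nome v).
Proof.
have [c1 /andP[c10 c11] hc1] := sin_pi_ge.
pose r0 : R := expR (- (2 * pi)).
have r00 : 0 < r0 by exact: expR_gt0.
have p0 := @pi_gt0 R; have p2 := @pi_ge2 R.
have r01 : r0 <= 1 by rewrite expR_le1; lra.
exists (r0 * c1) => [|v]; first exact: mulr_gt0.
set x := complex.Re v; set y := complex.Im v => hx /andP[y0 y1].
have sq : c1 ^+ 2 * x ^+ 2 <= sin (pi * x) ^+ 2.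
  have h := hc1 `|x|; rewrite normr_ge0 hx in h.
  have hs : c1 * `|x| <= `|sin (pi * x)|.
    apply: le_trans (h isT) _; case: (leP 0 x) => x0.
      by rewrite (ger0_norm x0) ler_norm.
    by rewrite (ltr0_norm x0) mulrN sinN -[`|sin _|]normrN ler_norm.
  rewrite -exprMn -(real_normK (num_real (c1 * x))) -[leRHS]real_normK ?num_real//.
  rewrite lerXn2r ?nnegrE// normrM (gtr0_norm c10)//.
set rho : R := expR (- (2 * pi * y)).
have rho0 : r0 <= rho by rewrite ler_expR; nra.
have rho1 : r0 * y <= 1 - rho.
  have h : rho * (1 + 2 * pi * y) <= 1.
    have e1 : rho * expR (2 * pi * y) = 1 by rewrite -expRD addNr expR0.
    by rewrite -[leRHS]e1 ler_wpM2l ?expR_ge0// expR_ge1Dx.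
  have yy : y <= 2 * pi * y by nra.
  have h2 : r0 * y <= rho * (2 * pi * y) by apply: ler_pM => //; exact: ltW.
  by rewrite mulrDr mulr1 in h; lra.
have nE : nm (1 - nome v) ^+ 2 = (1 - rho) ^+ 2 + 4 * rho * sin (pi * x) ^+ 2.
  have hRe : complex.Re (tpi R * v) = - (2 * pi * y).
    by rewrite tpiE RecM /= mul0r sub0r.
  have hIm : complex.Im (tpi R * v) = (pi * x) *+ 2.
    by rewrite tpiE ImcM /= mul0r add0r -mulrA mulr_natl.
  rewrite sqr_nm RecB ImcB nomeE cexpE hRe hIm /=.
  rewrite -/rho cos_mulr2n sin_mulr2n -[X in X - 1]mulr_natr -[cos _ * _ *+ 2]mulr_natr.
  have -> : cos (pi * x) ^+ 2 = 1 - sin (pi * x) ^+ 2 by rewrite sin2cos2; ring.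
  have := cos2Dsin2 (pi * x); move: (cos _) (sin _) => co si h.
  have e : co ^+ 2 = 1 - si ^+ 2 by lra.
  have -> : (0 - rho * (co * si * 2)) ^+ 2 = rho ^+ 2 * co ^+ 2 * si ^+ 2 * 4 by ring.
  by rewrite e; ring.
have main : (r0 * c1 * nm v) ^+ 2 <= nm (1 - nome v) ^+ 2.
  rewrite nE exprMn sqr_nm -/x -/y.
  have e1 : (r0 * y) ^+ 2 <= (1 - rho) ^+ 2.
    by rewrite lerXn2r// ?nnegrE; [|nra]; rewrite mulr_ge0// ltW.
  have e2 : r0 ^+ 2 * (c1 ^+ 2 * x ^+ 2) <= 4 * rho * sin (pi * x) ^+ 2.
    apply: ler_pM => //; [exact: sqr_ge0|by rewrite mulr_ge0 ?sqr_ge0|].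
    rewrite expr2; nra.
  have e3 : (r0 * c1) ^+ 2 * y ^+ 2 <= (r0 * y) ^+ 2.
    rewrite !exprMn mulrAC; apply: ler_piMr.
      by rewrite mulr_ge0 ?sqr_ge0.
    by apply: exprn_ile1 => //; exact: ltW.
  have -> : (r0 * c1) ^+ 2 * (x ^+ 2 + y ^+ 2) =
     r0 ^+ 2 * (c1 ^+ 2 * x ^+ 2) + (r0 * c1) ^+ 2 * y ^+ 2 by ring.
  lra.
by move: main; rewrite ler_sqr// nnegrE ?nm_ge0// mulr_ge0 ?nm_ge0// mulr_ge0// ltW.
Qed.

End PartialFractions.

(** * Partial fractions of the cotangent *)

Section CotangentSeries.
Variable R : realType.
Local Notation C := (R[i]^o).
Local Notation HH := (@upper_half_plane R).
Local Notation pi := (@pi R).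
Local Notation tpi := (@tpi R).
Implicit Types (u v w z : C).

Lemma cvg_inv_odd : (fun M => ((2 * M).+1%:R)^-1 : C) @ \oo --> (0 : C).
Proof.
apply/cvg_nmP => e e0; exists (Num.bound e^-1) => // M /= bM.
rewrite subr0 nmV nm_nat -[leRHS]invrK lef_pV2 ?posrE ?invr_gt0//.
have := archi_boundP (_ : 0 <= e^-1); rewrite invr_ge0 ltW// => /(_ isT) h.
apply: le_trans (ltW h) _; rewrite ler_nat; lia.
Qed.

(** Tends to [- 2 pi i v], which turns the finite identities over the roots of
    unity into partial fractions. The order is odd so that the roots are indexed
    by a symmetric interval. *)
Definition sdiff v M : C := (2 * M).+1%:R * (1 - nome (v / (2 * M).+1%:R)).

Lemma odd_neq0 M : (2 * M).+1%:R != 0 :> C.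
Proof. by rewrite pnatr_eq0. Qed.

Lemma cvg_vodd v : (fun M => v / (2 * M).+1%:R) @ \oo --> (0 : C).
Proof.
have h := cvgcM (cvgc_cst v) cvg_inv_odd; rewrite mulr0 in h; exact: h.
Qed.

Lemma sdiff_cvg v : sdiff v @ \oo --> (- (tpi * v) : C).
Proof.
have [phi hphi cphi] := cder_nome (0 : C).
have -> : sdiff v = (fun M => - (phi (v / (2 * M).+1%:R) * v)).
  apply/funext => M; rewrite /sdiff; have := hphi (v / (2 * M).+1%:R).
  rewrite nome0 subr0 => h; rewrite -opprB h mulrN; congr (- _).
  by rewrite mulrCA; congr (_ * _); rewrite mulrC divfK// odd_neq0.
rewrite nome0 mulr1 in cphi.
have h := cvg_comp (fun M => v / (2 * M).+1%:R) phi (cvg_vodd v) cphi.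
exact: (cvgcN (cvgcM h (cvgc_cst v))).
Qed.

Lemma nome_cvg1 v : (fun M => nome (v / (2 * M).+1%:R)) @ \oo --> (1 : C).
Proof.
have h := cvg_comp (fun M => v / (2 * M).+1%:R) (@nome R) (cvg_vodd v)
  (cder_cvg (cder_nome (0 : C))).
by rewrite nome0 in h; exact: h.
Qed.

Arguments sdiff_cvg : clear implicits.
Arguments nome_cvg1 : clear implicits.
Arguments cvg_vodd : clear implicits.

(** The points at which the partial fraction expansions are needed: [u] lies in
    the closed upper half-plane, away from the integers. *)
Definition away u : Prop := [/\ 0 <= complex.Im u, u != 0, nome u != 1 &
  exists2 d : R, 0 < d & forall j : nat,
    d * j.+1%:R <= nm (u + j.+1%:R) /\ d * j.+1%:R <= nm (u - j.+1%:R)].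

Lemma Re_nat n : complex.Re (n%:R : R[i]) = n%:R.
Proof. by rewrite -(rmorph_nat (real_complex R)). Qed.

Lemma Im_nat n : complex.Im (n%:R : R[i]) = 0.
Proof. by rewrite -(rmorph_nat (real_complex R)). Qed.

(** A bound uniform in [M], for the domination in Tannery's theorem. *)
Lemma sdiff_ge u : 0 <= complex.Im u -> exists2 c : R, 0 < c &
  \forall M \near \oo, forall j, (j < M)%N ->
    c * nm (u + j.+1%:R) <= nm (sdiff (u + j.+1%:R) M) /\
    c * nm (u - j.+1%:R) <= nm (sdiff (u - j.+1%:R) M).
Proof.
move=> u0; have [c c0 hc] := @nome_dist_ge R; exists c => //.
pose A := 2 * `|complex.Re u| + complex.Im u.
have A0 : 0 <= A by rewrite addr_ge0// mulr_ge0.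
exists (Num.bound A) => // M /= bM j jM.
have hM : A <= M%:R.
  by apply: le_trans (ltW (archi_boundP A0)) _; rewrite ler_nat.
have Nn : 0 < (2 * M).+1%:R :> R by rewrite ltr0n.
have NE : (2 * M).+1%:R = 2 * M%:R + 1 :> R by rewrite -natr1 natrM.
have Re0 := normr_ge0 (complex.Re u).
have jM' : j.+1%:R <= M%:R :> R by rewrite ler_nat.
have j0 : 0 <= j.+1%:R :> R by [].
have key v : complex.Im v = complex.Im u ->
    `|complex.Re v| <= `|complex.Re u| + j.+1%:R ->
    c * nm v <= nm (sdiff v M).
  move=> vI vR; rewrite /sdiff nmM nm_nat.
  have vN : v / (2 * M).+1%:R =
      (complex.Re v / (2 * M).+1%:R) +i* (complex.Im v / (2 * M).+1%:R).
    rewrite -(rmorph_nat (real_complex R)) -fmorphV; apply/eqP.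
    by rewrite eq_complex RecM ImcM /= !mulr0 subr0 add0r !eqxx.
  have -> : c * nm v = (2 * M).+1%:R * (c * nm (v / (2 * M).+1%:R)).
    by rewrite nmM nmV nm_nat [RHS]mulrCA [X in _ = _ * X]mulrCA divff ?gt_eqF// mulr1.
  rewrite ler_pM2l//; apply: hc; rewrite vN /=.
    rewrite normrM normfV (gtr0_norm Nn) ler_pdivrMr// NE; rewrite /A in hM; lra.
  rewrite vI; apply/andP; split; first by rewrite divr_ge0// ltW.
  rewrite ler_pdivrMr// mul1r NE; rewrite /A in hM; lra.
split; apply: key.
- by rewrite ImcD Im_nat addr0.
- by rewrite RecD Re_nat; apply: le_trans (ler_normD _ _) _; rewrite (ger0_norm j0).
- by rewrite ImcB Im_nat subr0.
- by rewrite RecB Re_nat; apply: le_trans (ler_normB _ _) _; rewrite (ger0_norm j0).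
Qed.

Lemma away_neq0 u j : away u -> u + j.+1%:R != 0 /\ u - j.+1%:R != 0.
Proof.
move=> [_ _ _ [d d0 hd]]; have [h1 h2] := hd j.
have p : 0 < d * j.+1%:R by rewrite mulr_gt0// ltr0n.
by split; rewrite -nm_gt0; [exact: lt_le_trans h1|exact: lt_le_trans h2].
Qed.

Lemma sdiff_inv_le (c d : R) v M j : 0 < c -> 0 < d -> d * j.+1%:R <= nm v ->
  c * nm v <= nm (sdiff v M) -> nm (sdiff v M)^-1 <= (c * d)^-1 / j.+1%:R.
Proof.
move=> c0 d0 hv hs; have j0 : 0 < j.+1%:R :> R by rewrite ltr0n.
have cd : 0 < c * d * j.+1%:R by rewrite !mulr_gt0.
have h : c * d * j.+1%:R <= nm (sdiff v M).
  by rewrite -mulrA; apply: le_trans hs; rewrite ler_wpM2l// ltW.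
by rewrite nmV -invfM lef_pV2 ?posrE//; exact: lt_le_trans h.
Qed.

Lemma dom_inv_sq u : away u -> exists2 K : R, 0 <= K &
  dom (fun j => (u + j.+1%:R) ^- 2 + (u - j.+1%:R) ^- 2) (fun j => K / j.+1%:R ^+ 2).
Proof.
move=> [_ _ _ [d d0 hd]]; exists (2 * d ^- 2) => [|j].
  by rewrite mulr_ge0// invr_ge0 exprn_ge0// ltW.
have [h1 h2] := hd j; have j0 : 0 < j.+1%:R :> R by rewrite ltr0n.
have p : 0 < d * j.+1%:R by rewrite mulr_gt0.
have key v : d * j.+1%:R <= nm v -> nm (v ^- 2) <= d ^- 2 / j.+1%:R ^+ 2.
  move=> hv; have v0 : 0 < nm v by exact: lt_le_trans hv.
  rewrite nmV nmX -invfM -exprMn lef_pV2 ?posrE ?exprn_gt0//.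
  by rewrite lerXn2r ?nnegrE ?nm_ge0// ltW.
apply: le_trans (le_nmD _ _) _.
apply: le_trans (lerD (key _ h1) (key _ h2)) _.
by rewrite -mulrA mulr_natl mulr2n.
Qed.

(** Lipschitz's formula of order 2, as a limit of [sum_inv_sq_node]. *)
Lemma lipschitz2 u : away u ->
  u ^- 2 + tsum (fun j => (u + j.+1%:R) ^- 2 + (u - j.+1%:R) ^- 2) =
  tpi ^+ 2 * (nome u / (1 - nome u) ^+ 2).
Proof.
move=> au; have [uI u0 u1 [d d0 hd]] := au.
pose P v M : C := nome (v / (2 * M).+1%:R) * (sdiff v M) ^- 2.
pose T M j : C := if (j < M)%N then P (u + j.+1%:R) M + P (u - j.+1%:R) M else 0.
have Plim v : v != 0 -> P v @ \oo --> (tpi ^- 2 * v ^- 2 : C).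
  move=> v0; have n0 : - (tpi * v) != 0 by rewrite oppr_eq0 mulf_neq0// tpi_neq0.
  have n2 : (- (tpi * v)) ^+ 2 != 0 by rewrite expf_neq0.
  have h := cvgcM (nome_cvg1 v) (cvgcV n2 (cvgcX (n := 2) (sdiff_cvg v))).
  by rewrite mul1r sqrrN exprMn invfM in h; exact: h.
have [c c0 hc] := sdiff_ge uI.
have Pdom v M j : 0 <= complex.Im v -> d * j.+1%:R <= nm v ->
    c * nm v <= nm (sdiff v M) -> nm (P v M) <= (c * d) ^- 2 / j.+1%:R ^+ 2.
  move=> vI hv hs; rewrite /P nmM.
  have h1 : nm (nome (v / (2 * M).+1%:R)) <= 1.
    rewrite nm_nome expR_le1 oppr_le0.
    have -> : complex.Im (v / (2 * M).+1%:R) = complex.Im v / (2 * M).+1%:R.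
      by rewrite -(rmorph_nat (real_complex R)) -fmorphV ImcM /= mulr0 add0r.
    by rewrite !mulr_ge0 ?pi_ge0 ?invr_ge0.
  have h2 := sdiff_inv_le c0 d0 hv hs.
  have -> : sdiff v M ^- 2 = (sdiff v M)^-1 ^+ 2 by rewrite exprVn.
  have -> : (c * d) ^- 2 / j.+1%:R ^+ 2 = ((c * d)^-1 / j.+1%:R) ^+ 2.
    by rewrite [RHS]exprMn !exprVn.
  rewrite nmX -[leRHS]mul1r; apply: ler_pM => //; rewrite ?exprn_ge0 ?nm_ge0//.
  by rewrite lerXn2r ?nnegrE ?nm_ge0//; apply: le_trans h2; rewrite nm_ge0.
have Tlim : (fun M => tsum (T M)) @ \oo --> tsum (fun j => tpi ^- 2 *
    ((u + j.+1%:R) ^- 2 + (u - j.+1%:R) ^- 2)).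
  apply: (@tannery _ nat \oo _ _ _ (fun j => (2 * (c * d) ^- 2) / j.+1%:R ^+ 2)).
  - by apply: summ_inv_sq; rewrite mulr_ge0// invr_ge0 exprn_ge0// mulr_ge0// ltW.
  - apply: filterS hc => M hM j; rewrite /T; case: ifP => [jM|_]; last first.
      by rewrite nm0 divr_ge0 ?exprn_ge0// mulr_ge0// invr_ge0 exprn_ge0// mulr_ge0// ltW.
    have [h1 h2] := hd j; have [h3 h4] := hM j jM.
    apply: le_trans (le_nmD _ _) _.
    have Ip : 0 <= complex.Im (u + j.+1%:R) by rewrite ImcD Im_nat addr0.
    have Im : 0 <= complex.Im (u - j.+1%:R) by rewrite ImcB Im_nat subr0.
    apply: le_trans (lerD (Pdom _ _ _ Ip h1 h3) (Pdom _ _ _ Im h2 h4)) _.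
    by rewrite -mulrA mulr_natl mulr2n.
  move=> j; have [n1 n2] := away_neq0 j au; rewrite mulrDr.
  apply: (cvgc_near _ (cvgcD (Plim _ n1) (Plim _ n2))).
  by exists j.+1 => // M /= jM; rewrite /T jM.
have id M : P u M + tsum (T M) = nome u / (1 - nome u) ^+ 2.
  rewrite (@tsum_fin _ _ M) => [|n Mn]; last by rewrite /T ltnNge Mn.
  pose g v : C := nome v / (1 - nome v) ^+ 2.
  have gT v : g (v + 1) = g v by rewrite /g nomeD nome1 mulr1.
  have := sum_symmetric u M gT.
  have -> : \sum_(j < (2 * M).+1) g ((u + j%:R) / (2 * M).+1%:R) =
     (2 * M).+1%:R ^+ 2 * (nome u / (1 - nome u) ^+ 2).
    by rewrite -sum_inv_sq_node.
  have Pg v : P v M = (2 * M).+1%:R ^- 2 * g (v / (2 * M).+1%:R).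
    by rewrite /P /g /sdiff exprMn invfM mulrCA.
  have -> : \sum_(n < M) T M n = (2 * M).+1%:R ^- 2 * \sum_(j < M)
     (g ((u + j.+1%:R) / (2 * M).+1%:R) + g ((u - j.+1%:R) / (2 * M).+1%:R)).
    rewrite big_distrr/=; apply: eq_bigr => j _.
    by rewrite /T ltn_ord !Pg mulrDr.
  rewrite Pg -mulrDr => <-; rewrite mulrA mulVf ?mul1r//.
  by rewrite expf_neq0// odd_neq0.
have [K K0 hK] := dom_inv_sq au.
have l1 := cvgcD (Plim u u0) Tlim.
have l2 : (fun M => P u M + tsum (T M)) @ \oo --> (nome u / (1 - nome u) ^+ 2 : C).
  have -> : (fun M => P u M + tsum (T M)) = (fun=> nome u / (1 - nome u) ^+ 2).
    by apply/funext => M; exact: id.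
  exact: cvgc_cst.
have E := cvg_unique (@norm_hausdorff _ _) (l1 _) l2.
rewrite -E (tsumZ _ (summ_inv_sq K0) hK) -mulrDr mulrA divff ?mul1r//.
by rewrite expf_neq0// tpi_neq0.
Qed.

(** The partial fraction expansion of the cotangent, from [sum_inv_node]; the
    terms of index [j] and [- j] are paired to make the series absolutely
    convergent. *)
Lemma cot_sum u : away u ->
  u^-1 + tsum (fun j => 2 * u / ((u + j.+1%:R) * (u - j.+1%:R))) =
  - tpi * ((1 - nome u)^-1 - 2^-1).
Proof.
move=> au; have [uI u0 u1 [d d0 hd]] := au.
pose T M j : C := if (j < M)%N then sdiff (2 * u) M /
  (sdiff (u + j.+1%:R) M * sdiff (u - j.+1%:R) M) else 0.
have [c c0 hc] := sdiff_ge uI.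
have [L hL] : exists L : R, \forall M \near \oo, nm (sdiff (2 * u) M) <= L.
  exists (nm (- (tpi * (2 * u))) + 1).
  have h := (cvg_nmP _ _).1 (sdiff_cvg (2 * u)) 1 ltr01.
  apply: filterS (h _) => M hM.
  by have := le_nm_dist (sdiff (2 * u) M) (- (tpi * (2 * u))); lra.
have L0 : 0 <= L.
  by have [M _ hM] := hL; apply: le_trans (hM M (leqnn _)); exact: nm_ge0.
have cd0 : 0 <= (c * d)^-1 by rewrite invr_ge0 mulr_ge0// ltW.
have Tlim : (fun M => tsum (T M)) @ \oo --> tsum (fun j => - tpi^-1 *
    (2 * u / ((u + j.+1%:R) * (u - j.+1%:R)))).
  apply: (@tannery _ nat \oo _ _ _ (fun j => (L * (c * d)^-1 ^+ 2) / j.+1%:R ^+ 2)).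
  - by apply: summ_inv_sq; rewrite mulr_ge0// exprn_ge0.
  - apply: filterS2 hc hL => M hM hLM j; rewrite /T; case: ifP => [jM|_]; last first.
      by rewrite nm0 divr_ge0 ?exprn_ge0// mulr_ge0// exprn_ge0.
    have [h1 h2] := hd j; have [h3 h4] := hM j jM.
    rewrite nmM invfM (nmM (sdiff _ _)^-1) -mulrA; apply: ler_pM; rewrite ?nm_ge0 ?mulr_ge0 ?nm_ge0//.
    have k1 := sdiff_inv_le c0 d0 h1 h3; have k2 := sdiff_inv_le c0 d0 h2 h4.
    apply: le_trans (ler_pM (nm_ge0 _) (nm_ge0 _) k1 k2) _.
    by rewrite -expr2 exprMn !exprVn.
  move=> j; have [n1 n2] := away_neq0 j au.
  have m1 : - (tpi * (u + j.+1%:R)) != 0 by rewrite oppr_eq0 mulf_neq0// tpi_neq0.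
  have m2 : - (tpi * (u - j.+1%:R)) != 0 by rewrite oppr_eq0 mulf_neq0// tpi_neq0.
  have h := cvgcM (sdiff_cvg (2 * u)) (cvgcV (mulf_neq0 m1 m2)
    (cvgcM (sdiff_cvg (u + j.+1%:R)) (sdiff_cvg (u - j.+1%:R)))).
  have -> : - tpi^-1 * (2 * u / ((u + j.+1%:R) * (u - j.+1%:R))) =
     - (tpi * (2 * u)) / (- (tpi * (u + j.+1%:R)) * - (tpi * (u - j.+1%:R))).
    have t0 := tpi_neq0 R; move: n1 n2; move: (u + _) (u - _) => x y n1 n2.
    by move: tpi t0 => t t0; field; rewrite t0 n1 n2.
  apply: (cvgc_near _ (h _ _ _)).
  by exists j.+1 => // M /= jM; rewrite /T jM.
pose g v : C := (1 - nome v)^-1 - 2^-1.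
have gT v : g (v + 1) = g v by rewrite /g nomeD nome1 mulr1.
pose Q M : C := (sdiff u M)^-1 - ((2 * M).+1%:R)^-1 / 2.
have Qlim : Q @ \oo --> (- tpi^-1 * u^-1 : C).
  have m1 : - (tpi * u) != 0 by rewrite oppr_eq0 mulf_neq0// tpi_neq0.
  have h := cvgcB (cvgcV m1 (sdiff_cvg u)) (cvgcM cvg_inv_odd (cvgc_cst (2^-1 : C))).
  by rewrite mul0r subr0 invrN invfM -mulNr in h; exact: h.
have idM : \forall M \near \oo, Q M + tsum (T M) = (1 - nome u)^-1 - 2^-1.
  apply: filterS hc => M hM; rewrite (@tsum_fin _ _ M) => [|n Mn]; last by rewrite /T ltnNge Mn.
  have N0 := odd_neq0 M.
  have := sum_symmetric u M gT.
  have -> : \sum_(j < (2 * M).+1) g ((u + j%:R) / (2 * M).+1%:R) =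
     (2 * M).+1%:R * ((1 - nome u)^-1 - 2^-1).
    rewrite /g sumrB (@sum_inv_node _ (2 * M).+1)// sumr_const card_ord.
    by rewrite -[X in _ - X]mulr_natl mulrBr.
  have -> : g (u / (2 * M).+1%:R) = (2 * M).+1%:R * Q M.
    rewrite /Q /g /sdiff invfM mulrBr; congr (_ - _); last by rewrite mulrA divff ?mul1r.
    by rewrite mulrA divff ?mul1r.
  have -> : \sum_(n < M) (g ((u + n.+1%:R) / (2 * M).+1%:R) +
      g ((u - n.+1%:R) / (2 * M).+1%:R)) = (2 * M).+1%:R * \sum_(n < M) T M n.
    rewrite big_distrr/=; apply: eq_bigr => j _; rewrite /T ltn_ord.
    have [h1 h2] := hd j; have [h3 h4] := hM j (ltn_ord j).
    have [n1 n2] := away_neq0 j au.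
    have s1 : sdiff (u + j.+1%:R) M != 0.
      by rewrite -nm_gt0; apply: lt_le_trans h3; rewrite mulr_gt0// nm_gt0.
    have s2 : sdiff (u - j.+1%:R) M != 0.
      by rewrite -nm_gt0; apply: lt_le_trans h4; rewrite mulr_gt0// nm_gt0.
    move: s1 s2; rewrite /g /sdiff !mulf_eq0 !negb_or => /andP[_ s1] /andP[_ s2].
    have e : nome (2 * u / (2 * M).+1%:R) = nome ((u + j.+1%:R) / (2 * M).+1%:R)
       * nome ((u - j.+1%:R) / (2 * M).+1%:R).
      by rewrite -nomeD; congr nome; rewrite -mulrDl; congr (_ / _); ring.
    rewrite e; move: s1 s2 N0; move: (nome _) (nome _) => x y.
    move: ((2 * M).+1%:R) => N s1 s2 N0.
    by field; rewrite N0 s1 s2.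
  by rewrite -mulrDr => /(mulfI N0).
have l1 := cvgcD Qlim Tlim.
have l2 : (fun M => Q M + tsum (T M)) @ \oo --> ((1 - nome u)^-1 - 2^-1 : C).
  by apply: cvg_near_cst.
have E := cvg_unique (@norm_hausdorff _ _) (l1 _) l2.
rewrite -E.
have [K K0 hK] : exists2 K : R, 0 <= K &
   dom (fun j => 2 * u / ((u + j.+1%:R) * (u - j.+1%:R))) (fun j => K / j.+1%:R ^+ 2).
  exists (nm (2 * u) * d ^- 2) => [|j].
    by rewrite mulr_ge0 ?nm_ge0// invr_ge0 exprn_ge0// ltW.
  have [h1 h2] := hd j; have j0 : 0 < j.+1%:R :> R by rewrite ltr0n.
  have p : 0 < d * j.+1%:R by rewrite mulr_gt0.
  rewrite nmM -mulrA; apply: ler_wpM2l; first exact: nm_ge0.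
  have h3 : (d * j.+1%:R) ^+ 2 <= nm (u + j.+1%:R) * nm (u - j.+1%:R).
    by rewrite expr2; apply: ler_pM => //; exact: ltW.
  rewrite nmV nmM -invfM -exprMn lef_pV2 ?posrE ?exprn_gt0//.
  by apply: lt_le_trans h3; rewrite exprn_gt0.
rewrite (tsumZ _ (summ_inv_sq K0) hK) -mulrDr mulrA mulrNN divff ?mul1r//.
exact: tpi_neq0.
Qed.

End CotangentSeries.

(** * The value of [zeta] at 2 and Lambert series *)

Section EisensteinTwo.
Variable R : realType.
Local Notation C := (R[i]^o).
Local Notation HH := (@upper_half_plane R).
Local Notation pi := (@pi R).
Local Notation tpi := (@tpi R).
Implicit Types (q u v w z : C).

Lemma cvgc_subseq (f : nat -> C) (s : nat -> nat) (l : C) :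
  (forall N, (N <= s N)%N) -> f @ \oo --> l -> (fun N => f (s N)) @ \oo --> l.
Proof.
move=> sN fl; apply/cvg_nmP => e e0.
have [n _ hn] := (cvg_nmP _ _).1 fl e e0.
by exists n => // N /= nN; apply: hn; apply: leq_trans (sN N).
Qed.

Lemma nome_half : nome (2^-1 : C) = -1.
Proof.
rewrite nomeE cexpE; have -> : tpi * 2^-1 = 0 +i* pi.
  rewrite tpiE -[2]/(2%:R) -(rmorph_nat (real_complex R)) -fmorphV.
  apply/eqP; rewrite eq_complex RecM ImcM /=.
  by apply/andP; split; apply/eqP; [ring|field].
rewrite /= expR0 cospi sinpi !mul1r; apply/eqP.
by rewrite eq_complex /= oppr0 !eqxx.
Qed.

Lemma half_real : (2^-1 : C) = (2^-1 : R)%:C.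
Proof. by rewrite fmorphV rmorph_nat. Qed.

Lemma away_half : away (2^-1 : C).
Proof.
have n2 : nm (2^-1 : C) = 2^-1 by rewrite nmV nm_nat.
split.
- by rewrite half_real.
- by rewrite -nm_gt0 n2 invr_gt0.
- by rewrite nome_half -subr_eq0 -opprD oppr_eq0 -[1 + 1]/(2%:R) pnatr_eq0.
exists 2^-1 => [|j]; first by rewrite invr_gt0.
have j0 : 0 <= j%:R :> R by [].
have jE : j.+1%:R = j%:R + 1 :> R by rewrite -natr1.
rewrite half_real -(rmorph_nat (real_complex R)) -rmorphD -rmorphB !nm_real jE.
split; first by apply: le_trans (ler_norm _); lra.
by rewrite -normrN; apply: le_trans (ler_norm _); lra.
Qed.

Definition zeta2 : C := tsum (fun j => j.+1%:R ^- 2).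

Lemma dom_nat_sq (a : nat -> nat) : (forall j, (j < a j)%N) ->
  dom (fun j => (a j)%:R ^- 2 : C) (fun j => 1 / j.+1%:R ^+ 2).
Proof.
move=> ha j; rewrite nmV nmX nm_nat mul1r lef_pV2 ?posrE ?exprn_gt0 ?ltr0n//.
  by rewrite lerXn2r ?nnegrE// ler_nat.
by apply: leq_ltn_trans (ha j).
Qed.

Lemma mul4_inv_sq (x : C) : 4 * (2 * x) ^- 2 = x ^- 2.
Proof.
have e : 4 = 2 ^+ 2 :> C by ring.
have n2 : 2 ^+ 2 != 0 :> C by rewrite expf_neq0// pnatr_eq0.
by rewrite exprMn invfM mulrA {1}e divff// mul1r.
Qed.

(** Euler's value [pi ^ 2 / 6]: Lipschitz's formula at 1/2 sums the inverse odd
    squares. *)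
Lemma zeta2E : 24 * zeta2 = - tpi ^+ 2.
Proof.
pose o j : C := (2 * j).+1%:R ^- 2.
have so := @summ_inv_sq R 1 ler01.
have ho : dom o (fun j => 1 / j.+1%:R ^+ 2) by apply: dom_nat_sq => j; lia.
have ho' : dom (fun j => o j.+1) (fun j => 1 / j.+1%:R ^+ 2).
  by apply: (dom_nat_sq (a := fun j => (2 * j.+1).+1)) => j; lia.
have hz : dom (fun j => j.+1%:R ^- 2 : C) (fun j => 1 / j.+1%:R ^+ 2).
  exact: (dom_nat_sq (a := succn)).
have h8 : 8 * tsum o = - tpi ^+ 2 / 4.
  have := lipschitz2 away_half; rewrite nome_half.
  have -> : tsum (fun j => (2^-1 + j.+1%:R) ^- 2 + (2^-1 - j.+1%:R) ^- 2) =
      4 * tsum (fun j => o j.+1) + 4 * tsum o.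
    rewrite -(tsumZ _ so ho) -(tsumZ _ so ho').
    have s4 : summ (fun j => 4 * (1 / j.+1%:R ^+ 2) : R) by exact: (summZ (ler0n R 4) so).
    rewrite -(tsumD s4 _ s4); last 2 first.
    - by move=> j; rewrite nmM nm_nat ler_wpM2l//; exact: ho'.
    - by move=> j; rewrite nmM nm_nat ler_wpM2l//; exact: ho.
    congr tsum; apply/funext => j; congr (_ + _); rewrite /o.
    - have -> : (2 * j.+1).+1%:R = 2 * (2^-1 + j.+1%:R) :> C.
        by rewrite -natr1 natrM mulrDr divff ?pnatr_eq0// addrC.
      by rewrite mul4_inv_sq.
    - have -> : (2 * j).+1%:R = 2 * - (2^-1 - j.+1%:R) :> C.
        rewrite -[(2 * j).+1%:R]natr1 natrM -[j.+1%:R]natr1.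
        by move: (j%:R) => x; field.
      by rewrite mul4_inv_sq sqrrN.
  have o0 : o 0%N = 1 by rewrite /o muln0 expr1n invr1.
  rewrite (tsum_recl so ho) o0 exprVn invrK => h.
  have -> : 8 * (1 + tsum (fun j => o j.+1)) =
    2 ^+ 2 + (4 * tsum (fun j => o j.+1) + 4 * (1 + tsum (fun j => o j.+1))) by ring.
  have e4 : (1 - -1) ^+ 2 = 4 :> C by ring.
  by rewrite h e4 mulrA mulrN1.
have hE : zeta2 = tsum o + 4^-1 * zeta2.
  have l1 : (fun N => series (fun j => j.+1%:R ^- 2 : C) (2 * N)%N) @ \oo --> zeta2.
    by apply: (@cvgc_subseq _ (fun N => (2 * N)%N)) => [N|]; [lia|exact: tsum_cvg so hz].
  have l2 := cvgcD (tsum_cvg so ho) (cvgcM (cvgc_cst (4^-1 : C)) (tsum_cvg so hz)).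
  have e : (fun N => series (fun j => j.+1%:R ^- 2 : C) (2 * N)%N) =
     (fun N => series o N + 4^-1 * series (fun j => j.+1%:R ^- 2 : C) N).
    apply/funext => N; rewrite /series/=; elim: N => [|N IH].
      by rewrite muln0 !big_nil mulr0 addr0.
    have -> : (2 * N.+1 = (2 * N).+2)%N by lia.
    rewrite !big_nat_recr//= IH /o mulrDr.
    have -> : (2 * N).+2%:R = 2 * N.+1%:R :> C by rewrite -natrM; congr (_%:R); lia.
    have -> : (2 * N.+1%:R : C) ^- 2 = 4^-1 * N.+1%:R ^- 2.
      by rewrite -(mul4_inv_sq N.+1%:R) mulrA mulVf ?mul1r// pnatr_eq0.
    ring.
  rewrite e in l1; exact: (cvg_unique (@norm_hausdorff _ _) l1 (l2 _ _ _)).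
have h34 : 4 * zeta2 = 4 * tsum o + zeta2.
  by rewrite {1}hE mulrDr mulrA divff ?mul1r// pnatr_eq0.
transitivity (4 * (8 * tsum o)); last by rewrite h8 mulrCA divff ?mulr1// pnatr_eq0.
have -> : 8 * tsum o = 2 * (4 * zeta2 - zeta2) by rewrite h34; ring.
ring.
Qed.

Definition phi2 u : C := nome u / (1 - nome u) ^+ 2.

Lemma subexp_nat : subexp (fun n => n%:R : C).
Proof.
by apply: (subexp_poly (K := 1) (m := 1)) => n; rewrite nm_nat mul1r expr1 ler_nat.
Qed.

Lemma psum_nat (X : C) : nm X < 1 -> psum (fun n => n%:R) X = X / (1 - X) ^+ 2.
Proof.
move=> X1; have n0 : 1 - X != 0.
  rewrite subr_eq0 eq_sym; apply: contraTneq X1 => ->.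
  by rewrite nm1 ltxx.
have h1 : psum (fun=> 1) X = (1 - X)^-1.
  have := psum_recl (subexp_const 1) X1; move: (psum _ _) => S e.
  apply: (mulfI n0); rewrite divff// mulrBl mul1r {1}e; ring.
have := psum_recl subexp_nat X1.
have -> : psum (fun n => n.+1%:R) X = psum (fun n => n%:R) X + (1 - X)^-1.
  rewrite -h1 -psumD//; [|exact: subexp_nat|exact: subexp_const].
  by congr psum; apply/funext => n; rewrite -natr1.
move: (psum _ _) => T e; rewrite add0r mulrDr in e.
apply: (mulfI n0); rewrite mulrBl mul1r {1}e expr2.
by move: n0; move: (1 - X) => D n0; field.
Qed.

(** The coefficients of [q ^ m / (1 - q ^ m) ^ 2]. *)
Definition spread (m n : nat) : C := if (m %| n)%N then (n %/ m)%:R else 0.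

Lemma spread_le m n : nm (spread m n) <= n%:R.
Proof.
rewrite /spread; case: ifP => _; last by rewrite nm0.
by rewrite nm_nat ler_nat leq_div.
Qed.

Lemma subexp_spread m : subexp (spread m).
Proof.
apply: subexp_le subexp_nat _ => n; rewrite nm_nat; exact: spread_le.
Qed.

Lemma psum_spread m q : (0 < m)%N -> nm q < 1 ->
  psum (spread m) q = psum (fun n => n%:R) (q ^+ m).
Proof.
move=> m0 q1.
have qm1 : nm (q ^+ m) < 1 by rewrite nmX exprn_ilt1 ?nm_ge0// -lt0n.
have l1 : (fun K => series (fun n => spread m n * q ^+ n) (m * K)%N) @ \oo --> psum (spread m) q.
  apply: (@cvgc_subseq _ (fun K => (m * K)%N)) => [K|]; first by rewrite leq_pmull.
  exact: psum_cvg (subexp_spread m) q1.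
have l2 := psum_cvg subexp_nat qm1.
apply: (cvg_unique (@norm_hausdorff _ _) l1).
have -> : (fun K => series (fun n => spread m n * q ^+ n) (m * K)%N) =
    series (fun n => n%:R * (q ^+ m) ^+ n); last exact: l2.
apply/funext => K; rewrite /series/=; elim: K => [|K IH]; first by rewrite muln0 !big_nil.
rewrite (@big_cat_nat _ _ _ (m * K))//= ?leq_pmul2l// IH big_nat_recr//=; congr (_ + _).
rewrite big_ltn ?ltn_pmul2l// {1}/spread dvdn_mulr// mulKn// exprM big_nat big1 ?addr0//.
move=> i /andP[iK1 iK2]; rewrite /spread ifF ?mul0r//.
apply/negP => /dvdnP[k kE]; move: iK1 iK2.
by rewrite kE [(k * m)%N]mulnC !ltn_pmul2l// ltnS => /leq_trans h /h; rewrite ltnn.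
Qed.

Definition sigmaC (n : nat) : C := if n is 0 then 0 else (sigma n)%:R.

Lemma sigma_spread N n : (n <= N)%N -> \sum_(m < N) spread m.+1 n = sigmaC n.
Proof.
case: n => [|n] nN.
  by rewrite big1// => m _; rewrite /spread dvdn0 div0n.
have n0 : (0 < n.+1)%N by [].
have inv : perm_eq [seq (n.+1 %/ d)%N | d <- divisors n.+1] (divisors n.+1).
  have k d : d \in divisors n.+1 -> (n.+1 %/ (n.+1 %/ d))%N = d.
    by rewrite -dvdn_divisors// => hd; rewrite divnA// mulKn.
  apply: uniq_perm; rewrite ?divisors_uniq//.
    rewrite map_inj_in_uniq ?divisors_uniq// => a b /k ka /k kb e.
    by rewrite -ka -kb e.
  move=> x; apply/mapP/idP => [[d hd ->]|hx].
    by move: hd; rewrite -!dvdn_divisors// => hd; exact: dvdn_div.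
  exists (n.+1 %/ x)%N; last by rewrite k.
  by move: hx; rewrite -!dvdn_divisors//; exact: dvdn_div.
have dE : perm_eq [seq d <- iota 1 N | (d %| n.+1)%N] (divisors n.+1).
  apply: uniq_perm; rewrite ?divisors_uniq ?filter_uniq ?iota_uniq// => x.
  rewrite mem_filter mem_iota -dvdn_divisors// add1n ltnS andbC.
  case: (boolP (x %| n.+1)%N) => hx; rewrite ?andbT ?andbF//.
  by rewrite (dvdn_gt0 n0 hx)/= (leq_trans (dvdn_leq n0 hx)).
rewrite /sigmaC /sigma -(perm_big _ inv)/= big_map -(perm_big _ dE)/=.
rewrite big_filter natr_sum [RHS]big_mkcond/=.
rewrite -(big_mkord xpredT (fun m => spread m.+1 n.+1)).
rewrite -[iota 1 N]/(iota (1 + 0) N) iotaDl big_map -/(index_iota 0 N).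
by rewrite /index_iota subn0; apply: eq_bigr => m _; rewrite /spread add1n.
Qed.

Lemma sigmaC_le n : nm (sigmaC n) <= n%:R ^+ 2.
Proof.
rewrite -(sigma_spread (leqnn n)); apply: le_trans (le_nm_sum _ _ _) _.
have -> : n%:R ^+ 2 = \sum_(m < n) n%:R :> R.
  by rewrite sumr_const card_ord -[RHS]mulr_natl expr2.
by apply: ler_sum => m _; exact: spread_le.
Qed.

Lemma subexp_sigma : subexp sigmaC.
Proof.
apply: (subexp_poly (K := 1) (m := 2)) => n; rewrite mul1r.
by apply: le_trans (sigmaC_le n) _; rewrite lerXn2r ?nnegrE// ler_nat.
Qed.

(** Lambert's rearrangement: the row sums of the lattice add up to the series
    with coefficients [sigma n]. *)
Lemma lambert z : HH z ->
  series (fun m => phi2 (m.+1%:R * z)) @ \oo --> psum sigmaC (nome z).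
Proof.
move=> zH; have q1 := nome_lt1 zH.
pose s N n : C := \sum_(m < N) spread m.+1 n.
have s_le N n : nm (s N n) <= nm (sigmaC n).
  have -> : sigmaC n = \sum_(m < maxn n N) spread m.+1 n.
    by rewrite sigma_spread// leq_maxl.
  have spE m : spread m.+1 n = (complex.Re (spread m.+1 n))%:C /\
      0 <= complex.Re (spread m.+1 n).
    by rewrite /spread; case: ifP => _; rewrite ?Re_nat ?rmorph_nat.
  have sE M : \sum_(m < M) spread m.+1 n = (\sum_(m < M) complex.Re (spread m.+1 n))%:C.
    by rewrite rmorph_sum; apply: eq_bigr => m _; exact: (spE m).1.
  have s0 M : 0 <= \sum_(m < M) complex.Re (spread m.+1 n).
    by apply: sumr_ge0 => m _; exact: (spE m).2.
  rewrite /s !sE !nm_real !ger0_norm//.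
  rewrite -!(big_mkord xpredT (fun m => complex.Re (spread m.+1 n))).
  rewrite (@big_cat_nat _ _ _ N 0 (maxn n N))//= ?leq_maxr// lerDl.
  by apply: sumr_ge0 => m _; exact: (spE m).2.
have ss N : subexp (s N) by apply: subexp_le subexp_sigma (s_le N).
have -> : series (fun m => phi2 (m.+1%:R * z)) = (fun N => tsum (fun n => s N n * nome z ^+ n)).
  apply/funext => N; rewrite /series/= -psumE; elim: N => [|N IH].
    rewrite big_nil (@psum_fin _ _ _ 0) ?big_ord0// => n _.
    by rewrite /s big_ord0.
  rewrite big_nat_recr//= IH.
  have -> : s N.+1 = (fun n => s N n + spread N.+1 n).
    by apply/funext => n; rewrite /s big_ord_recr.
  rewrite psumD//; last exact: subexp_spread.
  congr (_ + _); rewrite psum_spread// psum_nat ?nmX ?exprn_ilt1 ?nm_ge0//.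
  by rewrite /phi2 nomeMn.
rewrite psumE; have [B sB hB] := subexp_dom1 subexp_sigma q1.
apply: (@tannery R nat \oo _ _ _ B) => //.
  exists 0%N => // N _ n; apply: le_trans (hB n).
  by rewrite !nmM ler_wpM2r ?nm_ge0.
move=> n; apply: cvg_near_cst; exists n => // N /= nN.
by rewrite /s sigma_spread.
Qed.

End EisensteinTwo.

(** * The transformation law of [E_2] *)

Section EisensteinTwoLaw.
Variable R : realType.
Local Notation C := (R[i]^o).
Local Notation HH := (@upper_half_plane R).
Local Notation pi := (@pi R).
Local Notation tpi := (@tpi R).
Implicit Types (q u v w z : C).

Lemma cvgc0_le (f : nat -> C) (K : R) : 0 <= K ->
  (forall N, nm (f N) <= K / N.+1%:R) -> f @ \oo --> (0 : C).
Proof.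
move=> K0 hf; apply/cvg_nmP => e e0.
have Ke : 0 <= K / e by rewrite divr_ge0// ltW.
exists (Num.bound (K / e)) => // N /= bN; rewrite subr0.
apply: le_trans (hf N) _; rewrite ler_pdivrMr ?ltr0n// mulrC -ler_pdivrMr//.
by apply: le_trans (ltW (archi_boundP Ke)) _; rewrite ler_nat; lia.
Qed.

Lemma cvg_expn0 q : nm q < 1 -> (fun N => q ^+ N) @ \oo --> (0 : C).
Proof.
move=> q1; apply/cvg_nmP => e e0.
have q1' : `|nm q| < 1 by rewrite ger0_norm ?nm_ge0.
have [n _ hn] := (cvgrPdist_le _ _).1 (cvg_geometric 1 q1') e e0.
exists n => // N /= nN; have := hn N nN.
by rewrite /geometric /= mul1r sub0r normrN ger0_norm ?exprn_ge0 ?nm_ge0// subr0 nmX.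
Qed.

(** The imaginary part controls [a], and then the real part controls [x]. *)
Lemma lattice_ge z : HH z -> exists2 c : R, 0 < c &
  forall a x : R, 0 <= a -> c * (a + `|x|) <= nm (a%:C * z + x%:C).
Proof.
move=> zH; have y0 : 0 < complex.Im z by [].
set y := complex.Im z in y0; have z0 := nm_ge0 z.
pose D := 1 + (1 + nm z) / y.
have D0 : 0 < D.
  by rewrite /D ltr_wpDr//; apply: divr_ge0; [exact: addr_ge0|exact: ltW].
exists D^-1 => [|a x a0]; first by rewrite invr_gt0.
set N := nm _; have N0 : 0 <= N := nm_ge0 _.
rewrite mulrC ler_pdivrMr//.
have h1 : a * y <= N.
  have := le_Im_nm (a%:C * z + x%:C); rewrite ImcD ImcM /= mul0r !addr0 -/y.
  by rewrite ger0_norm// mulr_ge0// ltW.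
have h2 : `|x| <= N + a * nm z.
  have := le_nm_dist (a%:C * z + x%:C) (a%:C * z); rewrite -/N.
  have := le_nmB (a%:C * z + x%:C) (a%:C * z).
  by rewrite addrAC subrr add0r nmM !nm_real (ger0_norm a0) -/N; lra.
have h3 : a <= N / y by rewrite ler_pdivlMr.
have h4 : a * nm z <= N / y * nm z by rewrite ler_wpM2r.
have -> : N * D = N + (N / y + N / y * nm z) by rewrite /D mulrDr mulr1; congr (_ + _); ring.
lra.
Qed.

Lemma away_scale (a : R) z : HH z -> 0 < a -> away (a%:C * z).
Proof.
move=> zH a0; have [c c0 hc] := lattice_ge zH.
have aH : HH (a%:C * z).
  by rewrite /upper_half_plane /= ImcM /= mul0r addr0 mulr_gt0.
have key (s : R) j : `|s| = j.+1%:R -> c * j.+1%:R <= nm (a%:C * z + s%:C).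
  move=> sj; apply: le_trans (hc a s (ltW a0)); rewrite sj ler_wpM2l//; [exact: ltW|lra].
split; first exact: ltW aH.
- exact: HH_neq0.
- by apply: contraTneq (nome_lt1 aH) => ->; rewrite nm1 ltxx.
exists c => // j; rewrite -(rmorph_nat (real_complex R)); split.
  by apply: key; rewrite ger0_norm.
by rewrite -rmorphN; apply: key; rewrite normrN ger0_norm.
Qed.

(** Consecutive values of [hstep (m z)] at the half-integers differ by the
    telescoping terms that are subtracted from the double series. *)
Definition hstep u x : C := (u - x)^-1 - (u + x)^-1.

Lemma sigma_law_algebra (t z G B : C) : t != 0 -> z != 0 ->
  (t ^+ 2 * G - z ^- 2 * (- t ^+ 2 / 24) + B) -
    (- (- t ^+ 2 / 24) + B - z^-1 * (- t * (1 - 2^-1))) =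
  t ^+ 2 * (G + 24^-1 * (z ^- 2 - 1) - (2 * t * z)^-1).
Proof. by move=> t0 z0; field; rewrite t0 z0. Qed.

(** The quasi-modular law of [E_2]: the double series of [(m z + n) ^ (-2)]
    is only conditionally convergent, so its row and column sums differ. Their
    difference is computed by subtracting the telescoping terms
    [1 / (v - 1/2) - 1 / (v + 1/2)], [v = m z + n], after which the double series
    is absolutely convergent. *)
Lemma sigma_law z : HH z ->
  z ^- 2 * psum (@sigmaC R) (nome (- z^-1)) =
  psum (@sigmaC R) (nome z) + 24^-1 * (z ^- 2 - 1) - (2 * tpi * z)^-1.
Proof.
move=> zH; set w := - z^-1; have wH : HH w := HH_inv zH.
have z0 : z != 0 := HH_neq0 zH.
have [c c0 hc] := lattice_ge zH.
pose u m : C := m.+1%:R * z.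
pose k : R := 2 / c.
have k0 : 0 <= k by rewrite divr_ge0// ltW.
have uE m : u m = (m.+1%:R : R)%:C * z by rewrite rmorph_nat.
have n1 n : 0 < n.+1%:R :> R by rewrite ltr0n.
have invle (v : C) (s : R) j : s%:C = v -> forall m, j.+1%:R <= 2 * (m.+1%:R + `|s|) ->
   nm (u m + v)^-1 <= k / j.+1%:R /\ u m + v != 0.
  move=> <- m hj; have h := hc m.+1%:R s (ltW (n1 m)); rewrite -uE in h.
  have p : 0 < c * (m.+1%:R + `|s|) by rewrite mulr_gt0// ltr_wpDr.
  have q0 : 0 < nm (u m + s%:C) by apply: lt_le_trans h.
  split; last by rewrite -nm_gt0.
  rewrite nmV ler_pdivlMr// mulrC ler_pdivrMr//; rewrite /k.
  have : 2 / c * (c * (m.+1%:R + `|s|)) <= 2 / c * nm (u m + s%:C).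
    by rewrite ler_wpM2l.
  rewrite mulrA divfK ?gt_eqF// => h2; exact: le_trans hj h2.
have H1 m (v : C) (s : R) : s%:C = v -> nm (u m + v)^-1 <= k / m.+1%:R /\ u m + v != 0.
  move=> sv; apply: (invle v s) => //.
  by have := normr_ge0 s; have := n1 m; lra.
have H2 m n (v : C) (s : R) : s%:C = v -> n.+1%:R - 2^-1 <= `|s| -> nm (u m + v)^-1 <= k / n.+1%:R.
  move=> sv hs; apply: (invle v s _ sv m _).1.
  have : 1 <= m.+1%:R :> R by rewrite ler1n.
  by have := n1 n; lra.
pose A n : C := n%:R + 2^-1.
have AE n : ((n%:R + 2^-1 : R)%:C : C) = A n by rewrite rmorphD rmorph_nat fmorphV rmorph_nat.
have AEN n : ((- (n%:R + 2^-1) : R)%:C : C) = - A n by rewrite -AE; exact: rmorphN.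
have nE n : ((n%:R : R)%:C : C) = n%:R by rewrite rmorph_nat.
have nEN n : ((- n%:R : R)%:C : C) = - n%:R by rewrite -nE; exact: rmorphN.
have absn n : `|n%:R| = n%:R :> R by rewrite ger0_norm.
have absA n : `|n%:R + 2^-1| = n%:R + 2^-1 :> R by rewrite ger0_norm// addr_ge0// invr_ge0.
pose b m n : C := (u m + n.+1%:R) ^- 2 + (u m - n.+1%:R) ^- 2.
pose D m n : C := b m n - (hstep (u m) (A n.+1) - hstep (u m) (A n)).
have core (v v1 v2 : C) : v != 0 -> v1 != 0 -> v2 != 0 -> v1 = v - 2^-1 -> v2 = v + 2^-1 ->
   v ^- 2 - (v1^-1 - v2^-1) = - 4^-1 * (v^-1 * v^-1 * (v1^-1 * v2^-1)).
  move=> h h1 h2 e1 e2; have -> : v1^-1 - v2^-1 = v1^-1 * v2^-1.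
    have e : v2 - v1 = 1 by rewrite e1 e2; field.
    by rewrite -[RHS]mul1r -e; field; rewrite h1 h2.
  have -> : v ^- 2 - v1^-1 * v2^-1 = v ^- 2 * (v1^-1 * v2^-1) * (v1 * v2 - v ^+ 2).
    by field; rewrite h h1 h2.
  have -> : v1 * v2 - v ^+ 2 = - 4^-1 by rewrite e1 e2; field.
  by rewrite expr2 invfM; ring.
have Dle m n : nm (D m n) <= k ^+ 4 / m.+1%:R ^+ 2 / n.+1%:R ^+ 2.
  have bnd (v v1 v2 : C) : v != 0 -> v1 != 0 -> v2 != 0 -> v1 = v - 2^-1 -> v2 = v + 2^-1 ->
      nm v^-1 <= k / m.+1%:R -> nm v^-1 <= k / n.+1%:R ->
      nm v1^-1 <= k / n.+1%:R -> nm v2^-1 <= k / m.+1%:R ->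
      nm (v ^- 2 - (v1^-1 - v2^-1)) <= 4^-1 * (k ^+ 4 / m.+1%:R ^+ 2 / n.+1%:R ^+ 2).
    move=> h h1 h2 e1 e2 a1 a2 a3 a4; rewrite (core v v1 v2)//.
    rewrite nmM nmN nmV nm_nat ler_wpM2l ?invr_ge0// !nmM.
    have -> : k ^+ 4 / m.+1%:R ^+ 2 / n.+1%:R ^+ 2 =
      (k / m.+1%:R * (k / n.+1%:R)) * (k / n.+1%:R * (k / m.+1%:R)).
      by move: (n1 m) (n1 n); move: (m.+1%:R) (n.+1%:R) => x y x0 y0; field; rewrite !gt_eqF.
    exact: (ler_pM (mulr_ge0 (nm_ge0 _) (nm_ge0 _)) (mulr_ge0 (nm_ge0 _) (nm_ge0 _))
      (ler_pM (nm_ge0 _) (nm_ge0 _) a1 a2) (ler_pM (nm_ge0 _) (nm_ge0 _) a3 a4)).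
  have -> : D m n = ((u m + n.+1%:R) ^- 2 - ((u m + A n)^-1 - (u m + A n.+1)^-1)) +
      ((u m - n.+1%:R) ^- 2 - ((u m - A n.+1)^-1 - (u m - A n)^-1)).
    by rewrite /D /b /hstep; ring.
  have Ad : A n = n.+1%:R - 2^-1 by rewrite /A -natr1; field.
  have Au : A n.+1 = n.+1%:R + 2^-1 by [].
  have sn : n.+1%:R = n%:R + 1 :> R by rewrite -natr1.
  have P1 := H1 m _ _ (nE n.+1); have P2 := H1 m _ _ (nEN n.+1).
  have P3 := H1 m _ _ (AE n); have P4 := H1 m _ _ (AEN n).
  have P5 := H1 m _ _ (AE n.+1); have P6 := H1 m _ _ (AEN n.+1).
  have Q1 := H2 m n _ _ (nE n.+1); have Q2 := H2 m n _ _ (nEN n.+1).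
  have Q3 := H2 m n _ _ (AE n); have Q6 := H2 m n _ _ (AEN n.+1).
  rewrite absn in Q1; rewrite normrN absn in Q2; rewrite absA in Q3.
  rewrite normrN absA in Q6.
  apply: le_trans (le_nmD _ _) _.
  have B1 := bnd _ _ _ P1.2 P3.2 P5.2 ltac:(by rewrite Ad addrA) ltac:(by rewrite Au addrA)
     P1.1 (Q1 ltac:(lra)) (Q3 ltac:(lra)) P5.1.
  have B2 := bnd _ _ _ P2.2 P6.2 P4.2 ltac:(by rewrite Au opprD addrA)
     ltac:(by rewrite Ad opprB addrA addrAC) P2.1 (Q2 ltac:(lra)) (Q6 ltac:(lra)) P4.1.
  apply: le_trans (lerD B1 B2) _.
  have : 0 <= k ^+ 4 / m.+1%:R ^+ 2 / n.+1%:R ^+ 2.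
    by rewrite !divr_ge0 ?exprn_ge0.
  by move: (_ / _) => X; lra.
have kk n : 0 <= k / n.+1%:R by rewrite divr_ge0.
have k40 : 0 <= k ^+ 4 by rewrite exprn_ge0.
have A0 n : A n != 0.
  by rewrite -AE -nm_gt0 nm_real absA ltr_wpDl// invr_gt0.
(* Row sums: the telescoping terms add up to the initial one, and Lipschitz's
   formula at m z gives the rest. *)
have telescope m N : \sum_(n < N) (hstep (u m) (A n.+1) - hstep (u m) (A n)) =
    hstep (u m) (A N) - hstep (u m) (A 0%N).
  by rewrite -(big_mkord xpredT (fun n => hstep (u m) (A n.+1) - hstep (u m) (A n)))
    telescope_sumr.
have au m : away (u m) by rewrite uE; exact: away_scale.
have hlim m : (fun N => hstep (u m) (A N)) @ \oo --> (0 : C).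
  apply: (@cvgc0_le _ (k + k)) => [|N]; first exact: addr_ge0.
  have sn : N.+1%:R = N%:R + 1 :> R by rewrite -natr1.
  have Q3 := H2 m N _ _ (AE N); have Q6 := H2 m N _ _ (AEN N).
  rewrite absA in Q3; rewrite normrN absA in Q6.
  apply: le_trans (le_nmB _ _) _; rewrite mulrDl.
  by apply: lerD; [apply: Q6; lra|apply: Q3; lra].
have row m : tsum (D m) = tpi ^+ 2 * phi2 (u m) - u m ^- 2 + hstep (u m) (A 0%N).
  apply: tsumE; have [K K0 hK] := dom_inv_sq (au m).
  have l1 := tsum_cvg (summ_inv_sq K0) hK.
  have -> : tpi ^+ 2 * phi2 (u m) - u m ^- 2 + hstep (u m) (A 0%N) =
      tsum (b m) - (0 - hstep (u m) (A 0%N)).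
    by rewrite -(lipschitz2 (au m)); ring.
  have -> : series (D m) = (fun N => series (b m) N -
     (hstep (u m) (A N) - hstep (u m) (A 0%N))).
    by apply/funext => N; rewrite -telescope /series/= -(big_mkord xpredT
      (fun n => hstep (u m) (A n.+1) - hstep (u m) (A n))) -sumrB.
  exact: (cvgcB l1 (cvgcB (hlim m) (cvgc_cst _))).
(* Column sums: since m z + n = z (m - n w), Lipschitz's formula applies at
   n w, and the cotangent expansion at the half-integral multiples of w. *)
have sK := @summ_inv_sq R 1 ler01.
pose S2 : R := limn (series (fun n => 1 / n.+1%:R ^+ 2 : R)).
have S20 : 0 <= S2 by apply: le_trans (series_le_lim 0 sK); rewrite /series/= big_nil.
have colsum N : tsum (fun m => \sum_(n < N) D m n) =
    \sum_(n < N) (z ^- 2 * (tpi ^+ 2 * phi2 (n.+1%:R * w)) - n.+1%:R ^- 2)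
    + tsum (fun m => hstep (u m) (A 0%N))
    - z^-1 * (- tpi * ((1 - nome (A N * w))^-1 - 2^-1) - (A N * w)^-1).
  have k20 : 0 <= k ^+ 2 by rewrite exprn_ge0.
  have sb := summ_inv_sq (addr_ge0 k20 k20).
  have bdom n : dom (fun m => b m n) (fun m => (k ^+ 2 + k ^+ 2) / m.+1%:R ^+ 2).
    move=> m; rewrite mulrDl; apply: le_trans (le_nmD _ _) _.
    have sq (v : C) : nm v^-1 <= k / m.+1%:R -> nm (v ^- 2) <= k ^+ 2 / m.+1%:R ^+ 2.
      move=> h; have -> : v ^- 2 = v^-1 ^+ 2 by rewrite exprVn.
      rewrite nmX; have -> : k ^+ 2 / m.+1%:R ^+ 2 = (k / m.+1%:R) ^+ 2.
        by rewrite [RHS]exprMn exprVn.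
      by rewrite lerXn2r ?nnegrE ?nm_ge0.
    by apply: lerD; apply: sq; [exact: (H1 m _ _ (nE n.+1)).1|exact: (H1 m _ _ (nEN n.+1)).1].
  have bsum n : tsum (fun m => b m n) =
      z ^- 2 * (tpi ^+ 2 * phi2 (n.+1%:R * w)) - n.+1%:R ^- 2.
    have aw : away (n.+1%:R * w) by rewrite -(nE n.+1); exact: away_scale.
    have e : (fun m => b m n) = (fun m => z ^- 2 *
        ((n.+1%:R * w + m.+1%:R) ^- 2 + (n.+1%:R * w - m.+1%:R) ^- 2)).
      apply/funext => m; rewrite /b /u mulrDr addrC.
      have i1 : m.+1%:R * z - n.+1%:R = z * (n.+1%:R * w + m.+1%:R).
        by rewrite /w mulrDr !mulrN mulrCA divff// mulr1 [RHS]addrC [z * _]mulrC.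
      have i2 : m.+1%:R * z + n.+1%:R = - (z * (n.+1%:R * w - m.+1%:R)).
        by rewrite /w mulrBr !mulrN mulrCA divff// mulr1 opprB opprK [z * _]mulrC.
      by rewrite i1 i2 sqrrN !exprMn !invfM.
    have [K K0 hK] := dom_inv_sq aw.
    rewrite e (tsumZ _ (summ_inv_sq K0) hK).
    have := lipschitz2 aw; rewrite -/(phi2 _) => <-.
    have wz : z ^- 2 * (n.+1%:R * w) ^- 2 = n.+1%:R ^- 2.
      by rewrite -invfM -exprMn /w mulrCA mulrN divff// mulrN1 sqrrN.
    by rewrite -wz; ring.
  have hdom x (s : R) : s%:C = x -> dom (fun m => hstep (u m) x)
      (fun m => (nm (2 * x) * k ^+ 2) / m.+1%:R ^+ 2).
    move=> sx m; have [a1 b1] := H1 m _ _ sx.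
    have sx' : ((- s)%:C : C) = - x by rewrite -sx; exact: rmorphN.
    have [a2 b2] := H1 m _ _ sx'.
    have -> : hstep (u m) x = 2 * x * ((u m - x)^-1 * (u m + x)^-1).
      by rewrite /hstep; field; rewrite b1 b2.
    rewrite nmM -mulrA ler_wpM2l ?nm_ge0// nmM.
    have -> : k ^+ 2 / m.+1%:R ^+ 2 = k / m.+1%:R * (k / m.+1%:R).
      by rewrite -expr2 [RHS]exprMn exprVn.
    exact: (ler_pM (nm_ge0 _) (nm_ge0 _) a2 a1).
  have hsum x (s : R) : 0 < s -> s%:C = x -> tsum (fun m => hstep (u m) x) =
      z^-1 * (- tpi * ((1 - nome (x * w))^-1 - 2^-1) - (x * w)^-1).
    move=> s0 sx; have ax : away (x * w) by rewrite -sx; exact: away_scale.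
    have e m : hstep (u m) x = z^-1 *
        (2 * (x * w) / ((x * w + m.+1%:R) * (x * w - m.+1%:R))).
      have [a1 b1] := H1 m _ _ sx.
      have sx' : ((- s)%:C : C) = - x by rewrite -sx; exact: rmorphN.
      have [a2 b2] := H1 m _ _ sx'.
      have [c1 c2] := away_neq0 m ax.
      have i1 : u m - x = z * (x * w + m.+1%:R).
        by rewrite /w /u mulrDr !mulrN mulrCA divff// mulr1 [RHS]addrC [z * _]mulrC.
      have i2 : u m + x = - (z * (x * w - m.+1%:R)).
        by rewrite /w /u mulrBr !mulrN mulrCA divff// mulr1 opprB opprK [z * _]mulrC.
      rewrite /hstep i1 i2.
      have -> : 2 * (x * w) = (x * w + m.+1%:R) + (x * w - m.+1%:R) by ring.
      move: c1 c2; move: (x * w + _) (x * w - _) => X Y c1 c2.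
      by field; rewrite z0 c1 c2.
    have h0 : 0 <= nm (2 * x) * k ^+ 2 by rewrite mulr_ge0 ?nm_ge0 ?exprn_ge0.
    apply: (mulfI z0); rewrite (mulVKf z0) -(cot_sum ax).
    rewrite addrAC subrr add0r -(tsumZ z (summ_inv_sq h0) (hdom x s sx)).
    by congr tsum; apply/funext => m; rewrite e (mulVKf z0).
  rewrite -(hsum (A N) (N%:R + 2^-1))//; last by rewrite ltr_wpDl// invr_gt0.
  have -> : \sum_(n < N) (z ^- 2 * (tpi ^+ 2 * phi2 (n.+1%:R * w)) - n.+1%:R ^- 2) =
      tsum (fun m => \sum_(n < N) b m n).
    rewrite -(tsum_sum (f := fun (n : 'I_N) m => b m n) sb) => [|n]; last exact: bdom.
    by apply: eq_bigr => n _; rewrite bsum.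
  have hn x : 0 <= nm (2 * x) * k ^+ 2 by rewrite mulr_ge0 ?nm_ge0 ?exprn_ge0.
  have d1 : dom (fun m => \sum_(n < N) b m n)
      (fun m => (N%:R * (k ^+ 2 + k ^+ 2)) / m.+1%:R ^+ 2).
    move=> m; apply: le_trans (le_nm_sum _ _ _) _.
    have -> : N%:R * (k ^+ 2 + k ^+ 2) / m.+1%:R ^+ 2 =
        \sum_(n < N) ((k ^+ 2 + k ^+ 2) / m.+1%:R ^+ 2).
      by rewrite sumr_const card_ord -mulrA -[RHS]mulr_natl.
    by apply: ler_sum => n _; exact: bdom.
  have s1 : summ (fun m => (N%:R * (k ^+ 2 + k ^+ 2)) / m.+1%:R ^+ 2 : R).
    by apply: summ_inv_sq; rewrite mulr_ge0// addr_ge0.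
  have d2 := hdom (A 0%N) _ (AE 0%N); have s2 := summ_inv_sq (hn (A 0%N)).
  have d3 := hdom (A N) _ (AE N); have s3 := summ_inv_sq (hn (A N)).
  have d3' : dom (fun m => -1 * hstep (u m) (A N))
      (fun m => nm (2 * A N) * k ^+ 2 / m.+1%:R ^+ 2).
    by move=> m; rewrite mulN1r nmN; exact: d3.
  have d12 : dom (fun m => \sum_(n < N) b m n + hstep (u m) (A 0%N))
      (fun m => (N%:R * (k ^+ 2 + k ^+ 2) + nm (2 * A 0%N) * k ^+ 2) / m.+1%:R ^+ 2).
    move=> m; rewrite mulrDl; apply: le_trans (le_nmD _ _) _.
    by apply: lerD; [exact: d1|exact: d2].
  have s12 : summ (fun m => (N%:R * (k ^+ 2 + k ^+ 2) + nm (2 * A 0%N) * k ^+ 2)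
      / m.+1%:R ^+ 2).
    by apply: summ_inv_sq; rewrite addr_ge0// mulr_ge0// addr_ge0.
  rewrite -(tsumD s1 d1 s2 d2) -mulN1r -(tsumZ _ s3 d3) -(tsumD s12 d12 s3 d3').
  congr tsum; apply/funext => m; rewrite /D sumrB telescope; ring.
have colsum_lim : (fun N => tsum (fun m => \sum_(n < N) D m n)) @ \oo -->
    tsum (fun m => tsum (D m)).
  have Kdom m : dom (D m) (fun n => k ^+ 4 / m.+1%:R ^+ 2 / n.+1%:R ^+ 2).
    by move=> n; exact: Dle.
  have kp m : 0 <= k ^+ 4 / m.+1%:R ^+ 2 by rewrite divr_ge0 ?exprn_ge0.
  apply: (@tannery R nat \oo _ _ _ (fun m => (k ^+ 4 * S2) / m.+1%:R ^+ 2)).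
  - by apply: summ_inv_sq; rewrite mulr_ge0.
  - exists 0%N => // N _ m; apply: le_trans (le_nm_sum _ _ _) _.
    rewrite mulrAC.
    apply: (@le_trans _ _ (\sum_(n < N) k ^+ 4 / m.+1%:R ^+ 2 * (1 / n.+1%:R ^+ 2))).
      by apply: ler_sum => n _; rewrite mul1r; exact: Dle.
    rewrite -big_distrr/= ler_wpM2l//.
    by have := series_le_lim N sK; rewrite /series/= big_mkord.
  move=> m; have := tsum_cvg (summ_inv_sq (kp m)) (Kdom m).
  have -> : series (D m) = (fun N => \sum_(n < N) D m n).
    by apply/funext => N; rewrite /series/= big_mkord.
  by [].
have rowlim : series (fun m => tsum (D m)) @ \oo --> tsum (fun m => tsum (D m)).
  apply: (@tsum_cvg _ _ (fun m => (k ^+ 4 * S2) / m.+1%:R ^+ 2)).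
    by apply: summ_inv_sq; rewrite mulr_ge0.
  move=> m; have Kdom : dom (D m) (fun n => k ^+ 4 / m.+1%:R ^+ 2 / n.+1%:R ^+ 2).
    by move=> n; exact: Dle.
  have kp : 0 <= k ^+ 4 / m.+1%:R ^+ 2 by rewrite divr_ge0 ?exprn_ge0.
  apply: nm_cvg_le (tsum_cvg (summ_inv_sq kp) Kdom) _.
  exists 0%N => // N _; apply: le_trans (le_nm_sum _ _ _) _.
  rewrite mulrAC big_mkord.
  apply: (@le_trans _ _ (\sum_(n < N) k ^+ 4 / m.+1%:R ^+ 2 * (1 / n.+1%:R ^+ 2))).
    by apply: ler_sum => n _; rewrite mul1r; exact: Dle.
  rewrite -big_distrr/= ler_wpM2l//.
  by have := series_le_lim N sK; rewrite /series/= big_mkord.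
have dz : dom (fun j => j.+1%:R ^- 2 : C) (fun j => 1 / j.+1%:R ^+ 2).
  by move=> j; exact: (@dom_nat_sq R succn ltnSn j).
have zlim := tsum_cvg sK dz.
have h0 : 0 <= nm (2 * A 0%N) * k ^+ 2 by rewrite mulr_ge0 ?nm_ge0 ?exprn_ge0.
set Ac := tsum (fun m => hstep (u m) (A 0%N)) in colsum.
have hd0 : dom (fun m => hstep (u m) (A 0%N))
    (fun m => nm (2 * A 0%N) * k ^+ 2 / m.+1%:R ^+ 2).
  move=> m; have [a1 b1] := H1 m _ _ (AE 0%N); have [a2 b2] := H1 m _ _ (AEN 0%N).
  have -> : hstep (u m) (A 0%N) = 2 * A 0%N * ((u m - A 0%N)^-1 * (u m + A 0%N)^-1).
    by rewrite /hstep; field; rewrite b1 b2.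
  rewrite nmM -mulrA ler_wpM2l ?nm_ge0// nmM.
  have -> : k ^+ 2 / m.+1%:R ^+ 2 = k / m.+1%:R * (k / m.+1%:R).
    by rewrite -expr2 [RHS]exprMn exprVn.
  exact: (ler_pM (nm_ge0 _) (nm_ge0 _) a2 a1).
have hlim0 := tsum_cvg (summ_inv_sq h0) hd0.
have lim_rows : series (fun m => tsum (D m)) @ \oo -->
    (tpi ^+ 2 * psum (@sigmaC R) (nome z) - z ^- 2 * zeta2 R + Ac : C).
  have -> : series (fun m => tsum (D m)) = (fun M => tpi ^+ 2 *
      series (fun m => phi2 (m.+1%:R * z)) M -
      z ^- 2 * series (fun j => j.+1%:R ^- 2 : C) M +
      series (fun m => hstep (u m) (A 0%N)) M).
    apply/funext => M; rewrite /series/= !big_distrr/= -sumrB -big_split/=.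
    apply: eq_bigr => m _; rewrite row; congr (_ - _ + _).
    by rewrite /u exprMn invfM mulrC.
  exact: (cvgcD (cvgcB (cvgcM (cvgc_cst _) (lambert zH))
    (cvgcM (cvgc_cst _) zlim)) hlim0).
have nome_lim : (fun N => nome (A N * w)) @ \oo --> (0 : C).
  have -> : (fun N => nome (A N * w)) = (fun N => nome (2^-1 * w) * nome w ^+ N).
    by apply/funext => N; rewrite /A mulrDl nomeD nomeMn mulrC.
  have := cvgcM (cvgc_cst (nome (2^-1 * w))) (cvg_expn0 (nome_lt1 wH)).
  by rewrite mulr0; apply.
have Ainv_lim : (fun N => (A N * w)^-1) @ \oo --> (0 : C).
  apply: (@cvgc0_le _ (2 * nm w^-1)) => [|N]; first by rewrite mulr_ge0 ?nm_ge0.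
  rewrite invfM nmM mulrC -mulrA [leRHS]mulrCA ler_wpM2l ?nm_ge0//.
  have ap : 0 < N%:R + 2^-1 :> R by rewrite ltr_wpDl// invr_gt0.
  rewrite nmV -AE nm_real absA ler_pdivlMr// mulrC ler_pdivrMr//.
  by have : N.+1%:R = N%:R + 1 :> R; [rewrite -natr1|move=> ->; have := ler0n R N; lra].
have lim_cols : (fun N => tsum (fun m => \sum_(n < N) D m n)) @ \oo -->
    (z ^- 2 * (tpi ^+ 2 * psum (@sigmaC R) (nome w)) - zeta2 R + Ac -
     z^-1 * (- tpi * ((1 - 0)^-1 - 2^-1) - 0) : C).
  have -> : (fun N => tsum (fun m => \sum_(n < N) D m n)) =
     (fun N => z ^- 2 * (tpi ^+ 2 * series (fun n => phi2 (n.+1%:R * w)) N) -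
       series (fun j => j.+1%:R ^- 2 : C) N + Ac -
       z^-1 * (- tpi * ((1 - nome (A N * w))^-1 - 2^-1) - (A N * w)^-1)).
    apply/funext => N; rewrite colsum; congr (_ + _ - _).
    by rewrite /series/= !big_mkord !big_distrr/= -sumrB.
  have one0 : 1 - 0 != 0 :> C by rewrite subr0 oner_eq0.
  have l1 : (fun N => (1 - nome (A N * w))^-1) @ \oo --> ((1 - 0)^-1 : C).
    exact: (cvgcV one0 (cvgcB (cvgc_cst (1 : C)) nome_lim)).
  have l2 : (fun N => z^-1 * (- tpi * ((1 - nome (A N * w))^-1 - 2^-1) - (A N * w)^-1))
      @ \oo --> (z^-1 * (- tpi * ((1 - 0)^-1 - 2^-1) - 0) : C).
    exact: (cvgcM (cvgc_cst (z^-1)) (cvgcB (cvgcM (cvgc_cst (- tpi))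
      (cvgcB l1 (cvgc_cst (2^-1 : C)))) Ainv_lim)).
  have l3 := cvgcM (cvgc_cst (z ^- 2)) (cvgcM (cvgc_cst (tpi ^+ 2)) (lambert wH)).
  exact: (cvgcB (cvgcD (cvgcB (l3 _ _ _ _) zlim) (cvgc_cst Ac)) l2).
have E1 := cvgc_unique rowlim lim_rows.
have E2 := cvgc_unique colsum_lim lim_cols.
have Z24 : zeta2 R = - tpi ^+ 2 / 24.
  by rewrite -zeta2E mulrC mulKf// pnatr_eq0.
have t0 := tpi_neq0 R.
have t2 : tpi ^+ 2 != 0 by rewrite expf_neq0.
move: E2; rewrite E1 Z24 !subr0 invr1.
move: (psum _ (nome w)) (psum _ (nome z)) => Gw G E.
apply: (mulfI t2).
have -> : tpi ^+ 2 * (z ^- 2 * Gw) = (tpi ^+ 2 * G - z ^- 2 * (- tpi ^+ 2 / 24) + Ac)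
   - (- (- tpi ^+ 2 / 24) + Ac - z^-1 * (- tpi * (1 - 2^-1))).
  by rewrite E; ring.
exact: sigma_law_algebra.
Qed.

End EisensteinTwoLaw.

(** * The discriminant as a power series *)

Section ModularSeries.
Variable R : realType.
Local Notation C := (R[i]^o).
Local Notation HH := (@upper_half_plane R).
Local Notation tpi := (@tpi R).
Implicit Types (a b s : nat -> C) (q u v w z : C).

Lemma cder_qexp b z : subexp b -> HH z ->
  cder (fun w => psum b (nome w)) z (tpi * psum (theta b) (nome z)).
Proof.
move=> hb zH; have q1 := nome_lt1 zH.
have := cder_comp (cder_nome z) (cder_psum hb q1).
have -> : psum (fun n => n.+1%:R * b n.+1) (nome z) * (tpi * nome z) =
    tpi * psum (theta b) (nome z).
  by rewrite (psum_recl (subexp_theta hb) q1) /theta mul0r add0r; ring.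
by [].
Qed.

(** Differentiating a transformation law under [z -> - 1 / z]. *)
Lemma theta_law b (F : C -> C) z (l : C) : subexp b -> HH z ->
  (forall w, HH w -> psum b (nome (- w^-1)) = F w) -> cder F z l ->
  tpi * psum (theta b) (nome (- z^-1)) = z ^+ 2 * l.
Proof.
move=> hb zH hF Fl; have z0 := HH_neq0 zH.
have h := cder_comp (cder_negV z0) (cder_qexp hb (HH_inv zH)).
have h2 : cder F z (tpi * psum (theta b) (nome (- z^-1)) * z ^- 2).
  by apply: cder_near h; apply: filterS (near_HH zH) => w wH /=; exact: hF.
have n2 : z ^+ 2 != 0 by rewrite expf_neq0.
by rewrite (cder_unique Fl h2) [RHS]mulrC divfK.
Qed.

Definition unit_seq : nat -> C := fun n => if n is 0 then 1 else 0.

Lemma subexp_unit : subexp unit_seq.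
Proof.
by apply: subexp_le (subexp_const 1) _ => -[|n]; rewrite ?nm0 ?nm_ge0.
Qed.

Lemma psum_unit q : psum unit_seq q = 1.
Proof.
by rewrite (@psum_fin _ _ _ 1) ?big_ord1 ?mulr1// => -[].
Qed.

Definition e2 : nat -> C := fun n => unit_seq n + (-24) * sigmaC R n.

Lemma subexp_e2 : subexp e2.
Proof. by apply: subexpD; [exact: subexp_unit|apply: subexpZ; exact: subexp_sigma]. Qed.

Lemma psum_e2 q : nm q < 1 -> psum e2 q = 1 - 24 * psum (sigmaC R) q.
Proof.
move=> q1; rewrite /e2 psumD ?psumZ// ?psum_unit ?mulNr//.
- exact: subexp_sigma.
- exact: subexp_unit.
- by apply: subexpZ; exact: subexp_sigma.
Qed.

Lemma e2_law z : HH z -> psum e2 (nome (- z^-1)) =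
  z ^+ 2 * psum e2 (nome z) + 12 * z / tpi.
Proof.
move=> zH; have z0 := HH_neq0 zH; have t0 := tpi_neq0 R.
rewrite !psum_e2 ?nome_lt1//; last exact: HH_inv.
have n2 : z ^+ 2 != 0 by rewrite expf_neq0.
have := sigma_law zH; move: (psum _ (nome (- z^-1))) (psum _ (nome z)) => Gw G E.
have -> : Gw = z ^+ 2 * (z ^- 2 * Gw) by rewrite mulrA divff// mul1r.
rewrite E; move: t0; move: tpi => t t0; field.
by rewrite z0 t0.
Qed.

(** The list of the first coefficients of the solution [f] of [q f' = s f],
    [f(0) = 1], by recursion on the coefficients already found. *)
Fixpoint exps_prefix s (n : nat) : seq C :=
  if n is n'.+1 then
    let p := exps_prefix s n' in
    rcons p (n%:R^-1 * \sum_(j < n) s (n - j)%N * nth 0 p j)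
  else [:: 1].

Definition exps s (n : nat) : C := nth 0 (exps_prefix s n) n.

Lemma size_exps_prefix s n : size (exps_prefix s n) = n.+1.
Proof. by elim: n => //= n IH; rewrite size_rcons IH. Qed.

Lemma nth_exps_prefix s n j : (j <= n)%N -> nth 0 (exps_prefix s n) j = exps s j.
Proof.
elim: n => [|n IH]; first by rewrite leqn0 => /eqP ->.
rewrite leq_eqVlt => /predU1P[->//|]; rewrite ltnS => jn.
by rewrite /= nth_rcons size_exps_prefix ltnS jn IH.
Qed.

Lemma exps0 s : exps s 0 = 1.
Proof. by []. Qed.

Lemma expsS s n : n.+1%:R * exps s n.+1 = \sum_(j < n.+1) s (n.+1 - j)%N * exps s j.
Proof.
rewrite {1}/exps /= nth_rcons size_exps_prefix ltnn eqxx mulrA divff ?mul1r ?pnatr_eq0//.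
by apply: eq_bigr => j _; rewrite nth_exps_prefix// -ltnS.
Qed.

Lemma subSS_rev n i : (i < n.+1)%N -> (n.+1 - (n.+1 - i.+1))%N = i.+1.
Proof. by lia. Qed.

Lemma theta_exps s : s 0%N = 0 -> theta (exps s) = cmul s (exps s).
Proof.
move=> s0; apply/funext => -[|n]; rewrite /theta /cmul.
  by rewrite mul0r big_ord1 s0 mul0r.
rewrite expsS (reindex_inj rev_ord_inj)/= [RHS]big_ord_recl s0 mul0r add0r.
apply: eq_bigr => i _; have := ltn_ord i => iN.
by congr (s _ * exps s _); rewrite /= ?/bump ?leq0n; lia.
Qed.

(** Put [a n = |exps s n| r ^ n], and let [S] be the sum of a geometric series
    that dominates the [|s n| r ^ n]. Then [(n + 1) a (n + 1)] is at most [S]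
    times the maximum of [a 0, ..., a n], so that [a] stops growing once
    [n >= S]. *)
Lemma subexp_exps s : subexp s -> s 0%N = 0 -> subexp (exps s).
Proof.
move=> hs s0 r r01.
set t := (1 + r) / 2; have t01 : 0 < t < 1 by rewrite /t; lra.
have rt : r < t by rewrite /t; lra.
have r0 : 0 <= r by lra.
have [L hL] := hs t t01.
have L0 : 0 <= L by apply: le_trans (hL 0%N); rewrite mulr1 nm_ge0.
have rt01 := ratio_bounds r0 rt.
have sG := summ_geo L0 rt01.
pose S := limn (series (fun n => L * (r / t) ^+ n)).
have tn0 : t != 0 by rewrite gt_eqF//; case/andP: t01.
have sr j : nm (s j) * r ^+ j <= L * (r / t) ^+ j.
  have -> : r ^+ j = t ^+ j * (r / t) ^+ j by rewrite -exprMn mulrCA divff// mulr1.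
  by rewrite mulrA ler_wpM2r// exprn_ge0//; case/andP: rt01.
have S0 : 0 <= S by apply: le_trans (series_le_lim 0 sG); rewrite /series/= big_nil.
pose a n := nm (exps s n) * r ^+ n.
have a0 n : 0 <= a n by rewrite mulr_ge0 ?nm_ge0// exprn_ge0.
pose n0 := Num.bound S; pose K := \sum_(j < n0.+1) a j.
have K0 : 0 <= K by apply: sumr_ge0.
exists K => n; rewrite -/(a n); have [m mn] := ubnP n; elim: m n mn => // m IH n nm'.
have [nn0|n0n] := leqP n n0.
  have nn0' : (n < n0.+1)%N by [].
  by rewrite /K (bigD1 (Ordinal nn0'))//= lerDl sumr_ge0.
case: n nm' n0n => // n nm' n0n.
have nS : S <= n.+1%:R.
  by apply: le_trans (ltW (archi_boundP S0)) _; rewrite ler_nat ltnW.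
suff h : n.+1%:R * a n.+1 <= S * K.
  have h2 : n.+1%:R * a n.+1 <= n.+1%:R * K by apply: le_trans h _; rewrite ler_wpM2r.
  by move: h2; rewrite ler_pM2l ?ltr0n.
have -> : n.+1%:R * a n.+1 = nm (n.+1%:R * exps s n.+1) * r ^+ n.+1.
  by rewrite nmM nm_nat mulrA.
rewrite expsS; apply: (@le_trans _ _ (\sum_(j < n.+1) (L * (r / t) ^+ (n.+1 - j)) * K)).
  apply: (@le_trans _ _ (\sum_(j < n.+1) nm (s (n.+1 - j)%N * exps s j) * r ^+ n.+1)).
    by rewrite -big_distrl/= ler_wpM2r ?le_nm_sum// exprn_ge0.
  apply: ler_sum => j _; have jn := ltn_ord j.
  have -> : nm (s (n.+1 - j)%N * exps s j) * r ^+ n.+1 =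
      (nm (s (n.+1 - j)%N) * r ^+ (n.+1 - j)) * a j.
    have -> : r ^+ n.+1 = r ^+ (n.+1 - j) * r ^+ j by rewrite -exprD subnK// ltnW.
    by rewrite nmM /a; ring.
  apply: ler_pM => //; first by rewrite mulr_ge0 ?nm_ge0// exprn_ge0.
  by apply: IH; exact: leq_trans jn _.
rewrite -big_distrl/= ler_wpM2r//.
rewrite (reindex_inj rev_ord_inj)/=.
have h := series_le_lim n.+2 sG; apply: le_trans h.
rewrite /series/= big_mkord [leRHS]big_ord_recl/=.
have -> : \sum_(i < n.+1) L * (r / t) ^+ (n.+1 - (n.+1 - i.+1)) =
    \sum_(i < n.+1) L * (r / t) ^+ bump 0 i.
  by apply: eq_bigr => i _; rewrite subSS_rev.
by rewrite lerDr mulr_ge0.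
Qed.

Lemma theta_cmul a b : theta (cmul a b) =
  (fun n => cmul (theta a) b n + cmul a (theta b) n).
Proof.
apply/funext => n; rewrite /theta /cmul big_distrr/= -big_split/=.
apply: eq_bigr => i _; have -> : n%:R = i%:R + (n - i)%:R :> C.
  by rewrite -natrD subnKC// -ltnS.
ring.
Qed.

Lemma cmul0 a b : cmul a b 0 = a 0%N * b 0%N.
Proof. by rewrite /cmul big_ord1. Qed.

Lemma cmul1 a b : cmul a b 1 = a 0%N * b 1%N + a 1%N * b 0%N.
Proof. by rewrite /cmul big_ord_recr big_ord1. Qed.

(** Exponentials do not vanish: [exp (- s)] is an inverse of [exp s]. *)
Lemma psum_exps_inv s q : subexp s -> s 0%N = 0 -> nm q < 1 ->
  psum (exps s) q * psum (exps (fun n => (-1) * s n)) q = 1.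
Proof.
move=> hs s0 q1; set s' := fun n => _.
have hs' : subexp s' by exact: subexpZ.
have s0' : s' 0%N = 0 by rewrite /s' s0 mulr0.
have hU := subexp_exps hs s0; have hV := subexp_exps hs' s0'.
rewrite -psum_cmul//.
suff -> : cmul (exps s) (exps s') = unit_seq by exact: psum_unit.
have h0 : theta (cmul (exps s) (exps s')) = (fun=> 0).
  apply: psum_inj; [by apply: subexp_theta; exact: subexp_cmul|exact: subexp_const|].
  move=> x x01; have x1 : nm (x%:C : C) < 1 by rewrite nm_real gtr0_norm; lra.
  have hU' := subexp_theta hU; have hV' := subexp_theta hV.
  have z0 : psum (fun=> 0) (x%:C : C) = 0 by rewrite (@psum_fin _ _ _ 0) ?big_ord0.
  have sE : psum s' (x%:C : C) = - psum s x%:C by rewrite psumZ// mulN1r.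
  rewrite z0 theta_cmul psumD//; [|exact: subexp_cmul|exact: subexp_cmul].
  by rewrite !psum_cmul// !theta_exps// !psum_cmul// sE; ring.
apply/funext => -[|n]; first by rewrite cmul0 !exps0 mulr1.
have := congr1 (fun f => f n.+1) h0; rewrite /theta /= => /eqP.
by rewrite mulf_eq0 pnatr_eq0 /= => /eqP.
Qed.

(** The series of the infinite product of the [(1 - q ^ n) ^ 24], obtained from
    its logarithmic derivative. *)
Definition eta_seq : nat -> C := exps (fun n => (-24) * sigmaC R n).
Definition eta_inv : nat -> C := exps (fun n => (-1) * ((-24) * sigmaC R n)).
Definition delta : nat -> C := fun n => if n is n'.+1 then eta_seq n' else 0.

Lemma subexp_s24 : subexp (fun n => (-24) * sigmaC R n).
Proof. by apply: subexpZ; exact: subexp_sigma. Qed.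

Lemma s24_0 : (-24) * sigmaC R 0 = 0.
Proof. by rewrite mulr0. Qed.

Lemma subexp_eta : subexp eta_seq.
Proof. exact: subexp_exps subexp_s24 s24_0. Qed.

Lemma subexp_eta_inv : subexp eta_inv.
Proof.
by apply: subexp_exps; [apply: subexpZ; exact: subexp_s24|rewrite s24_0 mulr0].
Qed.

Lemma psum_eta_inv q : nm q < 1 -> psum eta_seq q * psum eta_inv q = 1.
Proof. by move=> q1; exact: psum_exps_inv subexp_s24 s24_0 q1. Qed.

Lemma subexp_delta : subexp delta.
Proof.
move=> r r01; have [K hK] := subexp_eta r01.
have K0 : 0 <= K by apply: le_trans (hK 0%N); rewrite mulr1 nm_ge0.
exists K => -[|n]; first by rewrite nm0 mul0r.
apply: le_trans (hK n); rewrite exprS mulrCA ler_piMl//; last lra.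
by rewrite mulr_ge0 ?nm_ge0// exprn_ge0//; lra.
Qed.

Lemma psum_delta q : nm q < 1 -> psum delta q = q * psum eta_seq q.
Proof. by move=> q1; rewrite (psum_recl subexp_delta q1) add0r. Qed.

Lemma delta_neq0 z : HH z -> psum delta (nome z) != 0.
Proof.
move=> zH; have q1 := nome_lt1 zH; rewrite psum_delta// mulf_neq0 ?nome_neq0//.
by apply: contra_eq_neq (psum_eta_inv q1) => ->; rewrite mul0r eq_sym oner_eq0.
Qed.

Lemma psum_theta_delta q : nm q < 1 ->
  psum (theta delta) q = psum e2 q * psum delta q.
Proof.
move=> q1; rewrite (psum_recl (subexp_theta subexp_delta) q1) {1}/theta mul0r add0r.
have -> : (fun n => theta delta n.+1) = (fun n => eta_seq n + theta eta_seq n).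
  by apply/funext => n; rewrite /theta /= -natr1; ring.
rewrite psumD//; [|exact: subexp_eta|exact: subexp_theta subexp_eta].
rewrite theta_exps ?s24_0// psum_cmul//; [|exact: subexp_s24|exact: subexp_eta].
rewrite psumZ//; last exact: subexp_sigma.
by rewrite psum_delta// psum_e2//; ring.
Qed.

End ModularSeries.

(** * Modular forms of weights 12, 4 and 6 *)

Section ModularForms.
Variable R : realType.
Local Notation C := (R[i]^o).
Local Notation HH := (@upper_half_plane R).
Local Notation tpi := (@tpi R).
Local Notation e2 := (@e2 R).
Local Notation delta := (@delta R).
Implicit Types (a b s : nat -> C) (q u v w z : C).

(** [p] stands for the real or the imaginary part. *)
Lemma is_derive0_line (f : C -> C) (p : R[i] -> R) (z0 d : C) (t : R) :
  p 0 = 0 -> {morph p : x y / x - y} ->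
  (forall (F : set_system R) (FF : Filter F) (k : R -> C) (l : C),
     k @ F --> l -> p (k r) @[r --> F] --> p l) ->
  (forall (r : R) x, p (r%:C * x) = r * p x) ->
  cder f (z0 + t%:C * d) 0 ->
  is_derive t 1 (fun r : R => p (f (z0 + r%:C * d))) 0.
Proof.
move=> p0 pB pc pZ [phi fE cphi].
pose g (r : R) : C := z0 + r%:C * d.
have gc : (fun h : R => g (h + t)) @ (0 : R)^' --> g t.
  apply/cvg_nmP => e e0.
  have De : 0 < e / (nm d + 1) by rewrite divr_gt0// ltr_wpDl ?nm_ge0.
  have : \forall h \near (0 : R)^', `|h| <= e / (nm d + 1).
    apply: (@nbhs_dnbhs _ (0 : R)); have /cvgrPdist_le := @cvg_id _ (nbhs (0 : R)).
    by move=> /(_ _ De); apply: filterS => h; rewrite sub0r normrN.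
  apply: filterS => h hle.
  have -> : g (h + t) - g t = h%:C * d by rewrite /g rmorphD mulrDl; ring.
  rewrite nmM nm_real; apply: (@le_trans _ _ (e / (nm d + 1) * nm d)).
    by rewrite ler_wpM2r ?nm_ge0.
  rewrite mulrAC ler_pdivrMr; last by rewrite ltr_wpDl ?nm_ge0.
  by apply: ler_wpM2l; [exact: ltW|rewrite lerDl].
have lim0 : (fun h : R => h^-1 *: ((fun r : R => p (f (g r))) (h *: 1 + t) - p (f (g t))))
    @ (0 : R)^' --> (0 : R).
  have h0 : (fun h : R => phi (g (h + t))) @ (0 : R)^' --> (0 : C).
    by move=> A /cphi hA; exact: (gc _ hA).
  have h1 : (fun h : R => phi (g (h + t)) * d) @ (0 : R)^' --> (0 * d : C).
    exact: (cvgcM h0 (cvgc_cst d)).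
  have h2 : p (phi (g (h + t)) * d) @[h --> (0 : R)^'] --> (0 : R).
    have h3 := pc _ _ _ _ h1; rewrite mul0r p0 in h3; exact: h3.
  apply: cvg_trans h2; apply: near_eq_cvg; near=> h.
  have hn0 : h != 0 by near: h; exact: nbhs_dnbhs_neq.
  rewrite /= [h *: 1]mulr1 -pB fE.
  have -> : g (h + t) - (z0 + t%:C * d) = h%:C * d by rewrite /g rmorphD mulrDl; ring.
  by rewrite mulrCA pZ [_ *: _]mulrA mulVf// mul1r.
by split; [apply/cvg_ex; exists 0|apply/cvg_lim].
Unshelve. all: by end_near. Qed.

Lemma HH_segment z0 z1 (t : R) : HH z0 -> HH z1 -> 0 <= t <= 1 ->
  HH (z0 + t%:C * (z1 - z0)).
Proof.
rewrite /upper_half_plane /= ImcD ImcM ImcB /= mul0r addr0.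
move: (complex.Im z0) (complex.Im z1) => x y x0 y0 /andP[t0 t1].
have [->|tn] := eqVneq t 0; first by rewrite mul0r addr0.
have tp : 0 < t by rewrite lt_def tn.
have := mulr_gt0 tp y0; have : 0 <= (1 - t) * x.
  by apply: mulr_ge0; [rewrite subr_ge0|exact: ltW].
by rewrite mulrBl mulrBr mul1r => h1 h2; lra.
Qed.

(** Mean value theorem for the real and imaginary parts along a segment. *)
Lemma cder0_const (f : C -> C) z0 z1 : (forall z, HH z -> cder f z 0) ->
  HH z0 -> HH z1 -> f z1 = f z0.
Proof.
move=> hf h0 h1.
have key (p : R[i] -> R) : p 0 = 0 -> {morph p : x y / x - y} ->
    (forall (F : set_system R) (FF : Filter F) (k : R -> C) (l : C),
       k @ F --> l -> p (k r) @[r --> F] --> p l) ->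
    (forall (r : R) x, p (r%:C * x) = r * p x) -> p (f z1) = p (f z0).
  move=> p0 pB pc pZ.
  pose F (r : R) : R := p (f (z0 + r%:C * (z1 - z0))).
  have dF (t : R) : 0 <= t <= 1 -> is_derive t 1 F 0.
    move=> t01; apply: (is_derive0_line p0 pB pc pZ).
    by apply: hf; exact: HH_segment.
  have cF : {within `[0, 1], continuous F}.
    apply: derivable_within_continuous => t; rewrite in_itv/= => t01.
    by have [] := dF t t01.
  have [t|c _] := @MVT_segment R F (fun=> 0) 0 1 ler01 _ cF.
    by rewrite in_itv/= => /andP[a b]; apply: dF; rewrite !ltW.
  have e1 : z0 + (1 : R)%:C * (z1 - z0) = z1 by rewrite rmorph1 mul1r addrC subrK.
  have e0 : z0 + (0 : R)%:C * (z1 - z0) = z0 by rewrite rmorph0 mul0r addr0.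
  by rewrite /F e1 e0 mul0r => /eqP; rewrite subr_eq0 => /eqP.
apply/eqP; rewrite eq_complex; apply/andP; split; apply/eqP.
- apply: key => //; first exact: RecB.
    by move=> F FF k l; exact: cvg_Re.
  by move=> r x; rewrite RecM /= mul0r subr0.
- apply: key => //; first exact: ImcB.
    by move=> F FF k l; exact: cvg_Im.
  by move=> r x; rewrite ImcM /= mul0r addr0.
Qed.

(** The coefficient sequences of the modular forms of weight [w]. Invariance
    under [z -> z + 1] is built into the expansion, so that only the inversion is
    required. *)
Definition mform (w : nat) b : Prop := subexp b /\
  forall z, HH z -> psum b (nome (- z^-1)) = z ^+ w * psum b (nome z).

(** Both [Delta (- 1 / z)] and [z ^ 12 * Delta z] have the logarithmic
    derivative [12 / z + 2 pi i E_2], and they agree at [i]. *)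
Lemma mform_delta : mform 12 delta.
Proof.
split=> [|z zH]; first exact: subexp_delta.
have sd := @subexp_delta R; have t0 := tpi_neq0 R.
pose N v : C := psum delta (nome (- v^-1)).
pose D v : C := v ^+ 12 * psum delta (nome v).
have D0 v : HH v -> D v != 0.
  move=> vH; apply: mulf_neq0; first by rewrite expf_neq0 ?HH_neq0.
  exact: delta_neq0.
pose l v : C := 12 * v^-1 + tpi * psum e2 (nome v).
have dN v : HH v -> cder N v (l v * N v).
  move=> vH; have v0 := HH_neq0 vH.
  have h := cder_comp (cder_negV v0) (cder_qexp sd (HH_inv vH)).
  apply: cder_eq h _; rewrite (psum_theta_delta (nome_lt1 (HH_inv vH))).
  rewrite (e2_law vH) -/(N v) /l; move: (N v) (psum e2 _) => n e.
  by move: t0; move: tpi => t t0; field; rewrite t0 v0.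
have dD v : HH v -> cder D v (l v * D v).
  move=> vH; have v0 := HH_neq0 vH.
  have h := cderM (cderX 11 (cder_id v)) (cder_qexp sd vH).
  apply: cder_eq h _; rewrite (psum_theta_delta (nome_lt1 vH)) /l /D.
  by move: (psum e2 _) (psum delta _) => e n; field.
have dQ v : HH v -> cder (fun v => N v * (D v)^-1) v 0.
  move=> vH; have Dv := D0 v vH.
  have h := cderM (dN v vH) (cder_comp (dD v vH) (cderV Dv)).
  apply: cder_eq h _; set y := (_ \o D) v; have -> : y = (D v)^-1 by [].
  by move: (N v) (l v) Dv; move: (D v) => x n e x0; field.
have iH : HH 'i%C by rewrite /upper_half_plane /= ltr01.
have iE : - ('i%C : C)^-1 = 'i%C.
  apply/eqP; rewrite eq_complex /= mul0r expr0n/= add0r expr1n invr1 mulr1.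
  by rewrite oppr0 opprK !eqxx.
have i12 : ('i%C : C) ^+ 12 = 1.
  have i2 : ('i%C : C) ^+ 2 = -1 by exact: sqr_i.
  by rewrite (_ : 12 = 2 * 6)%N// exprM i2 -signr_odd expr0.
have Di := D0 _ iH.
have := cder0_const dQ iH zH.
have -> : N 'i%C * (D 'i%C)^-1 = 1.
  by rewrite -[N _](_ : D 'i%C = _) ?divff// /D /N iE i12 mul1r.
by move=> /(canRL (mulfVK (D0 z zH))); rewrite mul1r.
Qed.

Lemma mform_unit : mform 0 (@unit_seq R).
Proof.
by split=> [|z _]; [exact: subexp_unit|rewrite !psum_unit mulr1].
Qed.

Lemma mformM (w v : nat) a b : mform w a -> mform v b -> mform (w + v) (cmul a b).
Proof.
move=> [sa ha] [sb hb]; split=> [|z zH]; first exact: subexp_cmul.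
rewrite !psum_cmul ?nome_lt1//; last exact: HH_inv.
by rewrite ha// hb// exprD; ring.
Qed.

Lemma mformD (w : nat) a b : mform w a -> mform w b -> mform w (fun n => a n + b n).
Proof.
move=> [sa ha] [sb hb]; split=> [|z zH]; first exact: subexpD.
rewrite !psumD ?nome_lt1//; last exact: HH_inv.
by rewrite ha// hb// mulrDr.
Qed.

Lemma mformZ (w : nat) (k : C) b : mform w b -> mform w (fun n => k * b n).
Proof.
move=> [sb hb]; split=> [|z zH]; first exact: subexpZ.
rewrite !psumZ ?nome_lt1//; last exact: HH_inv.
by rewrite hb// mulrCA.
Qed.

(** [E_4] and [E_6] by Ramanujan's formulas, as differential polynomials in
    [E_2]: their modularity follows from the law of [E_2]. *)
Definition e4 : nat -> C := fun n => cmul e2 e2 n + (-12) * theta e2 n.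
Definition e6 : nat -> C := fun n => cmul e2 e4 n + (-3) * theta e4 n.

Lemma subexp_e4 : subexp e4.
Proof.
apply: subexpD; first by apply: subexp_cmul; exact: subexp_e2.
by apply: subexpZ; apply: subexp_theta; exact: subexp_e2.
Qed.

Lemma subexp_e6 : subexp e6.
Proof.
apply: subexpD; first by apply: subexp_cmul; [exact: subexp_e2|exact: subexp_e4].
by apply: subexpZ; apply: subexp_theta; exact: subexp_e4.
Qed.

Lemma psum_e4 q : nm q < 1 ->
  psum e4 q = psum e2 q ^+ 2 - 12 * psum (theta e2) q.
Proof.
have s2 := @subexp_e2 R; have s2' := subexp_theta s2.
move=> q1; rewrite /e4 psumD//; [|exact: subexp_cmul|exact: subexpZ].
by rewrite psumZ// psum_cmul// expr2 mulNr.
Qed.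

Lemma psum_e6 q : nm q < 1 ->
  psum e6 q = psum e2 q * psum e4 q - 3 * psum (theta e4) q.
Proof.
have s2 := @subexp_e2 R; have s4 := subexp_e4; have s4' := subexp_theta s4.
move=> q1; rewrite /e6 psumD//; [|exact: subexp_cmul|exact: subexpZ].
by rewrite psumZ// psum_cmul// mulNr.
Qed.

Lemma mform_e4 : mform 4 e4.
Proof.
split=> [|z zH]; first exact: subexp_e4.
have t0 := tpi_neq0 R; have s2 := @subexp_e2 R.
rewrite !psum_e4 ?nome_lt1//; last exact: HH_inv.
have h := cderD (cderM (cderX 1 (cder_id z)) (cder_qexp s2 zH))
  (cderZ (12 / tpi) (cder_id z)).
have law v : HH v -> psum e2 (nome (- v^-1)) =
    v ^+ 2 * psum e2 (nome v) + 12 / tpi * v.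
  by move=> vH; rewrite e2_law//; congr (_ + _); exact: mulrAC.
have := theta_law s2 zH law h.
rewrite (law z zH) /=; move: (psum e2 (nome z)) (psum (theta e2) (nome z)) (psum (theta e2) _).
move: t0; move: tpi => t t0 E T T' {}h.
have -> : T' = t^-1 * (t * T') by rewrite mulKf.
by rewrite h; field.
Qed.

Lemma mform_e6 : mform 6 e6.
Proof.
split=> [|z zH]; first exact: subexp_e6.
have t0 := tpi_neq0 R; have s4 := subexp_e4.
rewrite !psum_e6 ?nome_lt1//; last exact: HH_inv.
have h := cderM (cderX 3 (cder_id z)) (cder_qexp s4 zH).
have := theta_law s4 zH mform_e4.2 h.
rewrite (e2_law zH) (mform_e4.2 z zH) /=.
move: (psum e2 (nome z)) (psum e4 (nome z)) (psum (theta e4) (nome z)) (psum (theta e4) _).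
move: t0; move: tpi => t t0 E F T T' {}h.
have -> : T' = t^-1 * (t * T') by rewrite mulKf.
by rewrite h; field.
Qed.

Lemma sigma1 : sigma 1 = 1%N.
Proof. by rewrite /sigma /divisors /= big_seq1. Qed.

Lemma e2_0 : e2 0 = 1. Proof. by rewrite /e2 /= mulr0 addr0. Qed.
Lemma e2_1 : e2 1 = -24. Proof. by rewrite /e2 /= sigma1 mulr1 add0r. Qed.
Lemma e4_0 : e4 0 = 1. Proof. by rewrite /e4 cmul0 /theta mul0r mulr0 e2_0; ring. Qed.
Lemma e4_1 : e4 1 = 240. Proof. by rewrite /e4 cmul1 /theta e2_0 e2_1; ring. Qed.
Lemma e6_0 : e6 0 = 1.
Proof. by rewrite /e6 cmul0 /theta mul0r mulr0 e2_0 e4_0; ring. Qed.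
Lemma e6_1 : e6 1 = -504.
Proof. by rewrite /e6 cmul1 /theta e2_0 e2_1 e4_0 e4_1; ring. Qed.

End ModularForms.

(** * The structure of the spaces of modular forms *)

Section Structure.
Variable R : realType.
Local Notation C := (R[i]^o).
Local Notation HH := (@upper_half_plane R).
Local Notation e2 := (@e2 R).
Local Notation e4 := (@e4 R).
Local Notation e6 := (@e6 R).
Local Notation delta := (@delta R).
Implicit Types (a b h : nat -> C) (q z : C) (w n : nat).

Lemma rat_nat n : is_rational (n%:R : C).
Proof. by exists n%:R; rewrite ratr_nat. Qed.

Lemma ratD (x y : C) : is_rational x -> is_rational y -> is_rational (x + y).
Proof. by move=> [r ->] [s ->]; exists (r + s); rewrite rmorphD. Qed.

Lemma ratN (x : C) : is_rational x -> is_rational (- x).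
Proof. by move=> [r ->]; exists (- r); rewrite rmorphN. Qed.

Lemma ratB (x y : C) : is_rational x -> is_rational y -> is_rational (x - y).
Proof. by move=> hx hy; apply: ratD => //; exact: ratN. Qed.

Lemma ratM (x y : C) : is_rational x -> is_rational y -> is_rational (x * y).
Proof. by move=> [r ->] [s ->]; exists (r * s); rewrite rmorphM. Qed.

Lemma ratV (x : C) : is_rational x -> is_rational x^-1.
Proof. by move=> [r ->]; exists r^-1; rewrite fmorphV. Qed.

Lemma ratX (x : C) n : is_rational x -> is_rational (x ^+ n).
Proof. by move=> [r ->]; exists (r ^+ n); rewrite rmorphXn. Qed.

Lemma rat_sum n (f : 'I_n -> C) : (forall i, is_rational (f i)) ->
  is_rational (\sum_(i < n) f i).
Proof.
move=> hf; apply: (big_ind (@is_rational R)) => //; last exact: ratD.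
exact: (rat_nat 0).
Qed.

Definition ratseq b : Prop := forall n, is_rational (b n).

Lemma ratseqD a b : ratseq a -> ratseq b -> ratseq (fun n => a n + b n).
Proof. by move=> ha hb n; exact: ratD. Qed.

Lemma ratseqZ (k : C) b : is_rational k -> ratseq b -> ratseq (fun n => k * b n).
Proof. by move=> hk hb n; exact: ratM. Qed.

Lemma ratseq_theta b : ratseq b -> ratseq (theta b).
Proof. by move=> hb n; apply: ratM => //; exact: rat_nat. Qed.

Lemma ratseq_cmul a b : ratseq a -> ratseq b -> ratseq (cmul a b).
Proof. by move=> ha hb n; apply: rat_sum => i; exact: ratM. Qed.

Lemma ratseq_exps s : ratseq s -> ratseq (exps s).
Proof.
move=> hs n; have [m nm'] := ubnP n; elim: m n nm' => // m IH [|n] nm'.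
  by rewrite exps0; exact: (rat_nat 1).
have n0 : n.+1%:R != 0 :> C by rewrite pnatr_eq0.
rewrite -[exps s _](mulKf n0) expsS; apply: ratM; first exact/ratV/rat_nat.
apply: rat_sum => j; apply: ratM => //; apply: IH.
by have := ltn_ord j; lia.
Qed.

Lemma ratseq_unit : ratseq (@unit_seq R).
Proof. by case=> [|n]; [exact: (rat_nat 1)|exact: (rat_nat 0)]. Qed.

Lemma ratseq_sigma : ratseq (sigmaC R).
Proof. by case=> [|n]; [exact: (rat_nat 0)|exact: rat_nat]. Qed.

Lemma ratseq_e2 : ratseq e2.
Proof.
apply: ratseqD; first exact: ratseq_unit.
by apply: ratseqZ; [exact/ratN/rat_nat|exact: ratseq_sigma].
Qed.

Lemma ratseq_e4 : ratseq e4.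
Proof.
apply: ratseqD; first by apply: ratseq_cmul; exact: ratseq_e2.
by apply: ratseqZ; [exact/ratN/rat_nat|exact/ratseq_theta/ratseq_e2].
Qed.

Lemma ratseq_e6 : ratseq e6.
Proof.
apply: ratseqD; first by apply: ratseq_cmul; [exact: ratseq_e2|exact: ratseq_e4].
by apply: ratseqZ; [exact/ratN/rat_nat|exact/ratseq_theta/ratseq_e4].
Qed.

Lemma ratseq_delta : ratseq delta.
Proof.
case=> [|n]; first exact: (rat_nat 0).
by apply: ratseq_exps; apply: ratseqZ; [exact/ratN/rat_nat|exact: ratseq_sigma].
Qed.

(** [Delta] has a simple zero at the cusp and no zero in the half-plane, so it
    divides every form that vanishes at the cusp. *)
Lemma delta_dvd b : subexp b -> b 0%N = 0 ->
  exists2 h, subexp h & b = cmul delta h.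
Proof.
move=> hb b0; exists (cmul (@eta_inv R) (fun n => b n.+1)).
  by apply: subexp_cmul; [exact: subexp_eta_inv|exact: subexp_shift].
have hV := @subexp_eta_inv R; have hD := @subexp_delta R.
have hS := subexp_shift hb.
apply: psum_inj => // [|x x01]; first by do 2![apply: subexp_cmul => //].
have x1 : nm (x%:C : C) < 1 by rewrite nm_real gtr0_norm; lra.
rewrite psum_cmul//; last exact: subexp_cmul.
rewrite psum_cmul// (psum_recl hb x1) b0 add0r psum_delta//.
by rewrite -mulrA (mulrA (psum (@eta_seq R) _)) psum_eta_inv// mul1r.
Qed.

Lemma cusp_dvd w b : mform (w + 12) b -> b 0%N = 0 ->
  exists2 h, mform w h & b = cmul delta h.
Proof.
move=> [hb hS] b0; have [h hh bE] := delta_dvd hb b0; exists h => //.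
split=> // z zH; have hD := @subexp_delta R.
have z0 := HH_neq0 zH.
have := hS z zH; rewrite bE !psum_cmul ?nome_lt1//; last exact: HH_inv.
rewrite (mform_delta R).2// exprD => E.
have d0 := delta_neq0 zH; have z12 : z ^+ 12 != 0 by rewrite expf_neq0.
apply: (mulfI (mulf_neq0 z12 d0)); rewrite E.
by move: (psum delta _) (psum h _) => x y; rewrite !mulrA; congr (_ * _); ring.
Qed.

(** The quotient by [Delta] would be a form of negative weight. *)
Lemma cusp_low w b : ~~ odd w -> (w < 12)%N -> mform w b -> b 0%N = 0 ->
  b = (fun=> 0).
Proof.
move=> we w12 [hb hS] b0; have [h hh bE] := delta_dvd hb b0.
suff h0 : forall n, h n = 0.
  by rewrite bE; apply/funext => n; apply: big1 => i _; rewrite h0 mulr0.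
have hD := @subexp_delta R.
have [t t0 wt] : exists2 t, (0 < t)%N & (w + 2 * t = 12)%N.
  by exists (6 - w./2)%N; have := odd_double_half w; rewrite (negbTE we); lia.
apply: (negative_weight t0 hh) => z zH.
have z0 := HH_neq0 zH; have d0 := delta_neq0 zH.
have := hS z zH; rewrite bE !psum_cmul ?nome_lt1//; last exact: HH_inv.
rewrite (mform_delta R).2// -wt exprD => E; rewrite -nmX -nmM; congr nm.
have zw : z ^+ w != 0 by rewrite expf_neq0.
apply: (mulfI (mulf_neq0 zw d0)).
rewrite -[in RHS]mulrA -E.
by move: (psum delta _) (psum h _) => x y; ring.
Qed.

(** A form of weight 2 with constant term [c] yields [c E_6] when multiplied by
    [E_4], and [c ^ 2 E_4] when squared; comparing the coefficients of [q] leaves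
    only [c = 0]. *)
Lemma mform2_eq0 b : mform 2 b -> b = (fun=> 0).
Proof.
move=> hb; apply: (@cusp_low 2) => //; set c := b 0%N.
have diff w (f g : nat -> C) : ~~ odd w -> (w < 12)%N -> mform w f -> mform w g ->
    f 0%N = g 0%N -> f 1%N = g 1%N.
  move=> we w12 hf hg fg0.
  have h0 : f 0%N + -1 * g 0%N = 0 by rewrite fg0 mulN1r subrr.
  have := cusp_low we w12 (mformD hf (mformZ (-1) hg)) h0.
  by move=> /(congr1 (fun k => k 1%N)) /eqP; rewrite mulN1r subr_eq0 => /eqP.
have := diff 6%N _ _ isT isT (mformM hb (mform_e4 R)) (mformZ c (mform_e6 R)).
rewrite cmul0 e4_0 e6_0 !mulr1 => /(_ erefl); rewrite cmul1 e4_0 e4_1 e6_1 -/c => h1.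
have := diff 4%N _ _ isT isT (mformM hb hb) (mformZ (c ^+ 2) (mform_e4 R)).
rewrite cmul0 e4_0 mulr1 expr2 => /(_ erefl); rewrite cmul1 e4_1 -/c => h2.
have b1 : b 1%N = -744 * c.
  by apply/eqP; rewrite -subr_eq0; apply/eqP; move: h1 => /(canRL (addKr _)); rewrite mulr1 => ->; ring.
have : 1728 * (c * c) = 0.
  have -> : 1728 * (c * c) = c * c * 240 - (c * b 1%N + b 1%N * c) by rewrite b1; ring.
  by rewrite h2 subrr.
by move/eqP; rewrite !mulf_eq0 pnatr_eq0/= orbb => /eqP.
Qed.

(** Products of powers of [E_4] and [E_6] reach every even weight other than 2. *)
Lemma eisenstein w : ~~ odd w -> w != 2 ->
  exists b, [/\ mform w b, ratseq b & b 0%N = 1].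
Proof.
have [m wm] := ubnP w; elim: m w wm => // m IH w wm we w2.
case: (ltnP w 8) => [w8|w8].
  have [->|[->|->]] : w = 0%N \/ w = 4%N \/ w = 6%N.
    by clear wm; move: we w2 w8; case: w => [|[|[|[|[|[|[|[|w]]]]]]]] //=; auto.
  - by exists (@unit_seq R); split; [exact: mform_unit|exact: ratseq_unit|].
  - by exists e4; split; [exact: mform_e4|exact: ratseq_e4|exact: e4_0].
  - by exists e6; split; [exact: mform_e6|exact: ratseq_e6|exact: e6_0].
have [|||b [hb rb b0]] := IH (w - 4)%N.
- by lia.
- by rewrite oddB ?(negbTE we)//; lia.
- by apply/eqP; lia.
exists (cmul b e4); split.
- by rewrite -(@subnK 4 w); [exact: mformM (mform_e4 R)|lia].
- by apply: ratseq_cmul; last exact: ratseq_e4.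
- by rewrite cmul0 b0 e4_0 mulr1.
Qed.

(** A triangular shape, with no condition on the coefficients above the diagonal,
    is preserved by multiplication by [Delta], which shifts the leading terms. *)
Definition echelon w d (F : nat -> nat -> C) : Prop :=
  [/\ forall i, (i < d)%N -> mform w (F i) /\ ratseq (F i),
      forall i j, (j < i)%N -> F i j = 0,
      forall i, F i i = 1
    & forall b, mform w b -> (forall j, (j < d)%N -> b j = 0) -> b = (fun=> 0)].

Lemma cmul_delta_low h i j : (forall l, (l < i)%N -> h l = 0) -> (j <= i)%N ->
  cmul delta h j = 0.
Proof.
move=> h0 ji; apply: big1 => -[[|l] lj] _ /=; first by rewrite mul0r.
by rewrite h0 ?mulr0//; apply: leq_trans ji; rewrite ltn_subrL; case: (j) lj.
Qed.

Lemma cmul_delta_lead h i : (forall l, (l < i)%N -> h l = 0) ->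
  cmul delta h i.+1 = h i.
Proof.
move=> h0; rewrite /cmul big_ord_recl mul0r add0r big_ord_recl/= mul1r subn1.
by rewrite big1 ?addr0// => l _; rewrite h0 ?mulr0// /bump !leq0n; have := ltn_ord l; lia.
Qed.

(** Every form of weight [w] is a multiple of an Eisenstein series plus [Delta]
    times a form of weight [w - 12]. *)
Lemma echelon_exists w : ~~ odd w -> exists d F, echelon w d F.
Proof.
have [m wm] := ubnP w; elim: m w wm => // m IH w wm we.
have [->|w2] := eqVneq w 2%N.
  exists 0%N, (fun i j => (i == j)%:R); split=> //.
  - by move=> i j /gtn_eqF /= ->.
  - by move=> i; rewrite eqxx.
  - by move=> b /mform2_eq0.
have [E [hE rE E0]] := eisenstein we w2.
case: (ltnP w 12) => [w12|w12].
  exists 1%N, (fun i => if i is 0%N then E else fun j => (i == j)%:R); split.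
  - by case.
  - by case=> // i j /gtn_eqF /= ->.
  - by case=> [|i]; rewrite ?E0 ?eqxx.
  - by move=> b hb /(_ 0%N isT) b0; exact (cusp_low we w12 hb b0).
have [||d [F [F1 F2 F3 F4]]] := IH (w - 12)%N; first by lia.
  by rewrite oddB// (negbTE we).
exists d.+1, (fun i => if i is i'.+1 then cmul delta (F i') else E); split.
- move=> [|i] // id; have [hF rF] := F1 i id; split.
    by rewrite -(subnKC w12); apply: mformM => //; exact: mform_delta.
  by apply: ratseq_cmul => //; exact: ratseq_delta.
- by move=> [|i] // j ji; apply: (@cmul_delta_low _ i) => // l; exact: F2.
- by move=> [|i] //; rewrite cmul_delta_lead// => l; exact: F2.
- move=> b hb b0; rewrite -(subnK w12) in hb.
  have [h hh bE] := cusp_dvd hb (b0 0%N isT).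
  suff h0 : h = (fun=> 0).
    by rewrite bE h0; apply/funext => n; apply: big1 => i _; rewrite mulr0.
  apply: F4 => // j; have [l jl] := ubnP j; elim: l j jl => // l IHl j jl jd.
  have hlow i : (i < j)%N -> h i = 0 by move=> ij; apply: IHl; lia.
  by rewrite -(cmul_delta_lead hlow) -bE b0.
Qed.

Section Echelon.
Variables (w d : nat) (F : nat -> nat -> C).
Hypothesis hF : echelon w d F.

(** Subtract [b i F_i] for [i = 0, 1, ...] in turn: the first [d] coefficients of
    the remainder stay rational, and more and more of them vanish. *)
Lemma echelon_rational b : mform w b ->
  (forall j, (j < d)%N -> is_rational (b j)) -> ratseq b.
Proof.
case: hF => F1 F2 F3 F4.
suff key m : forall b, (m <= d)%N -> mform w b ->
    (forall j, (j < d)%N -> is_rational (b j)) ->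
    (forall j, (j < d - m)%N -> b j = 0) -> ratseq b.
  by move=> hb rb; apply: (key d) => // j; rewrite subnn.
elim: m => [|m IH] {}b md hb rb b0.
  rewrite (F4 b hb) => [n|j jd]; first exact: (rat_nat 0).
  by rewrite b0// subn0.
pose i := (d - m.+1)%N; have id : (i < d)%N by rewrite /i; lia.
have [hFi rFi] := F1 i id.
have r : ratseq (fun n => b n + (- b i) * F i n).
  apply: IH; first exact: ltnW.
  - by apply: mformD => //; exact: mformZ.
  - by move=> j jd; apply: ratD; [exact: rb|apply: ratM => //; exact/ratN/rb].
  move=> j jm; have [ji|ij|->] := ltngtP j i; last by rewrite F3 mulr1 subrr.
    by rewrite b0// F2// mulr0 addr0.
  by move: jm ij; rewrite /i; lia.
move=> n; have -> : b n = (b n + (- b i) * F i n) + b i * F i n by ring.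
by apply: ratD; [exact: r|apply: ratM => //; exact: rb].
Qed.

(** As in [echelon_rational]; a form that vanishes at the cusp has no component
    along the member of index 0. *)
Lemma echelon_span b : mform w b -> b 0%N = 0 ->
  exists c : 'I_d.-1 -> C, forall n, b n = \sum_i c i * F i.+1 n.
Proof.
case: hF => F1 F2 F3 F4 hb b0.
suff key m : (m <= d.-1)%N -> forall b, mform w b ->
    (forall j, (j < d - m)%N -> b j = 0) ->
    exists c : nat -> C, forall n, b n = \sum_(d.-1 - m <= i < d.-1) c i * F i.+1 n.
  have [|c hc] := key d.-1 (leqnn _) b hb.
    by move=> j jd; have -> : j = 0%N by lia.
  by exists c => n; rewrite hc subnn big_mkord.
elim: m => [|m IH] md {hb b0}b hb b0.
  exists (fun=> 0) => n; rewrite subn0 big_geq// (F4 b hb)// => j jd.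
  by rewrite b0// subn0.
pose i := (d.-1 - m.+1)%N; have iE : (d.-1 - m = i.+1)%N by rewrite /i; lia.
have id : (i.+1 < d)%N by rewrite /i; lia.
have [hFi _] := F1 _ id.
have [||c hc] := IH (ltnW md) (fun n => b n + (- b i.+1) * F i.+1 n).
- by apply: mformD => //; exact: mformZ.
- move=> j jm; have [ji|ij|->] := ltngtP j i.+1; last by rewrite F3 mulr1 subrr.
    by rewrite b0 ?F2 ?mulr0 ?addr0//; rewrite /i in ji; lia.
  by rewrite /i in ij; lia.
exists (fun l => if l == i then b i.+1 else c l) => n.
rewrite big_ltn; last by rewrite /i; lia.
rewrite eqxx -[b n](subrK (b i.+1 * F i.+1 n)) addrC; congr (_ + _).
rewrite -mulNr hc iE; apply: eq_big_nat => l /andP[il _].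
by rewrite gtn_eqF.
Qed.

Lemma echelon_free (c : 'I_d.-1 -> C) :
  (forall n, \sum_i c i * F i.+1 n = 0) -> forall i, c i = 0.
Proof.
case: hF => F1 F2 F3 F4 hc i; have [m] := ubnP i; elim: m i => // m IH i im.
have := hc i.+1; rewrite (bigD1 i)//= F3 mulr1 big1 ?addr0// => j ji.
have [jl|lj] := ltnP j i; first by rewrite IH ?mul0r//; lia.
rewrite F2 ?mulr0// ltnS ltn_neqAle lj andbT.
by apply: contra ji => /eqP e; rewrite eq_sym; apply/eqP/val_inj.
Qed.

End Echelon.

End Structure.

(** * Cusp forms and their expansions *)

Section CuspExpansions.
Variable R : realType.
Local Notation C := (R[i]^o).
Local Notation HH := (@upper_half_plane R).
Implicit Types (b : nat -> C) (z : C) (w n : nat).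

Lemma moebius_HH (a b c d : int) z : a * d - b * c = 1 -> HH z ->
  c%:~R * z + d%:~R != 0 /\ HH ((a%:~R * z + b%:~R) / (c%:~R * z + d%:~R)).
Proof.
move=> /(congr1 (fun n : int => n%:~R : R)) /=.
rewrite rmorphB !rmorphM rmorph1 /=.
rewrite -!(rmorph_int (real_complex R)).
move: (a%:~R : R) (b%:~R : R) (c%:~R : R) (d%:~R : R) => {}a {}b {}c {}d det.
case: z => x y; rewrite /upper_half_plane /= => y0.
have N0 : 0 < (c * x + d) ^+ 2 + (c * y) ^+ 2.
  rewrite lt_def addr_ge0 ?sqr_ge0// andbT paddr_eq0 ?sqr_ge0// !sqrf_eq0.
  apply/negP => /andP[/eqP h1]; rewrite mulf_eq0 (gt_eqF y0) orbF => /eqP c0.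
  move: h1; rewrite c0 mul0r add0r => d0.
  by move: det; rewrite c0 d0 !mulr0 subrr => /eqP; rewrite eq_sym oner_eq0.
split.
  apply/negP => /eqP[]; rewrite !mul0r subr0 !addr0 => h1 h2.
  by move: N0; rewrite h1 h2 expr0n/= addr0 ltxx.
rewrite !mul0r !subr0 !addr0.
have -> : (a * x + b) * - (c * y / ((c * x + d) ^+ 2 + (c * y) ^+ 2)) +
    a * y * ((c * x + d) / ((c * x + d) ^+ 2 + (c * y) ^+ 2)) =
    (a * d - b * c) * y / ((c * x + d) ^+ 2 + (c * y) ^+ 2).
  by move: (_ + _ ^+ 2) N0 => N N0; field; rewrite gt_eqF.
by rewrite det mul1r divr_gt0.
Qed.

Lemma euclid_step (a c : int) : c != 0 -> (`|(a %% c)%Z| < `|c|)%N.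
Proof. by move=> c0; have := ltz_mod a c0; have := modz_ge0 a c0; lia. Qed.

(** [z |-> z + 1] and [z |-> - 1 / z] generate the modular group: Euclid's
    algorithm on the first column of the matrix. *)
Lemma mform_moebius w b (m n c d : int) z : ~~ odd w -> mform w b ->
  m * d - n * c = 1 -> HH z ->
  psum b (nome ((m%:~R * z + n%:~R) / (c%:~R * z + d%:~R))) =
  (c%:~R * z + d%:~R) ^+ w * psum b (nome z).
Proof.
move=> we [hb hS]; have sgnw (x : C) : (- x) ^+ w = x ^+ w.
  by rewrite exprNn -signr_odd (negbTE we) mul1r.
have shift z' (k : int) : nome (z' + k%:~R) = nome z' :> C.
  by rewrite nomeD nome_int mulr1.
move=> det zH; have [k kc] := ubnP `|c|%N; elim: k m n c d det kc => // k IH m n c d det kc.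
have [c0|c0] := eqVneq c 0.
  rewrite c0 mulr0 subr0 in det.
  have [[m1 d1]|[m1 d1]] : (m = 1 /\ d = 1) \/ (m = -1 /\ d = -1).
    have /eqP := congr1 absz det; rewrite abszM muln_eq1 => /andP[/eqP m1 /eqP d1].
    have [mE|mE] : m = 1 \/ m = -1 by lia.
      by left; split=> //; move: det; rewrite mE mul1r.
    by right; split=> //; move: det; rewrite mE mulN1r => /(canRL opprK).
  - by rewrite c0 m1 d1 !mul1r mul0r add0r divr1 shift expr1n mul1r.
  - rewrite c0 m1 d1 mul0r add0r mulN1r invrN1 mulrN1 opprD opprK.
    by rewrite -rmorphN shift sgnw expr1n mul1r.
pose q := (m %/ c)%Z; pose r := (m %% c)%Z; pose s := n - q * d.
have mE : m = q * c + r := divz_eq m c.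
have nE : n = q * d + s by rewrite /s addrC subrK.
have det1 : r * d - s * c = 1 by rewrite -det {1}mE {1}nE; ring.
have det2 : - c * s - - d * r = 1 by rewrite -det1; ring.
have [D0 _] := moebius_HH det zH.
have [N0 zH'] := moebius_HH det2 zH.
have := hS _ zH'; rewrite (IH _ _ _ _ det2); last first.
  by have := euclid_step m c0; rewrite -/r; lia.
rewrite !rmorphN /= !mulNr -opprD mulNr sgnw.
set x := _ * z + _ in D0 *; set y := _ * z + _ in N0 *.
rewrite mulrA -exprMn divfK// => <-.
rewrite invrN opprK invf_div -(shift (y / x) q); congr (psum b (nome _)).
apply: (mulIf D0); rewrite [RHS]mulrDl !divfK//.
by rewrite /x /y mE nE !rmorphD !rmorphM /=; ring.
Qed.

(** Extension by 0 off the half-plane, so that equality of functions is equality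
    of forms. *)
Definition zero_off b : C -> C :=
  fun z => if 0 < complex.Im z then psum b (nome z) else 0.

Lemma qexp_cvg b z : subexp b -> b 0%N = 0 -> HH z ->
  (\sum_(1 <= n < N) b n * qpar z ^+ n : C) @[N --> \oo] --> psum b (nome z).
Proof.
move=> hb b0 zH; apply: cvgc_near (psum_cvg hb (nome_lt1 zH)).
near=> N; rewrite /series/= big_ltn ?b0 ?mul0r ?add0r ?nome_qpar//.
by near: N; exact: nbhs_infty_gt.
Unshelve. all: by end_near. Qed.

Lemma cusp_form_psum w b : ~~ odd w -> mform w b -> b 0%N = 0 ->
  cusp_form w (zero_off b).
Proof.
move=> we hm b0; have hb := hm.1.
have E z : HH z -> zero_off b z = psum b (nome z) by move=> zH; rewrite /zero_off ifT.
split.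
- by move=> z zH; rewrite /zero_off ifF//; apply/negbTE/negP.
- move=> z zH; apply: cder_derivable; apply: cder_near (cder_qexp hb zH).
  by apply: filterS (near_HH zH) => v vH; rewrite E.
- move=> m n c d z det zH; rewrite !E ?(mform_moebius we hm det)//.
  by have [] := moebius_HH det zH.
- by exists b => z zH; rewrite E//; exact: qexp_cvg.
Qed.

(** Convergence at every point of the disc bounds the terms. *)
Lemma expansion_subexp (g : C -> C) b : has_cusp_expansion g b -> b 0%N = 0 ->
  subexp b /\ forall z, HH z -> g z = psum b (nome z).
Proof.
move=> hg b0; have cv z : HH z -> series (fun n => b n * nome z ^+ n) @ \oo --> g z.
  move=> zH; apply: cvgc_near (hg z zH); near=> N.
  rewrite /series/= [RHS]big_ltn ?b0 ?mul0r ?add0r ?nome_qpar//.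
  by near: N; exact: nbhs_infty_gt.
have hb : subexp b.
  move=> r r01; have [y y0 rE] := nome_imag r01.
  have /cv cz : HH (0 +i* y) by [].
  have /cvg_nmP/(_ 1 ltr01)[N _ hN] := cz; rewrite -rE in hN.
  have t0 n : 0 <= nm (b n) * r ^+ n by rewrite mulr_ge0 ?nm_ge0// exprn_ge0//; lra.
  exists (\sum_(j < N) nm (b j) * r ^+ j + 2) => n.
  have [nN|Nn] := ltnP n N.
    by rewrite (bigD1 (Ordinal nN))//= -addrA lerDl addr_ge0// sumr_ge0.
  apply: ler_wpDl; first by rewrite sumr_ge0.
  have -> : nm (b n) * r ^+ n = nm (b n * (r%:C : C) ^+ n).
    by rewrite nmM nmX nm_real ger0_norm//; lra.
  set S := series _ in hN; have -> : b n * (r%:C : C) ^+ n = (S n.+1 - g (0 +i* y)) - (S n - g (0 +i* y)).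
    by rewrite opprB addrA subrK /S /series/= big_nat_recr//= [_ + b n * _]addrC addrK.
  apply: le_trans (le_nmB _ _) _; have h1 := hN n Nn; have h2 := hN n.+1 (leqW Nn).
  exact: lerD h2 h1.
split=> // z zH; exact: cvgc_unique (cv z zH) (psum_cvg hb (nome_lt1 zH)).
Unshelve. all: by end_near. Qed.

Lemma cusp_form_expansion w (g : C -> C) : cusp_form w g -> exists b,
  [/\ mform w b, b 0%N = 0, g = zero_off b &
      forall n, (0 < n)%N -> fourier_coef g n = b n].
Proof.
move=> [g0 _ gS [b' hb']]; pose cut (f : nat -> C) n := if n is 0%N then 0 else f n.
have hcut f : has_cusp_expansion g f -> has_cusp_expansion g (cut f).
  move=> hf z zH; apply: cvg_trans (hf z zH); apply: near_eq_cvg.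
  apply: nearW => N; apply: eq_big_nat => -[] //.
have [hb gE] := expansion_subexp (hcut _ hb') erefl.
exists (cut b'); split=> //.
- split=> // z zH; have := gS 0 (-1) 1 0 z erefl zH.
  rewrite mul0r add0r mul1r addr0 mulN1r => h.
  by rewrite -!gE//; exact: HH_inv.
- apply/funext => z; rewrite /zero_off; case: ifP => zH; first exact: gE.
  by apply: g0; rewrite /upper_half_plane /= zH.
move=> [|n] // _.
have hc : has_cusp_expansion g (fourier_coef g).
  by apply: (@xgetPex _ (fun=> 0) [set b | has_cusp_expansion g b]); exists b'.
have [hb2 gE2] := expansion_subexp (hcut _ hc) erefl.
have := @qexp_inj _ _ _ hb2 hb _; move=> /(_ _)/(congr1 (fun f => f n.+1)); apply.
by move=> z zH; rewrite -gE// -gE2.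
Qed.

End CuspExpansions.

(** * The dimension of the space of cusp forms *)

Section Dimension.

(** Coordinates of the family [f] in the basis [e] form a matrix with trivial
    left kernel. *)
Lemma free_le_basis (K : fieldType) (V : lmodType K) (S : set V) (d m : nat)
    (e : 'I_d -> V) (f : 'I_m -> V) : is_basis S e -> (forall i, S (f i)) ->
  (forall c : 'I_m -> K, \sum_i c i *: f i = 0 -> forall i, c i = 0) ->
  (m <= d)%N.
Proof.
move=> [_ _ sp] fS ff.
have /choice[M ME] : forall i, exists c : 'I_d -> K, f i = \sum_j c j *: e j.
  by move=> i; exact: sp.
pose A : 'M[K]_(m, d) := \matrix_(i, j) M i j.
suff : row_free A by rewrite /row_free => /eqP <-; exact: rank_leq_col.
rewrite -kermx_eq0; apply/eqP/row_matrixP => i; apply/rowP => j.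
rewrite row0 [RHS]mxE; set v := row i (kermx A).
have vA : v *m A = 0 by apply/eqP; rewrite -sub_kermx row_sub.
apply: (ff (fun l => v 0 l)) j.
under eq_bigr do rewrite ME scaler_sumr; rewrite exchange_big/=.
apply: big1 => l _; under eq_bigr do rewrite scalerA.
have := congr1 (fun u : 'rV_d => u 0 l) vA; rewrite !mxE => vl.
rewrite -scaler_suml; under eq_bigr do rewrite -[M _ _](mxE matrix_key).
by move: vl; under eq_bigr do rewrite mxE; move=> ->; rewrite scale0r.
Qed.

(** The dimension is the size of an arbitrarily chosen basis, which cannot be
    smaller than an independent family. *)
Lemma dimension_ge (K : fieldType) (V : lmodType K) (S : set V) (d : nat)
    (e : 'I_d -> V) : is_basis S e -> (d <= dimension S)%N.
Proof.
move=> he; have [e' he'] : exists e' : 'I_(dimension S) -> V, is_basis S e'.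
  by apply: (@xgetPex _ 0%N [set d | exists e : 'I_d -> V, is_basis S e]); exists d, e.
by have [eS ef _] := he; exact: free_le_basis he' eS ef.
Qed.

Variable R : realType.
Local Notation C := (R[i]^o).
Local Notation HH := (@upper_half_plane R).

Lemma psum_sum d (c : 'I_d -> C) (b : 'I_d -> nat -> C) (q : C) :
  (forall i, subexp (b i)) -> nm q < 1 ->
  subexp (fun n => \sum_i c i * b i n) /\
  psum (fun n => \sum_i c i * b i n) q = \sum_i c i * psum (b i) q.
Proof.
move=> hb q1; elim: d c b hb => [|d IH] c b hb.
  have -> : (fun n => \sum_(i < 0) c i * b i n) = (fun=> 0).
    by apply/funext => n; rewrite big_ord0.
  by split; [exact: subexp_const|rewrite big_ord0 (@psum_fin _ _ _ 0) ?big_ord0].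
have -> : (fun n => \sum_(i < d.+1) c i * b i n) =
    (fun n => c ord0 * b ord0 n + \sum_(i < d) c (lift ord0 i) * b (lift ord0 i) n).
  by apply/funext => n; rewrite big_ord_recl.
have [hs hE] := IH (fun i => c (lift ord0 i)) (fun i => b (lift ord0 i)) (fun i => hb _).
have h0 : subexp (fun n => c ord0 * b ord0 n) by exact: subexpZ.
by split; [exact: subexpD|rewrite psumD// psumZ// hE big_ord_recl].
Qed.

Lemma zero_off_sum d (c : 'I_d -> R[i]) (b : 'I_d -> nat -> C) :
  (forall i, subexp (b i)) ->
  \sum_i c i *: zero_off (b i) = zero_off (fun n => \sum_i (c i : C) * b i n).
Proof.
move=> hb; apply/funext => z; rewrite fct_sumE.
rewrite (eq_bigr (fun i => (c i : C) * zero_off (b i) z))//.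
rewrite /zero_off; case: ifP => zH; last by apply: big1 => i _; rewrite mulr0.
by rewrite (psum_sum c hb (nome_lt1 (zH : HH z))).2.
Qed.

Lemma zero_off_inj a b : subexp a -> subexp b ->
  zero_off a = zero_off b :> (C -> C) -> a = b.
Proof.
move=> ha hb h; apply: qexp_inj => // z zH.
by have := congr1 (fun f => f z) h; rewrite /zero_off (zH : (0 < complex.Im z) = true).
Qed.

(** The members of the triangular family that vanish at the cusp form a basis
    of the space of cusp forms. *)
Lemma echelon_dimension w d F : ~~ odd w -> @echelon R w d F ->
  (d.-1 <= dimension (@cusp_form R w))%N.
Proof.
move=> we hF; have [F1 F2 F3 F4] := hF.
have id (i : 'I_d.-1) : (i.+1 < d)%N by have := ltn_ord i; lia.
have hm (i : 'I_d.-1) := (F1 _ (id i)).1.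
have hs (i : 'I_d.-1) := (hm i).1.
have hsum (c : 'I_d.-1 -> C) : subexp (fun n => \sum_i c i * F i.+1 n).
  by have [] := psum_sum c hs (_ : nm (0 : C) < 1); rewrite ?nm0.
apply: (@dimension_ge _ _ _ _ (fun i : 'I_d.-1 => zero_off (F i.+1))); split.
- by move=> i; apply: cusp_form_psum (hm i) _ => //; exact: F2.
- move=> c; rewrite (zero_off_sum c hs) => h.
  apply: (echelon_free hF) => n.
  have h0 : zero_off (fun n => \sum_i (c i : C) * F i.+1 n) = zero_off (fun=> 0).
    rewrite h; apply/funext => z; rewrite /zero_off; case: ifP => // _.
    by rewrite (@psum_fin _ _ _ 0) ?big_ord0.
  exact: (congr1 (fun f => f n) (zero_off_inj (hsum c) (subexp_const 0) h0)).
- move=> g /(cusp_form_expansion)[b [hb b0 -> _]].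
  have [c hc] := echelon_span hF hb b0; exists c.
  by rewrite (zero_off_sum c hs); congr zero_off; exact/funext.
Qed.

End Dimension.

(** * The kernel of the adjoint of the Serre derivative *)

Section Kernel.
Variable R : realType.
Local Notation C := (R[i]^o).
Local Notation HH := (@upper_half_plane R).
Implicit Types (b : nat -> C) (k n : nat).

Lemma cpow_nat n k : (0 < n)%N -> cpow n%:R (k%:R + 1) = n%:R ^+ k.+1 :> C.
Proof.
move=> n0; rewrite /cpow natr1 cexpMn; congr (_ ^+ _).
rewrite cexpE /= lnK ?posrE ?ltr0n// cos0 sin0 mulr1 mulr0.
by rewrite -(rmorph_nat (real_complex R)).
Qed.

(** After division by [n ^ (k + 1)] there remains [n ^ (-4)], which is summable
    against [sigma m <= m ^ 2]. Hecke's bound gives this exponent from [k = 8] on;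
    there are no nonzero cusp forms of weight below 12. *)
Lemma cusp_coef_bound k b : ~~ odd k -> mform (k + 2) b -> b 0%N = 0 ->
  exists2 K : R, 0 <= K & forall n, (0 < n)%N ->
    nm (b n) * n%:R ^+ 4 <= K * n%:R ^+ k.+1.
Proof.
move=> ke hb b0; have we : ~~ odd (k + 2) by rewrite oddD addbF.
case: (ltnP (k + 2) 12) => [k12|k12].
  by exists 0 => // n _; rewrite (cusp_low we k12 hb b0) nm0 !mul0r.
have kE : (k + 2 = 2 * k./2.+1)%N.
  by have := odd_double_half k; rewrite (negbTE ke); lia.
have [|K K0 hK] := @hecke_bound R b k./2.+1 hb.1 b0.
  by move=> z zH; rewrite hb.2// nmM nmX kE.
exists K => // n n0; have n1 : 1 <= n%:R :> R by rewrite ler1n.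
apply: (@le_trans _ _ (K * n%:R ^+ k./2.+1 * n%:R ^+ 4)).
  by rewrite ler_wpM2r ?exprn_ge0// hK.
rewrite -mulrA -exprD ler_wpM2l// ler_weXn2l//.
by lia.
Qed.

Section Form.
Variables (k : nat) (g : C -> C) (b : nat -> C) (K : R).
Hypothesis gb : forall n, (0 < n)%N -> fourier_coef g n = b n.
Hypothesis K0 : 0 <= K.
Hypothesis hK : forall n, (0 < n)%N -> nm (b n) * n%:R ^+ 4 <= K * n%:R ^+ k.+1.

(** The bound is uniform in [n]; this is what makes the series [mu g] converge in
    the half-plane. *)
Lemma L_E2_bound n : (0 < n)%N ->
  nm (L_E2 g n (k%:R + 1)) <= limn (series (fun m => K / m.+1%:R ^+ 2)).
Proof.
move=> n0; pose t m : C := (sigma m.+1)%:R * b (n + m.+1) / (n + m.+1)%:R ^+ k.+1.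
have tB : dom t (fun m => K / m.+1%:R ^+ 2).
  move=> m; rewrite /t !nmM nmV nmX !nm_nat.
  have p0 : 0 < (n + m.+1)%:R :> R by rewrite ltr0n addn_gt0 n0.
  have m0 : 0 < m.+1%:R :> R by rewrite ltr0n.
  rewrite ler_pdivrMr ?exprn_gt0//.
  have h1 : nm ((sigma m.+1)%:R : C) <= m.+1%:R ^+ 2 := sigmaC_le R m.+1.
  rewrite nm_nat in h1.
  have h2 := hK (_ : 0 < n + m.+1)%N; rewrite addn_gt0 n0 in h2; have {}h2 := h2 isT.
  have h3 : m.+1%:R ^+ 4 <= (n + m.+1)%:R ^+ 4 :> R.
    by apply: lerXn2r; rewrite ?nnegrE ?ler0n// ler_nat leq_addl.
  have h4 : nm (b (n + m.+1)) * m.+1%:R ^+ 4 <= K * (n + m.+1)%:R ^+ k.+1.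
    by apply: le_trans h2; rewrite ler_wpM2l ?nm_ge0.
  have h5 : nm (b (n + m.+1)) <= K * (n + m.+1)%:R ^+ k.+1 / m.+1%:R ^+ 4.
    by rewrite ler_pdivlMr ?exprn_gt0.
  apply: le_trans (ler_pM (ler0n _ _) (nm_ge0 _) h1 h5) _.
  rewrite le_eqVlt; apply/orP; left; apply/eqP.
  by move: (_ ^+ k.+1) m0; move: m.+1%:R => x y x0; field; rewrite gt_eqF.
have sB := summ_inv_sq K0.
have -> : L_E2 g n (k%:R + 1) = tsum t.
  apply: cvg_lim; first exact: norm_hausdorff.
  rewrite -cvg_shiftS; apply: cvgc_near (tsum_cvg sB tB); apply: nearW => N.
  rewrite /series/= big_add1/=; apply: eq_bigr => m _.
  by rewrite gb ?addn_gt0 ?n0// cpow_nat// addn_gt0 n0.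
exact: nm_tsum_le sB tB.
Qed.

Lemma subexp_mu : subexp b ->
  subexp (fun n => if n is 0%N then 0 else mu_coef k g n).
Proof.
move=> hb; set M := limn (series (fun m => K / m.+1%:R ^+ 2)).
have [M0 hM] : 0 <= M /\ forall n, (0 < n)%N -> nm (L_E2 g n (k%:R + 1)) <= M.
  by split; [exact: le_trans (nm_ge0 _) (L_E2_bound (isT : 0 < 1)%N)|exact: L_E2_bound].
pose A : R := nm (k%:R * (k%:R - 1) / (4 * pi%:C) : C).
have A0 : 0 <= A by exact: nm_ge0.
have h1 : subexp (fun n => (A * (k%:R / 12 + 1))%:C * (nm (b n))%:C : C).
  apply: subexpZ; apply: subexp_le hb _ => n.
  by rewrite nm_real ger0_norm ?nm_ge0.
have h2 : subexp (fun n => (A * (2 * n.+1%:R ^+ k * k%:R * M))%:C : C).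
  apply: (@subexp_poly R _ (A * (2 * k%:R * M)) k) => n.
  rewrite nm_real ger0_norm; first by rewrite le_eqVlt; apply/orP; left; apply/eqP; ring.
  by rewrite !mulr_ge0// exprn_ge0.
apply: subexp_le (subexpD h1 h2) _ => -[|n]; first by rewrite nm0 nm_ge0.
rewrite -rmorphM -rmorphD nm_real; apply: le_trans (ler_norm _).
have n1 : 1 <= n.+1%:R :> R by rewrite ler1n.
have n0 : 0 < n.+1%:R :> R by rewrite ltr0n.
rewrite /mu_coef gb// nmM; set X := nm _; set Y := nm _.
have hX : X <= A.
  rewrite /X invfM mulrA nmM -/A nmV nm_nat ler_piMr// invf_le1//.
have hY : Y <= nm (b n.+1) * (k%:R / 12 + 1) + 2 * n.+2%:R ^+ k * k%:R * M.
  apply: le_trans (le_nmB _ _) _; rewrite !nmM; apply: lerD.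
    rewrite ler_wpM2l ?nm_ge0//; apply: le_trans (le_nmB _ _) _; rewrite nm1 lerD2r.
    rewrite nmM nmV nmM !nm_nat ler_wpM2l// lef_pV2 ?posrE ?mulr_gt0//.
    by rewrite ler_peMr.
  rewrite nmX !nm_nat ler_pM ?nm_ge0 ?mulr_ge0 ?exprn_ge0 ?hM//.
  rewrite ler_wpM2r// ler_wpM2l// lerXn2r ?nnegrE ?ler0n// ler_nat.
  by [].
apply: le_trans (ler_pM (nm_ge0 _) (nm_ge0 _) hX hY) _.
by rewrite mulrDr mulrCA [nm _ * _]mulrC.
Qed.

(** The coefficients of [mu g] grow slowly enough for their series to converge
    in the half-plane, so they vanish with its sum. *)
Lemma mu_coef_eq0 n : subexp b -> mu k g = 0 -> (0 < n)%N -> mu_coef k g n = 0.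
Proof.
move=> hb mu0; case: n => // n _; have hc := subexp_mu hb.
set c := fun n => _ in hc; have c0 : c 0%N = 0 by [].
have cE m : (0 < m)%N -> mu_coef k g m = c m by case: m.
rewrite cE//; clearbody c; suff -> : c = (fun=> 0) by [].
apply: (qexp_inj hc (subexp_const 0)) => z zH.
rewrite [RHS](@psum_fin _ _ _ 0) ?big_ord0//.
have h : mu k g z = 0 by rewrite mu0.
rewrite /mu (zH : (0 < complex.Im z) = true) in h; rewrite -h; symmetry.
have sE N : \sum_(1 <= m < N) mu_coef k g m * qpar z ^+ m =
    \sum_(1 <= m < N) c m * qpar z ^+ m.
  by apply: eq_big_nat => m /andP[m0 _]; rewrite cE.
apply: cvg_lim; first exact: norm_hausdorff.
under eq_fun do rewrite sE.
exact: qexp_cvg hc c0 zH.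
Qed.

Lemma kernel_formula n : (0 < k)%N -> k != 1 -> (0 < n)%N -> mu_coef k g n = 0 ->
  L_E2 g n (k%:R + 1) =
    (k%:R - 12 * n%:R) / (24 * n%:R ^+ (k + 1) * k%:R) * fourier_coef g n.
Proof.
move=> k0 k1 n0; rewrite /mu_coef.
have kC : k%:R != 0 :> C by rewrite pnatr_eq0 -lt0n.
have k1C : k%:R - 1 != 0 :> C by rewrite subr_eq0 (eqr_nat _ _ 1).
have nC : n%:R != 0 :> C by rewrite pnatr_eq0 -lt0n.
have pC : pi%:C != 0 :> C by rewrite fmorph_eq0 gt_eqF// pi_gt0.
move/eqP; rewrite !mulf_eq0 !invr_eq0 !mulf_eq0 (negbTE kC) (negbTE k1C).
rewrite (negbTE nC) (negbTE pC) pnatr_eq0 /= subr_eq0 => /eqP E.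
have nkC : n%:R ^+ k != 0 :> C by rewrite expf_neq0.
have alg (x y z L f : C) : x != 0 -> y != 0 -> z != 0 ->
    f * (z / (12 * y) - 1) = 2 * x * z * L ->
    L = (z - 12 * y) / (24 * (x * y) * z) * f.
  move=> x0 y0 z0 {}E; have -> : L = (2 * x * z * L) / (2 * x * z).
    by field; rewrite x0 z0.
  by rewrite -E; field; rewrite x0 y0 z0.
by rewrite exprD expr1; exact: alg nkC nC kC E.
Qed.

End Form.

End Kernel.

Unset Implicit Arguments.
Set Strict Implicit.
Set Printing Implicit Defensive.

Theorem corollary3p4 (R : realType) (k : nat)
  (k_even : ~~ odd k) (k_ge : (7 <= k + 2)%N)
  (g : R[i]^o -> R[i]^o) (g_ker : ker_mu k g)
  (b_rat : forall l : nat,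
    (1 <= l <= dimension (@cusp_form R (k + 2)) + 1)%N ->
    is_rational (fourier_coef g l)) :
  (forall n : nat, (0 < n)%N -> is_rational (L_E2 g n (k%:R + 1))) /\
  (forall n : nat, (0 < n)%N ->
    L_E2 g n (k%:R + 1)
      = (k%:R - 12 * n%:R) / (24 * n%:R ^+ (k + 1) * k%:R)
          * fourier_coef g n).
Proof.
have [gS mu0] := g_ker; have w_even : ~~ odd (k + 2) by rewrite oddD addbF.
have [b [hb b0 _ gb]] := cusp_form_expansion gS.
have [K K0 hK] := cusp_coef_bound k_even hb b0.
have formula n : (0 < n)%N -> L_E2 g n (k%:R + 1) =
    (k%:R - 12 * n%:R) / (24 * n%:R ^+ (k + 1) * k%:R) * fourier_coef g n.
  move=> n0; apply: kernel_formula => //; [by lia|by apply/eqP; lia|].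
  exact (mu_coef_eq0 gb K0 hK hb.1 mu0 n0).
have [d [F hF]] := echelon_exists R w_even.
have b_all : ratseq b.
  apply: (echelon_rational hF hb) => -[|j] jd; first by rewrite b0; exact: (rat_nat R 0).
  rewrite -gb//; apply: b_rat; rewrite addn1 /=; apply: leqW.
  by apply: leq_trans (echelon_dimension w_even hF); lia.
split=> // n n0; rewrite formula// gb//; apply: ratM => //; apply: ratM.
  by apply: ratB; [exact: rat_nat|apply: ratM; exact: rat_nat].
apply: ratV; apply: ratM; last exact: rat_nat.
by apply: ratM; [exact: rat_nat|apply: ratX; exact: rat_nat].
Qed.
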